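(* Let $m\ge 1$ and let $X_{1},\ldots,X_{n}$ be independent, identically distributed random variables with the $m$-component normal mixture density $f(x)=\sum_{j=1}^{m}w_{j}\,\sigma_j^{-1}\phi((x-\mu_{j})/\sigma_{j})$, where $-\infty<\mu_{j}<\infty$, $\sigma_{j}>0$, $w_{j}>0$ for all $j$, and $\sum_{j=1}^{m}w_{j}=1$. For $r\in\{1,2,3,\ldots\}$ let $\widehat{F}_{2r}(x;h)=\frac{1}{n}\sum_{i=1}^{n}G_{2r}((x-X_{i})/h)$ be the kernel estimator of the distribution function $F$ of $f$ with the $(2r)$-th order Gaussian-based kernel $$G_{2r}(x)=\int_{-\infty}^{x}g_{2r}(z)\,\mathrm{d}z,\qquad g_{2r}(x)=\sum_{s=0}^{r-1}\frac{(-1)^{s}}{2^{s}s!}\phi^{(2s)}(x).$$ Then for every $h>0$ and $r=1,2,3,\ldots$, $$\mathrm{ISB}[\widehat{F}_{2r}(\cdot;h)]=-\sum_{s=0}^{r-1}\sum_{t=0}^{r-1}\frac{(-1)^{s+t}}{2^{s+t}s!\,t!}V(h;s+t,2)+2\sum_{s=0}^{r-1}\frac{(-1)^{s}}{2^{s}s!}V(h;s,1)-V(h;0,0),$$ $$\mathrm{IV}[\widehat{F}_{2r}(\cdot;h)]=-\frac{h}{n}\psi(g_{2r})+\frac{1}{n}\sum_{s=0}^{r-1}\sum_{t=0}^{r-1}\frac{(-1)^{s+t}}{2^{s+t}s!\,t!}V(h;s+t,2),$$ where $$V(h;p,q)=h^{2p}\sum_{i=1}^{m}\sum_{j=1}^{m}w_{i}w_{j}\,\sigma_{ij,q}^{1-2p}\,\phi^{(2p-2)}\!\left(\frac{\mu_{j}-\mu_{i}}{\sigma_{ij,q}}\right),\qquad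 \sigma_{ij,q}=\sqrt{\sigma_{i}^{2}+\sigma_{j}^{2}+qh^{2}},$$ and $$\psi(g_{2r})=-\frac{1}{\sqrt{\pi}}\sum_{s=0}^{r-1}\sum_{t=0}^{r-1}\frac{\mathrm{OF}(2s+2t-2)}{2^{2s+2t}s!\,t!}=\frac{\Gamma(2r-3/2)}{\pi\,\Gamma(2r-1)}+\sum_{s=0}^{r-2}\frac{\Gamma(r+s-1/2)}{\pi\,\Gamma(r+s+1)}I_{1/2}(r,s+1),$$ the sum over $s$ in the last expression being zero when $r=1$. Moreover, as $r\to\infty$, $$\psi(g_{2r})=\frac{1}{\pi\sqrt{2r-2}}+\frac{\sqrt{2}}{\pi^{3/2}(4r-3)}+O(r^{-3/2}).$$
   Context: $\phi$ and $\Phi$ are the standard normal density and distribution function. $\phi^{(j)}$ is the $j$-th derivative of $\phi$ for $j\ge 0$ ($\phi^{(0)}=\phi$), and for negative $j$ an iterated antiderivative vanishing at $-\infty$: $\phi^{(-1)}(x)=\Phi(x)$, $\phi^{(-2)}(x)=\phi(x)+x\Phi(x)$. For a symmetric kernel $k$ integrating to one, with $K(x)=\int_{-\infty}^{x}k(z)\,\mathrm{d}z$, $\psi(k)=2\int_{-\infty}^{\infty}xK(x)k(x)\,\mathrm{d}x$; thus $\psi(g_{2r})=2\int_{-\infty}^{\infty}xG_{2r}(x)g_{2r}(x)\,\mathrm{d}x$. Odd factorial: $\mathrm{OF}(2n)=\prod_{i=1}^{n}(2i-1)$ and $\mathrm{OF}(-2n)=(-1)^{n}/\mathrm{OF}(2n)$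 for integers $n\ge 1$, $\mathrm{OF}(0)=1$ (and $\mathrm{OF}(n)=0$ for $n$ odd). $I_{z}(\alpha,\beta)$ is the regularized incomplete beta function, $I_{z}(\alpha,\beta)=\int_{0}^{z}t^{\alpha-1}(1-t)^{\beta-1}\,\mathrm{d}t\big/\int_{0}^{1}t^{\alpha-1}(1-t)^{\beta-1}\,\mathrm{d}t$. For an estimator $\widehat{F}(\cdot;h)$ of $F$: $\mathrm{ISB}[\widehat{F}(\cdot;h)]=\int_{-\infty}^{\infty}\{\mathrm{E}[\widehat{F}(x;h)]-F(x)\}^{2}\,\mathrm{d}x$ (integrated squared bias) and $\mathrm{IV}[\widehat{F}(\cdot;h)]=\int_{-\infty}^{\infty}\mathrm{Var}[\widehat{F}(x;h)]\,\mathrm{d}x$ (integrated variance). *)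

(* Defs.v *)
From HB Require Import structures.
From mathcomp Require Import all_boot all_order all_algebra.
From mathcomp Require Import all_classical all_reals all_analysis.

Set Implicit Arguments.
Unset Strict Implicit.
Unset Printing Implicit Defensive.

Import Order.TTheory GRing.Theory Num.Theory.
Import numFieldNormedType.Exports.

Local Open Scope classical_set_scope.
Local Open Scope ring_scope.

Section analysis.
Context {R : realType}.
Implicit Types (f k : R -> R) (x z a b : R).

Definition antideriv f x : R :=
  \int[@lebesgue_measure R]_(t in `]-oo, x]) f t.

(* The standard normal density. *)
Definition phi : R -> R := normal_pdf 0 1.

(* phi^(j) for an integer j. [Negz n] is - n.+1, so that [dphi (-1)] is the
   standard normal distribution function and [dphi (-2)] its antiderivative. *)
Definition dphi (j : int) : R -> R :=
  match j with
  | Posz n => derive1n n phi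
  | Negz n => iter n.+1 antideriv phi
  end.

Definition psi k : R :=
  2 * \int[@lebesgue_measure R]_x (x * antideriv k x * k x).

(* [Negz n] is - n.+1, and OF(-2i) = (-1)^i / OF(2i). *)
Definition OF (j : int) : R :=
  let oddprod n : R := \prod_(1 <= i < n./2.+1) (2 * i%:R - 1) in
  if odd `|j|%N then 0 else
  match j with
  | Posz n => oddprod n
  | Negz n => (-1) ^+ n.+1./2 / oddprod n.+1
  end.

(* Euler's integral; only meaningful for 0 < a. *)
Definition Gamma a : R :=
  \int[@lebesgue_measure R]_(t in `]0, +oo[) (t `^ (a - 1) * expR (- t)).

Definition inc_beta z a b : R :=
  \int[@lebesgue_measure R]_(t in `]0, z[)
    (t `^ (a - 1) * (1 - t) `^ (b - 1)).

(* I_z(a, b); only meaningful for 0 <= z <= 1 and 0 < a, b. *)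
Definition reg_inc_beta z a b : R := inc_beta z a b / inc_beta 1 a b.

(* The Gaussian-based kernel g_{2r}, indexed by r, and its primitive G_{2r}. *)
Definition gkernel (r : nat) x : R :=
  \sum_(s < r) (-1) ^+ s / (2 ^+ s * s`!%:R) * dphi (2 * s%:Z) x.

Definition Gkernel (r : nat) : R -> R := antideriv (gkernel r).

End analysis.

Section mixture.
Context {R : realType} {m : nat}.
Variables w mu sigma : 'I_m -> R.

Definition mixture_pdf (x : R) : R :=
  \sum_(j < m) w j * (sigma j)^-1 * phi ((x - mu j) / sigma j).

Definition sigma2 (h : R) (i j : 'I_m) (q : nat) : R :=
  Num.sqrt (sigma i ^+ 2 + sigma j ^+ 2 + q%:R * h ^+ 2).

Definition V (h : R) (p q : nat) : R :=
  h ^+ (2 * p) *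
  \sum_(i < m) \sum_(j < m)
    w i * w j * sigma2 h i j q ^ (1 - 2 * p%:Z)
    * dphi (2 * p%:Z - 2) ((mu j - mu i) / sigma2 h i j q).

End mixture.

Section estimation.
Context {d : measure_display} {T : measurableType d} {R : realType}.
Variable P : probability T R.

Definition has_density (X : {RV P >-> R}) (f : R -> R) : Prop :=
  forall A : set R, measurable A ->
    distribution P X A = (\int[lebesgue_measure]_(x in A) (f x)%:E)%E.

Definition mutually_independent (I : finType) (X : I -> {RV P >-> R}) : Prop :=
  forall (J : {set I}) (A : I -> set R),
    (forall i, i \in J -> measurable (A i)) ->
    P (\bigcap_(i in [set` J]) (X i @^-1` A i)) =
    (\prod_(i in J) P (X i @^-1` A i))%E.

Definition Fhat (n : nat) (X : 'I_n -> {RV P >-> R}) (r : nat) (h x : R) :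
    T -> R :=
  fun t => n%:R^-1 * \sum_(i < n) Gkernel r ((x - X i t) / h).

(* In ISB and IV, an estimator of a distribution function is a family [Fh]
   of random variables indexed by the evaluation point. *)
Definition ISB (Fh : R -> T -> R) (F : R -> R) : \bar R :=
  (\int[lebesgue_measure]_x ('E_P[Fh x] - (F x)%:E) ^+ 2)%E.

Definition IV (Fh : R -> T -> R) : \bar R :=
  (\int[lebesgue_measure]_x 'V_P[Fh x])%E.

End estimation.

(* Main.v *)
(* Write D_p for phi^(p-1), so that D_0 is the normal distribution function. All
   quantities are sums of integrals of D_p((x - a) / s) * D_q((b - x) / t), a
   convolution of derivatives of two normal densities, which equals
     s^p * t^q * sg^(1 - p - q) * phi^(p+q-2)((b - a) / sg),
   sg = sqrt(s^2 + t^2).  For p = q = 1 this is completion of the square, for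
   p = 0 or q = 0 Tonelli's theorem, and otherwise integration by parts.

   Hence M = E[Fhat(x)] and F are combinations of functions D_{2s}, and so are
   1 - M and 1 - F because D_0(-u) = 1 - D_0(u).  The integrated squared bias
   follows from
     (M - F)^2 = - M(1 - M) - F(1 - F) + M(1 - F) + F(1 - M),
   whose terms, unlike M and F, are integrable.  By independence
     n Var[Fhat(x)] = M(1 - M) - E[G(1 - G)((x - X_1) / h)],
   and by Fubini's theorem the last term integrates to h * int G(1 - G), which is
   h * psi(g) after an integration by parts.

   The same convolution formula gives the first expression of psi(g).  With
   al_n = binom(2n, n) / 4^n it becomes
     sqrt(pi) psi(g) = sum_(t < r) p_t al_(r-1+t),
     p_t = binom(r-1+t, t) / 2^(r-1+t),
   where p_t is the probability that a fair coin has shown its other side t times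
   when one side appears for the r-th time.  Summation by parts leads to the
   incomplete beta functions, and the asymptotics come from Wallis' bounds
   1 / (n + 1/2) <= pi al_n^2 <= 1 / n together with the first two moments of
   r - t under p. *)
Require Import Defs.
From HB Require Import structures.
From mathcomp Require Import all_boot all_order all_algebra.
From mathcomp Require Import all_classical all_reals all_analysis.
From mathcomp Require Import measurable_realfun ring lra zify.
Import Order.TTheory GRing.Theory Num.Theory.
Import numFieldNormedType.Exports.
Local Open Scope classical_set_scope.
Local Open Scope ring_scope.
Set Implicit Arguments.
Unset Strict Implicit.

(** * Gaussian-dominated functions *)

(** A distribution function tends to 1 at the right, so a product of two of them is not integrable.
    Putting the second factor at a reflected argument, [(b - x) / t], pairs a left tail with a right
    tail. All integrands then are continuous and dominated by some C exp(- e x^2), and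
    integrability, vanishing boundary terms and Fubini's theorem follow from the closure properties
    of that class.

    The coin enters through [OF (2 * n - 2)]: divided by - 2^n n!, it is the backward difference of
    [al] at n, and with n = s + t what remains of the summand of psi is the probability [W s t] of
    passing through the lattice point (s, t). Pascal's rule can then act on the double sum.

    In the asymptotics, [al (r - 1 + t)] is expanded at 2r - 1, since r - t, the distance to that
    point, has a mean in closed form. The linear term produces the second summand of the expansion;
    the quadratic one is of order [al r / r], hence of order r^(-3/2). *)

Section Rintegral_complements.
Context d (T : measurableType d) (R : realType).
Variable nu : {measure set T -> \bar R}.
Implicit Types (f : T -> R) (A : set T).

Lemma EFin_Rintegral A f : measurable A -> nu.-integrable A (EFin \o f) ->
  (\int[nu]_(x in A) (f x)%:E)%E = (\int[nu]_(x in A) f x)%:E.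
Proof. by move=> mA intf; rewrite /Rintegral fineK//; exact: integrable_fin_num. Qed.

Lemma integrable_scale A f (k : R) : measurable A ->
  nu.-integrable A (EFin \o f) -> nu.-integrable A (EFin \o (fun x => k * f x)).
Proof.
move=> mA intf; have := integrableZl mA k intf.
by apply: eq_integrable => // x _; rewrite /= EFinM.
Qed.

Lemma integrable_sumR A (I : Type) (r : seq I) (h : I -> T -> R) : measurable A ->
  (forall i, nu.-integrable A (EFin \o h i)) ->
  nu.-integrable A (EFin \o (fun x => \sum_(i <- r) h i x)).
Proof.
move=> mA hi; have := @integrable_sum _ _ _ nu A mA _ r predT _ (fun i _ => hi i).
by apply: eq_integrable => // x _; rewrite /= sumEFin.
Qed.

Lemma Rintegral_sum A (I : Type) (r : seq I) (h : I -> T -> R) : measurable A ->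
  (forall i, nu.-integrable A (EFin \o h i)) ->
  \int[nu]_(x in A) (\sum_(i <- r) h i x) = \sum_(i <- r) \int[nu]_(x in A) h i x.
Proof.
move=> mA hi; elim: r => [|i r IH].
  by under eq_Rintegral do rewrite big_nil; rewrite big_nil Rintegral_cst// mul0r.
under eq_Rintegral do rewrite big_cons.
rewrite big_cons RintegralD ?IH//; exact: integrable_sumR.
Qed.

End Rintegral_complements.

Section gauss_dominated.
Context {R : realType}.
Notation mu := (@lebesgue_measure R).
Implicit Types (f g F : R -> R).

(* Fixing the measurable structure of [R] here keeps unification fast. *)
Lemma lebesgue_EFin_Rintegral (A : set R) f : measurable A ->
  mu.-integrable A (EFin \o f) ->
  (\int[mu]_(x in A) (f x)%:E)%E = (\int[mu]_(x in A) f x)%:E.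
Proof. by move=> mA fi; rewrite EFin_Rintegral. Qed.

Lemma lebesgue_integrable_scale (A : set R) f (k : R) : measurable A ->
  mu.-integrable A (EFin \o f) -> mu.-integrable A (EFin \o (fun x => k * f x)).
Proof. by move=> mA fi; apply: integrable_scale. Qed.

(** Continuity yields measurability and access to the fundamental theorem of calculus. The rate e is
    existential because sums, affine substitutions and factors x lower it. *)
Definition gdom f := continuous f /\
  exists C e : R, 0 < e /\ forall x, `|f x| <= C * expR (- (e * x ^+ 2)).

(** The multipliers of [gdom]; distribution functions belong here but not to [gdom]. *)
Definition cbounded f := continuous f /\ exists M, forall x, `|f x| <= M.

(** exp(- e x^2) is a multiple of the normal density of variance 1 / (2 e). *)
Lemma gauss_integrable (e : R) : 0 < e ->
  mu.-integrable setT (EFin \o (fun x : R => expR (- (e * x ^+ 2)))).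
Proof.
move=> e0; pose s := Num.sqrt ((2 * e)^-1).
have s2 : s ^+ 2 = (2 * e)^-1 by rewrite sqr_sqrtr// invr_ge0 mulr_ge0// ltW.
have s0 : s != 0 by rewrite gt_eqF// sqrtr_gt0 invr_gt0 mulr_gt0.
have := integrable_normal_pdf 0 s.
move=> /(integrableZl measurableT (normal_peak s)^-1).
apply: eq_integrable => //= x _; rewrite -EFinM normal_pdfE// mulKf.
  by rewrite /normal_fun subr0 s2; congr (expR _)%:E; field; rewrite gt_eqF.
by rewrite gt_eqF// normal_peak_gt0.
Qed.

Lemma gdom_gauss (C e : R) : 0 < e -> gdom (fun x => C * expR (- (e * x ^+ 2))).
Proof.
move=> e0; split.
  move=> z; apply: cvgM; first exact: cvg_cst.
  apply: continuous_comp; last exact: continuous_expR.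
  apply: (@cvgN _ R^o); apply: cvgM; first exact: cvg_cst.
  exact: sqr_continuous.
exists `|C|, e; split => // z.
by rewrite normrM (ger0_norm (expR_ge0 _)).
Qed.

Lemma cbounded_measurable f : cbounded f -> measurable_fun setT f.
Proof. by case=> + _; exact: continuous_measurable_fun. Qed.

Lemma gdom_measurable f : gdom f -> measurable_fun setT f.
Proof. by case=> + _; exact: continuous_measurable_fun. Qed.

Lemma gdom_integrable f : gdom f -> mu.-integrable setT (EFin \o f).
Proof.
move=> [cf [C [e [e0 fe]]]].
have := integrableZl measurableT C (gauss_integrable e0).
apply: le_integrable => //=.
  by apply/measurable_EFinP; exact: continuous_measurable_fun.
by move=> x _; rewrite lee_fin (le_trans (fe x))// ler_norm.
Qed.

Lemma gdom_integrableS (A : set R) f : measurable A -> gdom f ->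
  mu.-integrable A (EFin \o f).
Proof. by move=> mA /gdom_integrable; apply: integrableS. Qed.

Lemma gdom_cst0 : gdom (fun=> 0).
Proof.
split; first by move=> x; exact: cvg_cst.
by exists 0, 1; split => // x; rewrite normr0 mul0r.
Qed.

Lemma gdomD f g : gdom f -> gdom g -> gdom (fun x => f x + g x).
Proof.
move=> [cf [C [e [e0 fe]]]] [cg [C' [e' [e'0 fe']]]]; split.
  by move=> x; apply: cvgD; [exact: cf|exact: cg].
exists (`|C| + `|C'|), (Num.min e e'); split; first by rewrite lt_min e0.
move=> x; rewrite (le_trans (ler_normD _ _))// mulrDl.
have h (D d : R) : Num.min e e' <= d ->
    D * expR (- (d * x ^+ 2)) <= `|D| * expR (- (Num.min e e' * x ^+ 2)).
  move=> dm; apply: (@le_trans _ _ (`|D| * expR (- (d * x ^+ 2)))).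
    by rewrite ler_wpM2r ?expR_ge0 ?ler_norm.
  by rewrite ler_wpM2l// ler_expR lerN2 ler_wpM2r ?sqr_ge0.
by apply: lerD; [apply: le_trans (fe x) _|apply: le_trans (fe' x) _];
  apply: h; rewrite ge_min lexx ?orbT.
Qed.

Lemma gdomMb f g : gdom f -> cbounded g -> gdom (fun x => f x * g x).
Proof.
move=> [cf [C [e [e0 fe]]]] [cg [M gM]]; split.
  by move=> x; apply: cvgM; [exact: cf|exact: cg].
exists (C * M), e; split => // x; rewrite normrM mulrAC.
by apply: ler_pM => //.
Qed.

Lemma cbounded_cst (k : R) : cbounded (fun=> k).
Proof. by split; [move=> x; exact: cvg_cst|exists `|k|]. Qed.

Lemma gdom_cbounded f : gdom f -> cbounded f.
Proof.
move=> [cf [C [e [e0 fe]]]]; split => //; exists `|C| => x.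
apply: le_trans (fe x) _.
apply: (@le_trans _ _ (`|C| * expR (- (e * x ^+ 2)))).
  by rewrite ler_wpM2r ?expR_ge0 ?ler_norm.
by rewrite ler_piMr// expR_le1 oppr_le0 mulr_ge0 ?sqr_ge0// ltW.
Qed.

Lemma cboundedD f g : cbounded f -> cbounded g -> cbounded (fun x => f x + g x).
Proof.
move=> [cf [M fM]] [cg [N gN]]; split.
  by move=> x; apply: cvgD; [exact: cf|exact: cg].
by exists (M + N) => x; rewrite (le_trans (ler_normD _ _))// lerD.
Qed.

Lemma cboundedM f g : cbounded f -> cbounded g -> cbounded (fun x => f x * g x).
Proof.
move=> [cf [M fM]] [cg [N gN]]; split.
  by move=> x; apply: cvgM; [exact: cf|exact: cg].
by exists (M * N) => x; rewrite normrM ler_pM.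
Qed.

Lemma gdomZ (k : R) f : gdom f -> gdom (fun x => k * f x).
Proof.
move=> gf; have := gdomMb gf (cbounded_cst k).
by congr gdom; apply/funext => x; rewrite mulrC.
Qed.

Lemma cboundedZ (k : R) f : cbounded f -> cbounded (fun x => k * f x).
Proof. exact/cboundedM/cbounded_cst. Qed.

Lemma gdom_sum (I : Type) (r : seq I) (P : pred I) (h : I -> R -> R) :
  (forall i, P i -> gdom (h i)) -> gdom (fun x => \sum_(i <- r | P i) h i x).
Proof.
move=> gh; elim: r => [|i r IH].
  by under eq_fun do rewrite big_nil; exact: gdom_cst0.
under eq_fun do rewrite big_cons.
case Pi : (P i); last exact: IH.
by apply: gdomD; [exact: gh|exact: IH].
Qed.

Lemma cbounded_sum (I : Type) (r : seq I) (P : pred I) (h : I -> R -> R) :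
  (forall i, P i -> cbounded (h i)) ->
  cbounded (fun x => \sum_(i <- r | P i) h i x).
Proof.
move=> gh; elim: r => [|i r IH].
  by under eq_fun do rewrite big_nil; exact: cbounded_cst.
under eq_fun do rewrite big_cons.
case Pi : (P i); last exact: IH.
by apply: cboundedD; [exact: gh|exact: IH].
Qed.

Lemma continuous_affine (a s : R) : continuous (fun x : R => (x - a) / s).
Proof.
move=> x; apply: cvgM; last exact: cvg_cst.
by apply: (@cvgB _ R^o); [exact: cvg_id|exact: cvg_cst].
Qed.

Lemma continuous_compR f g : continuous f -> continuous g ->
  continuous (fun x => f (g x)).
Proof. by move=> cf cg x; apply: continuous_comp; [exact: cg|exact: cf]. Qed.

Lemma cbounded_affine (a s : R) f : cbounded f ->
  cbounded (fun x => f ((x - a) / s)).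
Proof.
move=> [cf [M fM]]; split; last by exists M.
by apply: (continuous_compR (g := fun x => (x - a) / s)) => //;
  exact: continuous_affine.
Qed.

(* From [x^2 <= 2 (x - a)^2 + 2 a^2]. *)
Lemma gdom_affine (a s : R) f : s != 0 -> gdom f ->
  gdom (fun x => f ((x - a) / s)).
Proof.
move=> s0 [cf [C [e [e0 fe]]]]; split.
  by apply: (continuous_compR (g := fun x => (x - a) / s)) => //;
    exact: continuous_affine.
have s2 : 0 < s ^+ 2 by rewrite exprn_even_gt0.
have es : 0 < e / s ^+ 2 by rewrite divr_gt0.
exists (`|C| * expR (e / s ^+ 2 * a ^+ 2)), (e / s ^+ 2 / 2); split.
  by rewrite divr_gt0.
move=> x; apply: le_trans (fe _) _; rewrite -[leRHS]mulrA -[X in _ <= _ * X]expRD.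
apply: (@le_trans _ _ (`|C| * expR (- (e * ((x - a) / s) ^+ 2)))).
  by rewrite ler_wpM2r ?expR_ge0 ?ler_norm.
rewrite ler_wpM2l// ler_expR expr_div_n.
rewrite (_ : e * ((x - a) ^+ 2 / s ^+ 2) = e / s ^+ 2 * (x - a) ^+ 2); last by ring.
have : 0 <= (e / s ^+ 2) / 2 * (x - 2 * a) ^+ 2.
  by rewrite mulr_ge0 ?sqr_ge0// divr_ge0// ltW.
lra.
Qed.

(** Half of the exponent absorbs the factor: |x| <= 1 + x^2 <= (1 + 2 / e) exp(e x^2 / 2). *)
Lemma gdom_mulx f : gdom f -> gdom (fun x => x * f x).
Proof.
move=> [cf [C [e [e0 fe]]]]; split.
  by move=> x; apply: cvgM; [exact: cvg_id|exact: cf].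
exists (`|C| * (1 + 2 / e)), (e / 2); split; first by rewrite divr_gt0.
move=> x; rewrite normrM.
apply: (@le_trans _ _ (`|x| * (`|C| * expR (- (e * x ^+ 2))))).
  rewrite ler_wpM2l//; apply: le_trans (fe x) _.
  by rewrite ler_wpM2r ?expR_ge0 ?ler_norm.
rewrite (_ : - (e * x ^+ 2) = - (e / 2 * x ^+ 2) + - (e / 2 * x ^+ 2)); last lra.
rewrite expRD mulrCA -[leRHS]mulrA.
apply: ler_wpM2l => //; rewrite mulrA; apply: ler_wpM2r; rewrite ?expR_ge0//.
rewrite expRN ler_pdivrMr ?expR_gt0//.
have h1 := expR_ge1Dx (e / 2 * x ^+ 2).
have h2 : 0 <= e / 2 * x ^+ 2 by rewrite mulr_ge0 ?sqr_ge0// divr_ge0// ltW.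
have e2 : 0 <= 2 / e by rewrite divr_ge0// ltW.
apply: (@le_trans _ _ (1 + x ^+ 2)).
  rewrite -real_normK ?num_real//; have := sqr_ge0 (`|x| - 1); nra.
apply: (@le_trans _ _ (1 * (1 + e / 2 * x ^+ 2) + 2 / e * (1 + e / 2 * x ^+ 2))).
  have -> : 2 / e * (1 + e / 2 * x ^+ 2) = 2 / e + x ^+ 2.
    by field; rewrite gt_eqF.
  lra.
by rewrite -mulrDl ler_wpM2l// addr_ge0.
Qed.

(** The majorant |C / e| / n comes from exp(u) >= u. Limits along the integers suffice for the
    exhaustions by intervals below. *)
Lemma cvg_gauss_n (C e : R) : 0 < e ->
  C * expR (- (e * n%:R ^+ 2)) @[n --> \oo] --> 0.
Proof.
move=> e0.
have : (n%:R : R)^-1 @[n --> \oo] --> 0.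
  apply/gtr0_cvgV0; last exact: cvgr_idn.
  by near=> n; rewrite ltr0n; near: n; exists 1%N.
move=> hn; have hc : (C / e) * (n%:R : R)^-1 @[n --> \oo] --> 0.
  by rewrite -(mulr0 (C / e)); apply: cvgM => //; exact: cvg_cst.
have hcN : `|C / e| * (n%:R : R)^-1 @[n --> \oo] --> 0.
  by rewrite -(mulr0 `|C / e|); apply: cvgM => //; exact: cvg_cst.
have hcNN : - (`|C / e| * (n%:R : R)^-1) @[n --> \oo] --> 0.
  by rewrite -oppr0; exact: cvgN.
apply: squeeze_cvgr hcNN hcN; near=> n; rewrite -ler_norml normrM.
rewrite (ger0_norm (expR_ge0 _)) normrM -mulrA ler_wpM2l//.
have n0 : (0 < n%:R :> R) by rewrite ltr0n; near: n; exists 1%N.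
have n1 : (1 <= n%:R :> R) by rewrite ler1n; near: n; exists 1%N.
rewrite expRN gtr0_norm ?invr_gt0// -invfM lef_pV2 ?posrE ?expR_gt0 ?mulr_gt0//.
apply: le_trans (expR_ge1Dx _).
apply: (@le_trans _ _ (e * n%:R ^+ 2)); last by rewrite lerDr.
by rewrite ler_wpM2l ?(ltW e0)// expr2 ler_peMr// ltW.
Unshelve. all: by end_near. Qed.

Lemma gdom_cvgy f : gdom f -> f n%:R @[n --> \oo] --> 0.
Proof.
move=> [cf [C [e [e0 fe]]]]; have h := cvg_gauss_n C e0.
have hN : - (C * expR (- (e * n%:R ^+ 2))) @[n --> \oo] --> 0.
  by rewrite -oppr0; exact: cvgN.
by apply: squeeze_cvgr hN h; near=> n; rewrite -ler_norml.
Unshelve. all: by end_near. Qed.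

Lemma gdom_cvgNy f : gdom f -> f (- n%:R) @[n --> \oo] --> 0.
Proof.
move=> gf; have N10 : (-1 : R) != 0 by rewrite oppr_eq0 oner_eq0.
have := gdom_cvgy (gdom_affine 0 N10 gf).
by under eq_fun do rewrite subr0 invrN invr1 mulrN1.
Qed.

Lemma integral_itvFTC f F (a b : R) : a < b -> continuous f ->
  (forall x : R, is_derive x 1 F (f x)) ->
  (\int[mu]_(x in `[a, b]) (f x)%:E = (F b - F a)%:E)%E.
Proof.
move=> ab cf dF; rewrite (@continuous_FTC2 _ f F)//.
- exact: continuous_subspaceT.
- have cF : continuous F.
    move=> x; apply/differentiable_continuous/derivable1_diffP.
    by have [] := dF x.
  split.
  + by move=> x _; have [] := dF x.
  + by apply: cvg_at_right_filter; exact: cF.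
  + by apply: cvg_at_left_filter; exact: cF.
- by move=> x _; rewrite derive1E; have [] := dF x.
Qed.

(** The fundamental theorem on intervals that fill [A], followed by dominated convergence with |f|
    as majorant. Half-lines and the whole line are both instances. *)
Lemma Rintegral_exhaust (A : set R) f F (a b : nat -> R) (l : R) :
  measurable A -> mu.-integrable A (EFin \o f) -> continuous f ->
  (forall x : R, is_derive x 1 F (f x)) ->
  (forall n, a n < b n) -> (forall n, `[a n, b n] `<=` A) ->
  (forall x, A x -> \forall n \near \oo, x \in `[a n, b n]) ->
  F (b n) - F (a n) @[n --> \oo] --> l ->
  \int[mu]_(x in A) f x = l.
Proof.
move=> mA intf cf dF ab abA Aab Fl.
pose fn n := (EFin \o f) \_ `[a n, b n].
have mf : measurable_fun A (EFin \o f).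
  by apply/measurable_EFinP/measurable_funTS; exact: continuous_measurable_fun.
have [] := @dominated_convergence _ _ R mu A mA fn (EFin \o f) (abse \o (EFin \o f)).
- move=> n; apply: measurable_funTS.
  apply/(measurable_restrictT _ _).1 => //.
  by apply/measurable_EFinP/measurable_funTS; exact: continuous_measurable_fun.
- exact: mf.
- apply: aeW => x Ax; apply: cvg_near_cst.
  near=> n; rewrite /fn patchT// inE/=.
  by near: n; exact: Aab.
- exact: integrable_abse.
- apply: aeW => x n Ax; rewrite /fn /patch; case: ifPn => //=.
  by rewrite normr0 lee_fin.
move=> _ _ h.
have {}h : (F (b n) - F (a n))%:E @[n --> \oo] --> (\int[mu]_(x in A) (f x)%:E)%E.
  move: h; apply: cvg_trans; apply: near_eq_cvg; near=> n.
  rewrite /fn /= -integral_mkcondr setIidr//.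
  exact: integral_itvFTC.
have h2 : (F (b n) - F (a n))%:E @[n --> \oo] --> l%:E.
  by apply: cvg_EFin => //; exact: nearW.
rewrite /Rintegral.
by rewrite -(cvg_lim _ h)// (cvg_lim _ h2).
Unshelve. all: by end_near. Qed.

Lemma antideriv_primitive f F (x : R) : continuous f ->
  mu.-integrable `]-oo, x] (EFin \o f) ->
  (forall y : R, is_derive y 1 F (f y)) ->
  F (- n%:R) @[n --> \oo] --> 0 ->
  antideriv f x = F x.
Proof.
move=> cf intf dF F0.
(* The intervals must be non-degenerate for every n, so the left end points start beyond |x|. *)
pose k := (Num.truncn `|x|).+1.
have kx : `|x| < k%:R by exact: truncnS_gt.
have F0' : F (- (n + k)%:R) @[n --> \oo] --> 0.
  by rewrite (cvg_shiftn k (fun n => F (- n%:R))).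
apply: (@Rintegral_exhaust _ _ F (fun n => - (n + k)%:R) (fun=> x)) => //.
- move=> n; rewrite natrD; apply: (@lt_le_trans _ _ (- `|x|)).
    by rewrite ltrN2 (lt_le_trans kx)// lerDr.
  by rewrite lerNl -normrN ler_norm.
- by move=> n y /=; rewrite !in_itv/= => /andP[].
- move=> y /=; rewrite in_itv/= => yx; near=> n.
  rewrite in_itv/= yx andbT natrD lerNl.
  apply: (@le_trans _ _ n%:R); last by rewrite lerDl.
  by near: n; exact: nbhs_infty_ger.
- rewrite -[X in _ --> X](subr0 (F x)); apply: cvgB => //; exact: cvg_cst.
Unshelve. all: by end_near. Qed.

Lemma Rintegral_primitive f F (l : R) : gdom f ->
  (forall y : R, is_derive y 1 F (f y)) ->
  F n%:R @[n --> \oo] --> l ->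
  F (- n%:R) @[n --> \oo] --> 0 ->
  \int[mu]_x f x = l.
Proof.
move=> gf dF Fl F0.
apply: (@Rintegral_exhaust _ _ F (fun n => - (n.+1)%:R) (fun n => n.+1%:R)) => //.
- exact: gdom_integrable.
- by case: gf.
- by move=> n; apply: (@lt_trans _ _ 0) => //; rewrite oppr_lt0.
- move=> y _; near=> n; rewrite in_itv/= -ler_norml.
  apply: (@le_trans _ _ n%:R); last by rewrite ler_nat.
  by near: n; exact: nbhs_infty_ger.
- rewrite -[X in _ --> X](subr0 l); apply: cvgB.
  + by rewrite (cvg_shiftS (fun n => F n%:R)).
  + by rewrite (cvg_shiftS (fun n => F (- n%:R))).
Unshelve. all: by end_near. Qed.

(** Integration by parts without boundary terms, when [F] is a product. *)
Lemma Rintegral_deriv0 f F : gdom f -> gdom F ->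
  (forall y : R, is_derive y 1 F (f y)) -> \int[mu]_x f x = 0.
Proof.
move=> gf gF dF; apply: Rintegral_primitive gf dF _ _.
  exact: gdom_cvgy.
exact: gdom_cvgNy.
Qed.

End gauss_dominated.

(** * Derivatives of the normal density *)

Section derivation_rules.
Context {R : realType}.
Implicit Types (f g : R -> R).

Lemma is_deriveMf f g (x df dg : R) : is_derive x 1 f df -> is_derive x 1 g dg ->
  is_derive x 1 (fun y => f y * g y) (df * g x + f x * dg).
Proof.
move=> Df Dg; have := is_deriveM Df Dg; rewrite /GRing.scale/= addrC => H.
by apply: is_derive_eq; rewrite mulrC.
Qed.

Lemma is_deriveDf f g (x df dg : R) : is_derive x 1 f df -> is_derive x 1 g dg ->
  is_derive x 1 (fun y => f y + g y) (df + dg).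
Proof. by move=> Df Dg; exact: is_deriveD. Qed.

Lemma is_derive_cstf (k x : R) : is_derive x 1 (fun=> k) 0.
Proof. exact: is_derive_cst. Qed.

Lemma is_derive_affine f (a s x df : R) : is_derive ((x - a) / s) 1 f df ->
  is_derive x 1 (fun y => f ((y - a) / s)) (df / s).
Proof.
move=> Df; have Dg : is_derive x 1 (fun y : R => (y - a) / s) s^-1.
  have := is_deriveMf (is_deriveDf (is_derive_id x 1) (is_derive_cstf (- a) x))
    (is_derive_cstf s^-1 x).
  by move=> H; apply: is_derive_eq; rewrite addr0 mul1r mulr0 addr0.
by have := @is_derive1_comp _ f (fun y : R => (y - a) / s) x _ _ Df Dg.
Qed.

Lemma is_derive_uniq f (x d1 d2 : R) :
  is_derive x 1 f d1 -> is_derive x 1 f d2 -> d1 = d2.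
Proof. by move=> [_ <-] [_ <-]. Qed.

End derivation_rules.

Section gauss_derivatives.
Context {R : realType}.
Notation mu := (@lebesgue_measure R).
Notation phi := (@phi R).

Definition DD (p : nat) : R -> R :=
  if p is n.+1 then derive1n n phi else antideriv phi.

(** This is phi^(p-2). Convolving [DD p] with [DD q] gives a multiple of [EE (p + q)], so two
    distribution functions call for the second antiderivative. *)
Definition EE (p : nat) : R -> R :=
  if p is n.+1 then DD n else antideriv (antideriv phi).

Lemma dphiEE (p : nat) : dphi (p%:Z - 2) = EE p.
Proof.
case: p => [|[|p]] //.
by rewrite (_ : p.+2%:Z - 2 = p%:Z)//; lia.
Qed.

Lemma phiE (x : R) : phi x = (Num.sqrt (2 * pi))^-1 * expR (- (x ^+ 2 / 2)).
Proof.
rewrite /Defs.phi normal_pdfE ?oner_neq0// /normal_peak /normal_fun.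
by rewrite subr0 expr1n mul1r -[in LHS](mulr_natl pi) mulNr.
Qed.

Lemma phi_ge0 (x : R) : 0 <= phi x.
Proof. exact: normal_pdf_ge0. Qed.

Lemma gdom_phi : gdom phi.
Proof.
split; first by apply: continuous_normal_pdf; exact: oner_neq0.
exists (Num.sqrt (2 * pi))^-1, 2^-1; split; first by rewrite invr_gt0.
by move=> x; rewrite ger0_norm ?phi_ge0// phiE mulrC [X in - X]mulrC mulrC.
Qed.

Lemma is_derive_phi (x : R) : is_derive x 1 phi (- x * phi x).
Proof.
have -> : phi = (fun x => (Num.sqrt (2 * pi))^-1 * expR (- (x ^+ 2 / 2))).
  by apply/funext => y; exact: phiE.
have H : is_derive x 1 (fun x : R => - (x ^+ 2 / 2)) (- x).
  have := is_deriveMf (is_deriveMf (is_derive_id x 1) (is_derive_id x 1))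
     (is_derive_cstf (- 2^-1) x).
  rewrite [X in is_derive _ _ X _](_ : _ = fun x => - (x ^+ 2 / 2)); last first.
    by apply/funext => y; rewrite expr2 mulrN.
  by move=> H; apply: is_derive_eq; rewrite !mul1r mulr1 mulr0 addr0; lra.
have H2 := @is_derive1_comp _ expR (fun x : R => - (x ^+ 2 / 2)) x _ _
  (is_derive_expR _) H.
have := is_deriveMf (is_derive_cstf ((Num.sqrt (2 * pi))^-1) x) H2.
by move=> H3; apply: (is_derive_eq H3); rewrite mul0r add0r mulrA mulrC.
Qed.

Lemma gdom_poly_phi (p : {poly R}) : gdom (fun x => p.[x] * phi x).
Proof.
elim/poly_ind: p => [|p c IH].
  by under eq_fun do rewrite horner0 mul0r; exact: gdom_cst0.
have := gdomD (gdom_mulx IH) (gdomZ c gdom_phi).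
congr gdom; apply/funext => x.
by rewrite hornerMXaddC [RHS]mulrDl mulrA (mulrC x).
Qed.

(** The polynomial is a Hermite polynomial up to sign. It stays existential: only decay and
    differentiability are drawn from it. *)
Lemma derive1n_phi_poly (n : nat) :
  exists p : {poly R}, derive1n n phi = fun x => p.[x] * phi x.
Proof.
elim: n => [|n [p IH]].
  by exists 1; apply/funext => x; rewrite hornerC mul1r derive1n0.
exists (p^`() - 'X * p); apply/funext => x; rewrite derive1nS IH derive1E.
have H := is_deriveMf (is_derive_poly p x) (is_derive_phi x).
rewrite (@derive_val _ _ _ _ _ _ _ H) hornerD hornerN hornerM hornerX.
by rewrite [RHS]mulrDl mulNr mulNr mulrN mulrA (mulrC x).
Qed.

Lemma gdom_DD (n : nat) : gdom (DD n.+1).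
Proof. by have [p /= ->] := derive1n_phi_poly n; exact: gdom_poly_phi. Qed.

Lemma is_derive_antideriv (f : R -> R) (x : R) : continuous f ->
  (forall y, mu.-integrable `]-oo, y] (EFin \o f)) ->
  is_derive x 1 (antideriv f) (f x).
Proof.
move=> cf intf.
have xx1 : x < x + 1 by rewrite ltrDl.
have := @continuous_FTC1 R f -oo%O x (x + 1) xx1 (intf _).
move=> /(_ (ltNyr _) (cf x))[H1 H2].
by apply: DeriveDef; [exact: H1|rewrite -derive1E; exact: H2].
Qed.

Lemma is_derive_DD (n : nat) (x : R) : is_derive x 1 (DD n) (DD n.+1 x).
Proof.
case: n => [|n] /=.
  apply: is_derive_antideriv; first by case: gdom_phi.
  by move=> y; exact: gdom_integrableS gdom_phi.
have [p E] := derive1n_phi_poly n; rewrite E derive1E.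
have H := is_deriveMf (is_derive_poly p x) (is_derive_phi x).
by apply: DeriveDef; [have [] := H|].
Qed.

Lemma continuous_is_derive (f df : R -> R) :
  (forall x : R, is_derive x 1 f (df x)) -> continuous f.
Proof.
move=> Df x; apply/differentiable_continuous/derivable1_diffP.
by have [] := Df x.
Qed.

Lemma continuous_DD (n : nat) : continuous (DD n).
Proof. exact: continuous_is_derive (is_derive_DD n). Qed.

Lemma DD1 (x : R) : DD 1 x = phi x. Proof. by []. Qed.

Lemma DD2 (x : R) : DD 2 x = - x * phi x.
Proof. exact: is_derive_uniq (is_derive_DD 1 x) (is_derive_phi x). Qed.

(** The Hermite recurrence; each instance is the derivative of the preceding one. *)
Lemma DD_rec (n : nat) (x : R) :
  DD n.+3 x = - x * DD n.+2 x - n.+1%:R * DD n.+1 x.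
Proof.
elim: n x => [|n IH] x.
  apply: is_derive_uniq (is_derive_DD 2 x) _.
  rewrite (_ : DD 2 = fun y => - y * DD 1 y); last first.
    by apply/funext => y; rewrite DD2.
  have := is_deriveMf (is_deriveMf (is_derive_id x 1) (is_derive_cstf (-1) x))
    (is_derive_DD 1 x).
  rewrite [X in is_derive _ _ X _](_ : _ = fun y => - y * DD 1 y); last first.
    by apply/funext => y; rewrite mulrN1.
  by move=> H; apply: (is_derive_eq H); rewrite DD2 -DD1; ring.
apply: is_derive_uniq (is_derive_DD n.+3 x) _.
rewrite (_ : DD n.+3 = fun y => - y * DD n.+2 y - n.+1%:R * DD n.+1 y); last first.
  by apply/funext => y; rewrite IH.
have H1 := is_deriveMf (is_deriveMf (is_derive_id x 1) (is_derive_cstf (-1) x))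
    (is_derive_DD n.+2 x).
have H2 := is_deriveMf (is_derive_cstf (- n.+1%:R) x) (is_derive_DD n.+1 x).
have := is_deriveDf H1 H2.
rewrite [X in is_derive _ _ X _](_ : _ =
   fun y => - y * DD n.+2 y - n.+1%:R * DD n.+1 y); last first.
  by apply/funext => y; rewrite mulrN1 (mulNr n.+1%:R).
move=> H; apply: (is_derive_eq H).
by rewrite -IH -(natr1 n.+1); ring.
Qed.

Lemma phiN (x : R) : phi (- x) = phi x.
Proof. by rewrite !phiE sqrrN. Qed.

Lemma DDN (n : nat) (x : R) : DD n.+1 (- x) = (-1) ^+ n * DD n.+1 x.
Proof.
suff H : (forall x, DD n.+1 (- x) = (-1) ^+ n * DD n.+1 x) /\
         (forall x, DD n.+2 (- x) = (-1) ^+ n.+1 * DD n.+2 x) by case: H.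
elim: n {x} => [|n [IH1 IH2]].
  split=> x; first by rewrite mul1r /DD derive1n0 phiN.
  by rewrite !DD2 phiN; ring.
split=> // x; rewrite !DD_rec IH1 IH2 !exprS; ring.
Qed.

Lemma DD0_ge0 (x : R) : 0 <= DD 0 x.
Proof. by apply: Rintegral_ge0 => y _; exact: phi_ge0. Qed.

(** For u <= x <= 0 one has u^2 / 2 >= x^2 / 4 + u^2 / 4: one half of the exponent is kept as the
    bound, the other makes the integral finite. *)
Lemma DD0_left_tail : exists B : R, 0 <= B /\
  forall x, x <= 0 -> DD 0 x <= B * expR (- (4^-1 * x ^+ 2)).
Proof.
have e0 : 0 < 4^-1 :> R by rewrite invr_gt0.
pose c : R := (Num.sqrt (2 * pi))^-1.
pose g (u : R) := expR (- (4^-1 * u ^+ 2)).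
have gg : gdom g by have := gdom_gauss 1 e0; under eq_fun do rewrite mul1r.
have c0 : 0 <= c by rewrite invr_ge0.
exists (c * \int[mu]_u g u); split.
  by rewrite mulr_ge0// Rintegral_ge0// => y _; exact: expR_ge0.
move=> x x0; rewrite /DD /antideriv.
apply: (@le_trans _ _ (\int[mu]_(u in `]-oo, x]) ((c * g x) * g u))).
  apply: le_Rintegral => //.
  - exact: gdom_integrableS gdom_phi.
  - by apply: gdom_integrableS => //; exact: gdomZ.
  - move=> u /=; rewrite in_itv/= => ux; rewrite phiE -mulrA ler_wpM2l// -expRD.
    rewrite ler_expR.
    have : x ^+ 2 <= u ^+ 2.
      by rewrite -(sqrrN x) -(sqrrN u) ler_sqr ?nnegrE ?oppr_ge0// ?lerN2// (le_trans ux).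
    lra.
rewrite RintegralZl//; last exact: gdom_integrableS.
rewrite mulrAC ler_wpM2r ?expR_ge0// ler_wpM2l//.
rewrite /Rintegral fine_le//.
- by apply: integrable_fin_num => //; exact: gdom_integrableS.
- by apply: integrable_fin_num => //; exact: gdom_integrable.
- apply: ge0_subset_integral => //=.
  + by apply/measurable_EFinP; exact: gdom_measurable.
  + by move=> y _; rewrite lee_fin expR_ge0.
Qed.

Lemma DD0_cvgNy : DD 0 (- n%:R) @[n --> \oo] --> 0.
Proof.
have [B [B0 hB]] := DD0_left_tail.
have e0 : 0 < 4^-1 :> R by rewrite invr_gt0.
apply: squeeze_cvgr (cvg_cst _) (cvg_gauss_n B e0).
near=> n; rewrite DD0_ge0/= -(sqrrN n%:R); apply: hB.
by rewrite oppr_le0.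
Unshelve. all: by end_near. Qed.

(** The sum of both values has derivative zero. Its constant value is the total mass of phi, since
    [DD 0] vanishes at the left. *)
Lemma DD0N (x : R) : DD 0 (- x) = 1 - DD 0 x.
Proof.
have sumcst y : DD 0 (- y) + DD 0 y = DD 0 (- 0) + DD 0 0.
  apply: (@is_derive_0_is_cst R (fun y => DD 0 (- y) + DD 0 y)) => z.
  have N1 : (- z - 0) / 1 = - z :> R by rewrite subr0 divr1.
  have H : is_derive z 1 (fun y => DD 0 (- y)) (- phi z).
    have h : is_derive ((z - 0) / -1) 1 (DD 0) (DD 1 ((z - 0) / -1)).
      exact: is_derive_DD.
    have := is_derive_affine h.
    rewrite [X in is_derive _ _ X _](_ : _ = fun y => DD 0 (- y)); last first.
      by apply/funext => u; rewrite subr0 invrN1 mulrN1.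
    move=> h'; apply: is_derive_eq.
    by rewrite subr0 invrN1 !mulrN1 DD1 phiN.
  have := is_deriveDf H (is_derive_DD 0 z).
  by move=> h'; apply: is_derive_eq; rewrite DD1 addrC subrr.
set k := DD 0 (- 0) + DD 0 0 in sumcst.
suff -> : 1 = k by rewrite -(sumcst x) addrK.
have -> : 1 = \int[mu]_x phi x by rewrite /Rintegral integral_normal_pdf.
apply: (Rintegral_primitive gdom_phi (is_derive_DD 0)); last exact: DD0_cvgNy.
rewrite [X in X @ _ --> _](_ : _ = fun n : nat => k - DD 0 (- n%:R)); last first.
  by apply/funext => n; rewrite -(sumcst n%:R) addrAC subrr add0r.
by rewrite -[X in _ --> X]subr0; apply: cvgB; [exact: cvg_cst|exact: DD0_cvgNy].
Qed.

Lemma DD0_le1 (x : R) : DD 0 x <= 1.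
Proof. by have := DD0_ge0 (- x); rewrite DD0N subr_ge0. Qed.

Lemma cbounded_DD (n : nat) : cbounded (DD n).
Proof.
case: n => [|n]; last exact/gdom_cbounded/gdom_DD.
split; first exact: continuous_DD.
by exists 1 => x; rewrite ger0_norm ?DD0_ge0 ?DD0_le1.
Qed.

(** For 0 < x <= K the trivial bound 1 costs at most a factor exp(K^2 / 4), so the Gaussian bound
    extends to every left half-line. *)
Lemma DD0_tail : exists B : R, forall K x, x <= K ->
  DD 0 x <= (B + expR (4^-1 * K ^+ 2)) * expR (- (4^-1 * x ^+ 2)).
Proof.
have [B [B0 hB]] := DD0_left_tail.
exists B => K x xK; rewrite mulrDl.
have [x0|x0] := leP x 0.
  by rewrite (le_trans (hB _ x0))// lerDl mulr_ge0 ?expR_ge0.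
apply: le_trans (DD0_le1 _) _.
apply: (@le_trans _ _ (0 + 1)); first by rewrite add0r.
rewrite lerD ?mulr_ge0 ?expR_ge0// -expRD -[leLHS]expR0 ler_expR subr_ge0.
by rewrite ler_wpM2l ?invr_ge0// ler_sqr ?nnegrE// ?ltW// (lt_le_trans x0).
Qed.

Lemma integrable_DD0 (x : R) : mu.-integrable `]-oo, x] (EFin \o DD 0).
Proof.
have [B hB] := DD0_tail.
have e0 : 0 < 4^-1 :> R by rewrite invr_gt0.
have := gdom_integrableS (measurable_itv `]-oo, x])
  (gdom_gauss (B + expR (4^-1 * x ^+ 2)) e0).
apply: le_integrable => //.
  apply/measurable_EFinP; apply: measurable_funTS.
  exact: (continuous_measurable_fun (@continuous_DD 0)).
move=> y /=; rewrite in_itv/= => yx; rewrite lee_fin ger0_norm; last exact: DD0_ge0.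
by rewrite (le_trans (hB _ _ yx))// ler_norm.
Qed.

Lemma is_derive_EE (n : nat) (x : R) : is_derive x 1 (EE n) (EE n.+1 x).
Proof.
case: n => [|n]; last exact: is_derive_DD.
have cD : continuous (DD 0) := @continuous_DD 0.
exact: (@is_derive_antideriv (DD 0) x cD integrable_DD0).
Qed.

Lemma EE0 (x : R) : EE 0 x = phi x + x * DD 0 x.
Proof.
apply: (@antideriv_primitive _ (DD 0) (fun x => phi x + x * DD 0 x)).
- exact: continuous_DD.
- exact: integrable_DD0.
- move=> y; have := is_deriveDf (is_derive_phi y)
    (is_deriveMf (is_derive_id y 1) (is_derive_DD 0 y)).
  by move=> h; apply: is_derive_eq; rewrite DD1; ring.
rewrite -[X in _ --> X]addr0; apply: cvgD.
  exact: gdom_cvgNy gdom_phi.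
have [B [B0 hB]] := DD0_left_tail.
have gg : gdom (fun x : R => x * (B * expR (- (4^-1 * x ^+ 2)))).
  by apply: gdom_mulx; apply: gdom_gauss; rewrite invr_gt0.
apply: squeeze_cvgr (gdom_cvgNy gg) (cvg_cst _).
near=> n; rewrite mulr_le0_ge0 ?oppr_le0 ?DD0_ge0// andbT.
by rewrite ler_wnM2l ?oppr_le0//; apply: hB; rewrite oppr_le0.
Unshelve. all: by end_near. Qed.

(** The Hermite recurrence continues below degree zero: at n = 0 it is the formula for the second
    antiderivative, at n = 1 it is phi' = - x phi. *)
Lemma EE_rec (n : nat) (x : R) : EE n.+2 x = - x * EE n.+1 x - (n%:R - 1) * EE n x.
Proof.
case: n => [|[|n]].
- by rewrite EE0 /EE DD1; ring.
- by rewrite /EE DD2 DD1; ring.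
- by rewrite /EE DD_rec -(natr1 n.+1); ring.
Qed.

Lemma antideriv_DD (n : nat) : antideriv (DD n.+1) = DD n.
Proof.
apply/funext => x; apply: antideriv_primitive.
- exact: continuous_DD.
- by apply: gdom_integrableS => //; exact: gdom_DD.
- exact: is_derive_DD.
- by case: n => [|n]; [exact: DD0_cvgNy|exact/gdom_cvgNy/gdom_DD].
Qed.

(** If p or q is positive, one factor is [gdom] and the other bounded. If both are zero, the first
    factor decays at the left and the reflected one at the right, while the other is at most 1. *)
Lemma gdom_DDDD (p q : nat) (a s b t : R) : 0 < s -> 0 < t ->
  gdom (fun x => DD p ((x - a) / s) * DD q ((b - x) / t)).
Proof.
move=> s0 t0.
have E (r : nat) : (fun x => DD r ((b - x) / t)) = (fun x => DD r ((x - b) / (- t))).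
  by apply/funext => x; rewrite invrN mulrN -mulNr opprB.
have bb (r : nat) : cbounded (fun x => DD r ((b - x) / t)).
  by rewrite E; apply: (@cbounded_affine _ b (- t)); exact: cbounded_DD.
have ba (r : nat) : cbounded (fun x => DD r ((x - a) / s)).
  by apply: cbounded_affine; exact: cbounded_DD.
case: p => [|p]; last first.
  apply: gdomMb => //; apply: gdom_affine; [by rewrite gt_eqF|exact: gdom_DD].
case: q => [|q]; last first.
  under eq_fun do rewrite mulrC.
  apply: gdomMb => //; rewrite E.
  by apply: (@gdom_affine _ b (- t)); [rewrite oppr_eq0 gt_eqF|exact: gdom_DD].
have [B hB] := DD0_tail.
pose g (C : R) (u : R) := C * expR (- (4^-1 * u ^+ 2)).
have gg C : gdom (g C) by apply: gdom_gauss; rewrite invr_gt0.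
have s0' : s != 0 by rewrite gt_eqF.
have t0' : - t != 0 by rewrite oppr_eq0 gt_eqF.
have g1 C := gdom_affine a s0' (gg C).
have g2 C := gdom_affine b t0' (gg C).
(* Constants for the split at 0: x <= 0 gives (x - a) / s <= - a / s, and x > 0 gives (b - x) / t <=
   b / t. *)
pose C1 := B + expR (4^-1 * (- a / s) ^+ 2).
pose C2 := B + expR (4^-1 * (b / t) ^+ 2).
have [_ [C [e [e0 He]]]] := gdomD (gdomMb (g1 C1) (cbounded_cst 1)) (g2 C2).
have [c1 _] := cboundedM (ba 0%N) (bb 0%N).
split=> //; exists C, e; split => // x.
apply: le_trans (He x); rewrite mulr1.
rewrite ger0_norm; last by rewrite mulr_ge0 ?DD0_ge0.
apply: le_trans (ler_norm _).
have P1 : 0 <= C1.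
  by have := le_trans (DD0_ge0 _) (hB (- a / s) _ (lexx _)); rewrite pmulr_lge0 ?expR_gt0.
have P2 : 0 <= C2.
  by have := le_trans (DD0_ge0 _) (hB (b / t) _ (lexx _)); rewrite pmulr_lge0 ?expR_gt0.
have [x0|x0] := leP x 0.
  apply: (@le_trans _ _ (DD 0 ((x - a) / s))).
    by rewrite ler_piMr ?DD0_ge0 ?DD0_le1.
  apply: le_trans (hB (- a / s) _ _) _; first by rewrite ler_pM2r ?invr_gt0// gerDr.
  by rewrite lerDl mulr_ge0 ?expR_ge0.
apply: (@le_trans _ _ (DD 0 ((b - x) / t))).
  by rewrite ler_piMl ?DD0_ge0 ?DD0_le1.
apply: le_trans (hB (b / t) _ _) _.
  by rewrite ler_pM2r ?invr_gt0// gerBl ltW.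
rewrite (_ : (b - x) / t = (x - b) / (- t)); last first.
  by rewrite invrN mulrN -mulNr opprB.
by rewrite lerDr mulr_ge0 ?expR_ge0.
Qed.

End gauss_derivatives.

Arguments DD : simpl never.
Arguments EE : simpl never.

(** * Convolutions *)

Section gauss_convolution.
Context {R : realType}.
Notation mu := (@lebesgue_measure R).
Notation phi := (@phi R).

Lemma normal_pdf_phi (m s x : R) : 0 < s -> normal_pdf m s x = s^-1 * phi ((x - m) / s).
Proof.
move=> s0; rewrite normal_pdfE ?gt_eqF// phiE /normal_peak /normal_fun.
rewrite -mulrnAr sqrtrM ?sqr_ge0// sqrtr_sqr gtr0_norm// invfM -mulrA.
rewrite mulr_natl; congr (_ * (_ * expR _)).
by rewrite expr_div_n -mulr_natr invfM mulNr mulrA.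
Qed.

Lemma DDx (p : nat) (x : R) : x * DD p.+1 x = - DD p.+2 x - p%:R * DD p x.
Proof.
case: p => [|p]; first by rewrite DD2 DD1 mul0r subr0 mulNr opprK.
by rewrite DD_rec; ring.
Qed.

Lemma is_derive_DDaffine (p : nat) (a s x : R) :
  is_derive x 1 (fun y => DD p ((y - a) / s)) (DD p.+1 ((x - a) / s) / s).
Proof. by apply: is_derive_affine; exact: is_derive_DD. Qed.

Lemma reflectE (b x t : R) : (b - x) / t = (x - b) / (- t).
Proof. by rewrite invrN mulrN -mulNr opprB. Qed.

Lemma is_derive_DDreflect (p : nat) (b t x : R) :
  is_derive x 1 (fun y => DD p ((b - y) / t)) (- (DD p.+1 ((b - x) / t) / t)).
Proof.
have := is_derive_DDaffine p b (- t) x.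
rewrite [X in is_derive _ _ X _](_ : _ = fun y => DD p ((b - y) / t)); last first.
  by apply/funext => y; rewrite reflectE.
by move=> H; apply: (is_derive_eq H); rewrite -reflectE invrN mulrN.
Qed.

Section convolution.
Variables (a b s t : R).
Hypotheses (s0 : 0 < s) (t0 : 0 < t).

Let I p q := \int[mu]_x (DD p ((x - a) / s) * DD q ((b - x) / t)).
Let sg := Num.sqrt (s ^+ 2 + t ^+ 2).

(** Integration by parts; it also holds for p = q = 0, since the product of the two distribution
    functions is [gdom]. Hence only p + q matters in the convolution. *)
Lemma conv_shift (p q : nat) : t * I p.+1 q = s * I p q.+1.
Proof.
have g := gdom_DDDD _ _ a b s0 t0.
pose f x := s^-1 * (DD p.+1 ((x - a) / s) * DD q ((b - x) / t)) +
   - t^-1 * (DD p ((x - a) / s) * DD q.+1 ((b - x) / t)).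
have : \int[mu]_x f x = 0.
  apply: (Rintegral_deriv0 _ (g p q)).
    by apply: gdomD; apply: gdomZ; exact: g.
  move=> y.
  have := is_deriveMf (is_derive_DDaffine p a s y) (is_derive_DDreflect q b t y).
  by move=> H; apply: (is_derive_eq H); rewrite /f; ring.
rewrite /f RintegralD//=; last 2 first.
- by apply: gdom_integrable; apply: gdomZ; exact: g.
- by apply: gdom_integrable; apply: gdomZ; exact: g.
rewrite !RintegralZl//; last 2 first.
- by apply: gdom_integrable; exact: g.
- by apply: gdom_integrable; exact: g.
rewrite -/(I _ _) -/(I _ _) => /eqP; rewrite mulNr subr_eq0 => /eqP E.
have -> : t * I p.+1 q = t * s * (s^-1 * I p.+1 q) by field; rewrite gt_eqF.
by rewrite E; field; rewrite gt_eqF.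
Qed.

(** Write b - a = (x - a) + (b - x) under the integral and let the Hermite recurrence absorb each
    linear factor. *)
Lemma conv_moment (p : nat) :
  (b - a) * I p.+1 1 = - s * I p.+2 1 - s * p%:R * I p 1 - t * I p.+1 2.
Proof.
have g := gdom_DDDD _ _ a b s0 t0.
have gi p' q' := gdom_integrable (g p' q').
rewrite /I -!RintegralZl//.
rewrite -RintegralB//; last 2 first.
- by apply: gdom_integrable; apply: gdomZ; exact: g.
- by apply: gdom_integrable; apply: gdomZ; exact: g.
rewrite -RintegralB//; last 2 first.
- apply: gdom_integrable; apply: gdomD; first by apply: gdomZ; exact: g.
  under eq_fun do rewrite -mulNr.
  by apply: gdomZ; exact: g.
- by apply: gdom_integrable; apply: gdomZ; exact: g.
apply: eq_Rintegral => x _.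
have -> : (b - a) * (DD p.+1 ((x - a) / s) * DD 1 ((b - x) / t)) =
    s * ((x - a) / s * DD p.+1 ((x - a) / s)) * DD 1 ((b - x) / t) +
    t * DD p.+1 ((x - a) / s) * ((b - x) / t * DD 1 ((b - x) / t)).
  by field; rewrite !gt_eqF.
by rewrite !DDx; ring.
Qed.

Lemma sgE : sg ^+ 2 = s ^+ 2 + t ^+ 2.
Proof. by rewrite sqr_sqrtr// addr_ge0 ?sqr_ge0. Qed.

Lemma sg_gt0 : 0 < sg.
Proof. by rewrite sqrtr_gt0 addr_gt0// exprn_gt0. Qed.

Lemma conv_phi_phi : I 1 1 = s * t / sg * phi ((b - a) / sg).
Proof.
have sg0 := sg_gt0; have sgE := sgE.
(* Completing the square: the product of the two densities is, up to a factor, a normal density with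
   mean c and standard deviation r. *)
pose r := s * t / sg; have r0 : 0 < r by rewrite divr_gt0// mulr_gt0.
pose c := (a * t ^+ 2 + b * s ^+ 2) / sg ^+ 2.
have key (x : R) : phi ((x - a) / s) * phi ((b - x) / t) =
    phi ((b - a) / sg) * phi ((x - c) / r).
  rewrite !phiE mulrACA [RHS]mulrACA -!expRD; congr (_ * expR _).
  rewrite -!opprD -!mulrDl; congr (- (_ / 2)).
  have hr : r ^+ 2 = s ^+ 2 * t ^+ 2 / (s ^+ 2 + t ^+ 2).
    by rewrite /r expr_div_n exprMn sgE.
  rewrite (expr_div_n (x - a)) (expr_div_n (b - x)) (expr_div_n (b - a)).
  rewrite (expr_div_n (x - c)) hr /c sgE.
  by field; rewrite !gt_eqF// addr_gt0// exprn_gt0.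
have -> : I 1 1 = \int[mu]_x (r * phi ((b - a) / sg) * normal_pdf c r x).
  apply: eq_Rintegral => x _; rewrite normal_pdf_phi// !DD1.
  rewrite (_ : r * _ * _ = phi ((b - a) / sg) * phi ((x - c) / r)).
    exact: key.
  by field; rewrite gt_eqF.
rewrite RintegralZl//; last exact: integrable_normal_pdf.
by rewrite /Rintegral integral_normal_pdf/= mulr1.
Qed.

End convolution.

Lemma antideriv_DD1_affine (a t b : R) : 0 < t ->
  antideriv (fun z => t^-1 * DD 1 ((z - a) / t)) b = DD 0 ((b - a) / t).
Proof.
move=> t0; have tN0 : t != 0 by rewrite gt_eqF.
apply: (@antideriv_primitive _ _ (fun z => DD 0 ((z - a) / t))).
- by have [cg _] := gdomZ t^-1 (gdom_affine a tN0 (gdom_DD 0)); exact: cg.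
- apply: gdom_integrableS => //; apply: gdomZ.
  exact: (gdom_affine a tN0 (gdom_DD 0)).
- by move=> y; have := is_derive_DDaffine 0 a t y; rewrite mulrC.
- have [B hB] := @DD0_tail R.
  have e0 : 0 < 4^-1 :> R by rewrite invr_gt0.
  have := gdom_affine a tN0 (gdom_gauss (B + expR (4^-1 * (- a / t) ^+ 2)) e0).
  move=> /gdom_cvgNy; apply: squeeze_cvgr (cvg_cst 0); near=> n.
  rewrite DD0_ge0/= hB//.
  by rewrite ler_pM2r ?invr_gt0// gerDr oppr_le0.
Unshelve. all: by end_near. Qed.

(** [DD 0] is the integral of [DD 1] over a half-line, encoded by an indicator so that both
    integrals run over the whole line. Non-negativity permits the exchange without a bound on the
    double integral. *)
Lemma conv_tonelli (b t : R) (f : R -> R) : 0 < t -> continuous f -> (forall x, 0 <= f x) ->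
  (forall z, gdom (fun x => f x * DD 1 ((z - x) / t))) ->
  \int[mu]_x (f x * DD 0 ((b - x) / t)) =
  antideriv (fun z => t^-1 * \int[mu]_x (f x * DD 1 ((z - x) / t))) b.
Proof.
move=> t0 cf f0 gf.
pose A : set R := `]-oo, b]%classic.
pose h (xz : R * R) := (f xz.1 * (t^-1 * DD 1 ((xz.2 - xz.1) / t)) * \1_A xz.2)%:E.
have tN0 : t != 0 by rewrite gt_eqF.
have mDD1 : measurable_fun setT (@DD R 1) by apply: gdom_measurable; exact: gdom_DD.
have mh : measurable_fun setT h.
  apply/measurable_EFinP; apply: measurable_funM; last first.
    have mA : measurable_fun setT (\1_A : R -> R).
      by apply: measurable_indic; exact: measurable_itv.
    exact: (measurableT_comp mA measurable_snd).
  apply: measurable_funM.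
    by apply: measurableT_comp => //; exact: continuous_measurable_fun.
  apply: measurable_funM => //.
  apply: (measurableT_comp (f := DD 1)) => //.
  by apply: measurable_funM => //; exact: measurable_funB.
have h0 xz : (0 <= h xz)%E.
  rewrite lee_fin mulr_ge0// mulr_ge0// mulr_ge0 ?invr_ge0 ?(ltW t0)//.
  exact: phi_ge0.
have Ez (x : R) : DD 0 ((b - x) / t) = \int[mu]_(z in A) (t^-1 * DD 1 ((z - x) / t)).
  by rewrite -antideriv_DD1_affine.
have fubini : (\int[mu]_x \int[mu]_z h (x, z) = \int[mu]_z \int[mu]_x h (x, z))%E.
  exact: fubini_tonelli.
have indicE (g : R -> R) (z : R) : (g z * \1_A z)%:E = ((EFin \o g) \_ A) z.
  rewrite /patch indicE; case: ifP => /= _; first by rewrite mulr1.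
  by rewrite mulr0.
have Il x : (\int[mu]_z h (x, z) = (f x * DD 0 ((b - x) / t))%:E)%E.
  have gg : gdom (fun z => t^-1 * DD 1 ((z - x) / t)).
    by apply: gdomZ; exact: (gdom_affine x tN0 (gdom_DD 0)).
  have mA : measurable A := measurable_itv _.
  have ig := gdom_integrableS mA gg.
  have ifg := gdom_integrableS mA (gdomZ (f x) gg).
  have E : \int[mu]_(z in A) (f x * (t^-1 * DD 1 ((z - x) / t))) =
      f x * DD 0 ((b - x) / t).
    by rewrite RintegralZl; [rewrite Ez|exact: mA|exact: ig].
  rewrite -E -(lebesgue_EFin_Rintegral mA ifg).
  rewrite [RHS]integral_mkcond; apply: eq_integral => z _.
  by rewrite -(indicE (fun z => f x * (t^-1 * DD 1 ((z - x) / t)))).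
have Ir z : (\int[mu]_x h (x, z) =
    ((EFin \o (fun z => t^-1 * \int[mu]_x (f x * DD 1 ((z - x) / t)))%R) \_ A) z)%E.
  rewrite -indicE /h/=.
  have ifg := gdom_integrable (gf z).
  rewrite (_ : (t^-1 * _ * _)%:E = ((t^-1 * \1_A z)%:E *
    \int[mu]_x (f x * DD 1 ((z - x) / t))%:E)%E); last first.
    by rewrite mulrAC EFinM -(lebesgue_EFin_Rintegral measurableT ifg).
  rewrite -(integralZl measurableT ifg).
  by apply: eq_integral => x _; rewrite -EFinM; congr EFin; ring.
rewrite /antideriv /Rintegral; congr fine.
under eq_integral do rewrite -Il.
by rewrite fubini [RHS]integral_mkcond; apply: eq_integral => z _; exact: Ir.
Unshelve. all: by end_near. Qed.

(** The decay shared by phi and its first two antiderivatives: unlike [gdom], it leaves the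
    behaviour at the right free. The rate 1/4 is that of [DD0_left_tail]. *)
Definition left_tail (f : R -> R) := forall K, exists C, forall x, x <= K ->
  `|f x| <= C * expR (- (4^-1 * x ^+ 2)).

Lemma left_tail_bound (f : R -> R) (a s b : R) : 0 < s -> left_tail f ->
  exists2 g, gdom g & forall x, x <= b -> `|f ((x - a) / s)| <= g x.
Proof.
move=> s0 /(_ ((b - a) / s))[C hC].
have e0 : 0 < 4^-1 :> R by rewrite invr_gt0.
have sN0 : s != 0 by rewrite gt_eqF.
exists (fun x => C * expR (- (4^-1 * ((x - a) / s) ^+ 2))).
  exact: (gdom_affine a sN0 (gdom_gauss C e0)).
by move=> x xb; apply: hC; rewrite ler_pM2r ?invr_gt0// lerD2r.
Qed.

Lemma left_tail_integrable (f : R -> R) (a s b : R) : 0 < s -> continuous f ->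
  left_tail f -> mu.-integrable `]-oo, b] (EFin \o (fun x => f ((x - a) / s))).
Proof.
move=> s0 cf /(left_tail_bound a b s0)[g gg fg].
have := gdom_integrableS (measurable_itv `]-oo, b]) gg.
apply: le_integrable => //.
  apply/measurable_EFinP; apply: measurable_funTS.
  apply: continuous_measurable_fun.
  by apply: (continuous_compR (g := fun x => (x - a) / s)) => //;
    exact: continuous_affine.
move=> x /=; rewrite in_itv/= => xb; rewrite lee_fin.
exact: le_trans (fg _ xb) (ler_norm _).
Qed.

Lemma left_tail_cvg (f : R -> R) (a s : R) : 0 < s ->
  left_tail f -> f ((- n%:R - a) / s) @[n --> \oo] --> 0.
Proof.
move=> s0 /(left_tail_bound a 0 s0)[g gg fg].
have h := gdom_cvgNy gg.
have hN : - g (- n%:R) @[n --> \oo] --> 0 by rewrite -oppr0; exact: cvgN.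
apply: squeeze_cvgr hN h; near=> n; rewrite -ler_norml; apply: fg.
by rewrite oppr_le0.
Unshelve. all: by end_near. Qed.

Lemma continuous_EE (p : nat) : continuous (@EE R p).
Proof. exact: continuous_is_derive (is_derive_EE p). Qed.

Lemma left_tail_DD0 : left_tail (DD 0).
Proof.
have [B hB] := @DD0_tail R.
by move=> K; exists (B + expR (4^-1 * K ^+ 2)) => x xK; rewrite ger0_norm ?DD0_ge0 ?hB.
Qed.

Lemma left_tail_DD1 : left_tail (DD 1).
Proof.
move=> K; exists (Num.sqrt (2 * pi))^-1 => x _; rewrite ger0_norm ?phi_ge0// DD1 phiE.
rewrite ler_wpM2l ?invr_ge0// ler_expR.
have := sqr_ge0 x; lra.
Qed.

Lemma left_tail_EE0 : left_tail (EE 0).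
Proof.
move=> K; have [C1 h1] := left_tail_DD1 K; have [C0 h0] := left_tail_DD0 K.
exists (C1 + `|K| * C0) => x xK; rewrite ger0_norm; last first.
  by apply: Rintegral_ge0 => y _; exact: DD0_ge0.
rewrite EE0 mulrDl lerD//.
  by rewrite (le_trans _ (h1 _ xK))// ler_norm.
rewrite -mulrA (@le_trans _ _ (`|K| * DD 0 x))//.
  by rewrite ler_wpM2r ?DD0_ge0// (le_trans xK)// ler_norm.
by rewrite ler_wpM2l// (le_trans _ (h0 _ xK))// ler_norm.
Qed.

(** Integrating a convolution formula in b lowers the order of the second factor from 1 to 0. The
    restriction p <= 1 makes [DD p] non-negative, as Tonelli's theorem asks. *)
Lemma conv_primitive (p : nat) (a s t k sg : R) : (p <= 1)%N ->
  0 < s -> 0 < t -> 0 < sg ->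
  (forall z, \int[mu]_x (DD p ((x - a) / s) * DD 1 ((z - x) / t)) =
     k * EE p.+1 ((z - a) / sg)) ->
  forall b, \int[mu]_x (DD p ((x - a) / s) * DD 0 ((b - x) / t)) =
     k / t * sg * EE p ((b - a) / sg).
Proof.
move=> p1 s0 t0 sg0 Ik b.
have [pos lt1 lt0] : [/\ forall x : R, 0 <= DD p x,
    left_tail (EE p.+1) & left_tail (EE p)].
  clear Ik; case: p p1 => [|[|//]] _.
    by split; [exact: DD0_ge0|exact: left_tail_DD0|exact: left_tail_EE0].
  by split; [exact: phi_ge0|exact: left_tail_DD1|exact: left_tail_DD0].
rewrite (conv_tonelli b (f := fun x => DD p ((x - a) / s))).
- rewrite (_ : (fun z => _) = fun z => k / t * EE p.+1 ((z - a) / sg)); last first.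
    by apply/funext => z; rewrite Ik mulrCA mulrA.
  have cE : continuous (EE p.+1) := @continuous_EE p.+1.
  apply: (@antideriv_primitive _ (fun z => k / t * EE p.+1 ((z - a) / sg))
    (fun z => k / t * sg * EE p ((z - a) / sg))).
  + move=> z; apply: cvgM; first exact: cvg_cst.
    by apply: (continuous_compR (g := fun x => (x - a) / sg)) => //;
      exact: continuous_affine.
  + have h := left_tail_integrable a b sg0 cE lt1.
    exact: (lebesgue_integrable_scale (k / t) (measurable_itv _) h).
  + move=> y; have h := is_derive_affine (is_derive_EE p ((y - a) / sg)).
    have := is_deriveMf (is_derive_cstf (k / t * sg) y) h.
    by move=> H; apply: (is_derive_eq H); field; rewrite !gt_eqF.
  + rewrite -(mulr0 (k / t * sg)); apply: cvgM; first exact: cvg_cst.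
    exact: left_tail_cvg.
- exact: t0.
- apply: (continuous_compR (g := fun x => (x - a) / s)); last exact: continuous_affine.
  exact: continuous_DD.
- by move=> x; exact: pos.
- by move=> z; exact: gdom_DDDD.
Qed.

Lemma convolution_DD (p q : nat) (a s b t : R) : 0 < s -> 0 < t ->
  let sg := Num.sqrt (s ^+ 2 + t ^+ 2) in
  \int[mu]_x (DD p ((x - a) / s) * DD q ((b - x) / t)) =
  s ^+ p * t ^+ q * sg * EE (p + q) ((b - a) / sg) / sg ^+ (p + q).
Proof.
move=> s0 t0 sg; have sg0 : 0 < sg := sg_gt0 s0 t0.
have sgE : sg ^+ 2 = s ^+ 2 + t ^+ 2 := sgE s t.
pose I p q b := \int[mu]_x (DD p ((x - a) / s) * DD q ((b - x) / t)).
pose claim p q b := I p q b = s ^+ p * t ^+ q * sg * EE (p + q) ((b - a) / sg) / sg ^+ (p + q).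
have sN0 : s != 0 by rewrite gt_eqF.
have tN0 : t != 0 by rewrite gt_eqF.
have sgN0 : sg != 0 by rewrite gt_eqF.
have shift p' q' b' : claim p'.+1 q' b' <-> claim p' q'.+1 b'.
  have E : I p'.+1 q' b' = s / t * I p' q'.+1 b'.
    apply: (mulfI tN0); rewrite conv_shift//.
    by rewrite mulrA mulrCA divff// mulr1.
  rewrite /claim E addSn addnS; split=> [H|->].
    have st : s / t != 0 by rewrite mulf_neq0// invr_eq0.
    apply: (mulfI st); rewrite H !exprS; field.
    by rewrite sgN0 tN0 expf_neq0.
  by rewrite !exprS; field; rewrite sgN0 tN0 expf_neq0.
have shifts p' q' b' : claim p' q' b' <-> claim (p' + q')%N 0%N b'.
  elim: q' p' => [|q' IH] p'; first by rewrite addn0.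
  by rewrite -shift IH addnS addSn.
(* The degrees p + q = 2, 1, 0 in this order: completion of the square, then one integration in b
   for each step down. *)
have c2 b' : claim 1%N 1%N b'.
  rewrite /claim /I conv_phi_phi// !expr1 -/sg.
  by rewrite (_ : EE (1 + 1) _ = phi ((b' - a) / sg))//; field.
have c1 b' : claim 1%N 0%N b'.
  rewrite /claim /I (@conv_primitive 1 a s t (s * t / sg) sg)//.
    by rewrite !expr1 expr0; field; rewrite sgN0.
  by move=> z; rewrite -/(I 1%N 1%N z) c2 !expr1 /=; field.
have c0 b' : claim 0%N 0%N b'.
  rewrite /claim /I (@conv_primitive 0 a s t t sg)//.
    by rewrite !expr0; field.
  move=> z; rewrite -/(I 0%N 1%N z) (iffLR (shift 0%N 0%N z) (c1 z)) !expr1 expr0 /=.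
  by field.
(* By the shifts q = 0 suffices; two consecutive degrees are carried along because the moment
   identity looks two degrees back. *)
suff H N b' : claim N 0%N b' /\ claim N.+1 0%N b'.
  by apply: (iffRL (shifts p q b)); have [] := H (p + q)%N b.
elim: N => [|N [IH0 IH1]]; first by split; [exact: c0|exact: c1].
split=> //; case: N IH0 IH1 => [|N] IH0 IH1.
  by apply/(shifts 1%N 1%N); exact: c2.
have h1 : claim N.+1 1%N b' by exact: (iffLR (shift _ _ _) IH1).
have h0 : claim N 1%N b' by exact: (iffLR (shift _ _ _) IH0).
apply: (iffRL (shift N.+2 0%N b')); apply: (iffRL (shift N.+1 1%N b')).
have := conv_moment a b' s0 t0 N; rewrite -!/(I _ _ _) h1 h0.
have E : I N.+2 1%N b' = s / t * I N.+1 2%N b'.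
  apply: (mulfI tN0); rewrite conv_shift//.
  by rewrite mulrA mulrCA divff// mulr1.
rewrite E => H.
(* Both terms of top degree in the moment identity are multiples of the same integral, and their
   coefficients add up to sg^2 / t. *)
have sgt : s ^+ 2 / t + t = sg ^+ 2 / t by rewrite sgE; field.
have {}H : sg ^+ 2 / t * I N.+1 2%N b' = - (b' - a) *
   (s ^+ N.+1 * t ^+ 1 * sg * EE (N.+1 + 1) ((b' - a) / sg) / sg ^+ (N.+1 + 1)) -
   s * N%:R * (s ^+ N * t ^+ 1 * sg * EE (N + 1) ((b' - a) / sg) / sg ^+ (N + 1)).
  have -> : sg ^+ 2 / t * I N.+1 2%N b' =
      s * (s / t * I N.+1 2%N b') + t * I N.+1 2%N b'.
    by rewrite -sgt; field.
  by rewrite mulNr H; ring.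
have st : sg ^+ 2 / t != 0 by rewrite mulf_neq0 ?expf_neq0// invr_eq0.
apply: (mulfI st); rewrite H.
rewrite !addn1 addn2 (EE_rec N.+1) -(natr1 N) !exprS; field.
by rewrite sgN0 tN0 expf_neq0.
Qed.

End gauss_convolution.

(** * Gaussian-based kernels *)

Section kernels.
Context {R : realType}.
Notation mu := (@lebesgue_measure R).
Notation phi := (@phi R).

Definition cs (s : nat) : R := (-1) ^+ s / (2 ^+ s * s`!%:R).

Lemma gkernelE (r : nat) (x : R) : gkernel r x = \sum_(s < r) cs s * DD (2 * s).+1 x.
Proof.
by apply: eq_bigr => s _; rewrite /cs (_ : 2 * (s : nat)%:Z = (2 * s)%N%:Z).
Qed.

Lemma gdom_gkernel (r : nat) : gdom (@gkernel R r).
Proof.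
rewrite (_ : gkernel r = fun x => \sum_(s < r) cs s * DD (2 * s).+1 x).
  by apply: gdom_sum => s _; apply: gdomZ; exact: gdom_DD.
by apply/funext => x; rewrite gkernelE.
Qed.

Lemma antideriv_sum (n : nat) (c : 'I_n -> R) (h : 'I_n -> R -> R) (x : R) :
  (forall i, gdom (h i)) ->
  antideriv (fun y => \sum_(i < n) c i * h i y) x =
  \sum_(i < n) c i * antideriv (h i) x.
Proof.
move=> gh; rewrite /antideriv Rintegral_sum//=; last first.
  by move=> i; apply: gdom_integrableS => //; exact: gdomZ.
by apply: eq_bigr => i _; rewrite RintegralZl//; exact: gdom_integrableS.
Qed.

Lemma GkernelE (r : nat) (x : R) : Gkernel r x = \sum_(s < r) cs s * DD (2 * s) x.
Proof.
rewrite /Gkernel (_ : gkernel r = fun x => \sum_(s < r) cs s * DD (2 * s).+1 x).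
  rewrite antideriv_sum; last by move=> s; exact: gdom_DD.
  by apply: eq_bigr => s _; rewrite antideriv_DD.
by apply/funext => y; rewrite gkernelE.
Qed.

Lemma cs0 : cs 0 = 1.
Proof. by rewrite /cs !expr0 !mul1r invr1. Qed.

(* [smoothed r h t a] is the law of [a + t Z], of distribution function
   [DD 0 ((x - a) / t)], plus the correction terms of the kernel of order [2r]
   with bandwidth [h]. *)
Definition smoothed (r : nat) (h t a x : R) : R :=
  \sum_(s < r) cs s * (h / t) ^+ (2 * s) * DD (2 * s) ((x - a) / t).

Definition smoothedC (r : nat) (h t a x : R) : R :=
  \sum_(s < r) cs s * (h / t) ^+ (2 * s) * DD (2 * s) ((a - x) / t).

(** For s >= 1 the function [DD (2 * s)] is odd, so the correction terms change sign; the 1 comes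
    from the term s = 0, whose coefficient is 1. *)
Lemma smoothedCE (r : nat) (h t a x : R) : (0 < r)%N ->
  smoothedC r h t a x = 1 - smoothed r h t a x.
Proof.
case: r => // r _; rewrite /smoothedC /smoothed !big_ord_recl/=.
rewrite !muln0 !expr0 !cs0 !mul1r opprD addrA -(opprB x a) mulNr DD0N.
congr (_ + _); rewrite -sumrN; apply: eq_bigr => s _.
rewrite (_ : (2 * bump 0 s = (2 * s).+2)%N); last by rewrite /bump; lia.
rewrite DDN (_ : (-1) ^+ (2 * s).+1 = -1) ?mulN1r ?mulrN//.
by rewrite exprS exprM sqrrN !expr1n mulr1.
Qed.

Lemma cbounded_smoothed (r : nat) (h t a : R) : cbounded (smoothed r h t a).
Proof.
apply: cbounded_sum => s _; apply: cboundedZ.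
by apply: cbounded_affine; exact: cbounded_DD.
Qed.

Section product.
Variables (r r' : nat) (h h' t t' a b : R).
Hypotheses (t0 : 0 < t) (t'0 : 0 < t').

Lemma smoothed_prodE (x : R) : smoothed r h t a x * smoothedC r' h' t' b x =
  \sum_(s < r) \sum_(u < r') (cs s * cs u * (h / t) ^+ (2 * s) * (h' / t') ^+ (2 * u)) *
    (DD (2 * s) ((x - a) / t) * DD (2 * u) ((b - x) / t')).
Proof.
rewrite mulr_suml; apply: eq_bigr => s _; rewrite mulr_sumr.
by apply: eq_bigr => u _; ring.
Qed.

Lemma gdom_smoothed : gdom (fun x => smoothed r h t a x * smoothedC r' h' t' b x).
Proof.
under eq_fun do rewrite smoothed_prodE.
apply: gdom_sum => s _; apply: gdom_sum => u _; apply: gdomZ; exact: gdom_DDDD.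
Qed.

(** The weights (h / t)^(2s) cancel the powers of t in the convolution formula, so t and t' survive
    only through sg. *)
Lemma Rintegral_smoothed : let sg := Num.sqrt (t ^+ 2 + t' ^+ 2) in
  \int[mu]_x (smoothed r h t a x * smoothedC r' h' t' b x) =
  \sum_(s < r) \sum_(u < r') cs s * cs u * h ^+ (2 * s) * h' ^+ (2 * u) *
    (sg * EE (2 * (s + u)) ((b - a) / sg) / sg ^+ (2 * (s + u))).
Proof.
move=> sg; under eq_Rintegral do rewrite smoothed_prodE.
have g s u := gdom_DDDD s u a b t0 t'0.
rewrite Rintegral_sum//; last first.
  by move=> s; apply: gdom_integrable; apply: gdom_sum => u _; exact: gdomZ.
apply: eq_bigr => s _; rewrite Rintegral_sum//; last first.
  by move=> u; apply: gdom_integrable; exact: gdomZ.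
apply: eq_bigr => u _; rewrite RintegralZl//; last exact: gdom_integrable.
rewrite convolution_DD// -/sg -mulnDr !expr_div_n.
have := sg_gt0 t0 t'0; rewrite -/sg => sg0.
by field; rewrite !expf_neq0 ?gt_eqF.
Qed.

End product.

Lemma Gkernel_smoothed (r : nat) (x : R) : Gkernel r x = smoothed r 1 1 0 x.
Proof.
by rewrite GkernelE; apply: eq_bigr => s _; rewrite subr0 !divr1 expr1n mulr1.
Qed.

Lemma cbounded_Gkernel (r : nat) : cbounded (@Gkernel R r).
Proof.
have := cbounded_smoothed r 1 1 0; congr cbounded.
by apply/funext => x; rewrite Gkernel_smoothed.
Qed.

Lemma gdom_GGc (r : nat) : (0 < r)%N ->
  gdom (fun x : R => Gkernel r x * (1 - Gkernel r x)).
Proof.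
move=> r0; have := gdom_smoothed r r 1 1 0 0 ltr01 ltr01; congr gdom.
by apply/funext => x; rewrite smoothedCE// -Gkernel_smoothed.
Qed.

Lemma is_derive_Gkernel (r : nat) (x : R) : is_derive x 1 (Gkernel r) (gkernel r x).
Proof.
apply: is_derive_antideriv; first by case: (gdom_gkernel r).
by move=> y; apply: gdom_integrableS => //; exact: gdom_gkernel.
Qed.

(** By the Hermite recurrence x g(x) is a combination of derivatives of [gdom] functions. *)
Lemma Rintegral_x_gkernel (r : nat) : \int[mu]_x (x * gkernel r x) = 0.
Proof.
have gx n : gdom (fun x : R => x * DD n.+1 x) by apply: gdom_mulx; exact: gdom_DD.
have I0 n : \int[mu]_x DD n.+2 x = 0.
  by apply: (Rintegral_deriv0 _ (gdom_DD n)); [exact: gdom_DD|exact: is_derive_DD].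
under eq_Rintegral do rewrite gkernelE mulr_sumr.
under eq_Rintegral do under eq_bigr do rewrite mulrCA.
rewrite Rintegral_sum//; last first.
  by move=> s; apply: gdom_integrable; apply: gdomZ; exact: gx.
rewrite big1// => s _; rewrite RintegralZl//; last by apply: gdom_integrable; exact: gx.
(* The factor 2 s stays inside the integral: at s = 0 it removes [DD 0], which is not integrable. *)
have Ds : \int[mu]_x ((2 * s)%:R * DD (2 * s) x) = 0.
  have [->|s0] := posnP (s : nat).
    by under eq_Rintegral do rewrite mul0r; rewrite Rintegral_cst// mul0r.
  have -> : (2 * s = (2 * s - 2).+2)%N by lia.
  by rewrite RintegralZl ?I0 ?mulr0//; apply: gdom_integrable; exact: gdom_DD.
have gDs : gdom (fun x : R => (2 * s)%:R * DD (2 * s) x).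
  have [->|s0] := posnP (s : nat).
    by under eq_fun do rewrite mul0r; exact: gdom_cst0.
  have -> : (2 * s = (2 * s - 2).+2)%N by lia.
  by apply: gdomZ; exact: gdom_DD.
under eq_Rintegral do rewrite DDx -mulN1r.
rewrite RintegralB//; last 2 first.
- by apply: gdom_integrable; apply: gdomZ; exact: gdom_DD.
- exact: gdom_integrable.
rewrite Ds RintegralZl ?I0 ?mulr0 ?subr0 ?mulr0//.
by apply: gdom_integrable; exact: gdom_DD.
Qed.

(** The derivative of - x G (1 - G) is 2 x G g - x g - G (1 - G). It integrates to zero, and so does
    x g. *)
Lemma psi_gkernel (r : nat) : (0 < r)%N ->
  psi (gkernel r) = \int[mu]_x (Gkernel r x * (1 - Gkernel r x)) :> R.
Proof.
move=> r0; rewrite /psi -/(Gkernel r).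
have gG := gdom_GGc r0; have gg := gdom_gkernel r; have bG := cbounded_Gkernel r.
have gxg := gdom_mulx gg.
have gxGg : gdom (fun x : R => x * Gkernel r x * gkernel r x).
  have := gdomMb gxg bG; congr gdom; apply/funext => x; ring.
pose f (x : R) := (2 * (x * Gkernel r x * gkernel r x) - x * gkernel r x)
  - Gkernel r x * (1 - Gkernel r x).
have gf1 : gdom (fun x : R => 2 * (x * Gkernel r x * gkernel r x) - x * gkernel r x).
  apply: gdomD; first exact: gdomZ.
  by have := gdomZ (-1) gxg; under eq_fun do rewrite mulN1r.
have gf : gdom f.
  apply: gdomD => //.
  by have := gdomZ (-1) gG; under eq_fun do rewrite mulN1r.
have : \int[mu]_x f x = 0.
  have gF := gdomZ (-1) (gdom_mulx gG).
  apply: (Rintegral_deriv0 gf gF) => y.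
  have DG := is_derive_Gkernel r y.
  have D1 := is_deriveDf (is_derive_cstf 1 y)
    (is_deriveMf (is_derive_cstf (-1) y) DG).
  have := is_deriveMf (is_derive_cstf (-1) y)
    (is_deriveMf (is_derive_id y 1) (is_deriveMf DG D1)).
  rewrite [X in is_derive _ _ X _](_ : _ = fun x =>
    -1 * (x * (Gkernel r x * (1 - Gkernel r x)))); last first.
    by apply/funext => z; rewrite (mulN1r (Gkernel r z)).
  by move=> H; apply: (is_derive_eq H); rewrite /f /=; ring.
rewrite /f RintegralB//; last 2 first.
- exact: gdom_integrable.
- exact: gdom_integrable.
rewrite RintegralB//; last 2 first.
- by apply: gdom_integrable; exact: gdomZ.
- exact: gdom_integrable.
rewrite Rintegral_x_gkernel subr0 RintegralZl//; last exact: gdom_integrable.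
by move/eqP; rewrite subr_eq0 => /eqP.
Qed.

Lemma psi_EE (r : nat) : (0 < r)%N ->
  psi (gkernel r) = \sum_(s < r) \sum_(u < r)
    cs s * cs u * (Num.sqrt 2 * EE (2 * (s + u)) 0 / 2 ^+ (s + u)).
Proof.
move=> r0; rewrite psi_gkernel//.
under eq_Rintegral do rewrite Gkernel_smoothed -smoothedCE//.
rewrite Rintegral_smoothed//; apply: eq_bigr => s _; apply: eq_bigr => u _.
by rewrite !expr1n !mulr1 subrr mul0r -[1 + 1]/(2%:R) exprM sqr_sqrtr.
Qed.

Lemma OF_base : OF (2 * 0%:Z - 2) = -1 :> R.
Proof.
rewrite /OF/= /index_iota/= unlock/= /reducebig/=.
by rewrite expr1 mulr1 mulr1; field.
Qed.

(** The value OF(-2) = -1 extends the recurrence of odd factorials to n = 0, in step with that of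
    [EE] at the point 0. *)
Lemma OF_rec (n : nat) :
  OF (2 * n.+1%:Z - 2) = (2 * n%:R - 1) * OF (2 * n%:Z - 2) :> R.
Proof.
case: n => [|n].
  rewrite OF_base mulr0 sub0r mulrNN mulr1.
  rewrite (_ : 2 * 1%:Z - 2 = 0%:Z)// /OF/=.
  by rewrite big_geq// mulr1.
have E k : 2 * k.+1%:Z - 2 = (2 * k)%N%:Z by lia.
have OFE k : OF (2 * k)%N%:Z = \prod_(1 <= i < k.+1) (2 * i%:R - 1) :> R.
  by rewrite /OF absz_nat mul2n odd_double doubleK.
by rewrite !E !OFE big_nat_recr//= mulrC.
Qed.

Lemma EE_even0 (n : nat) : EE (2 * n) 0 =
  - (-1) ^+ n * OF (2 * n%:Z - 2) / Num.sqrt (2 * pi) :> R.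
Proof.
elim: n => [|n IH].
  rewrite muln0 EE0 mul0r addr0 phiE expr0n/= mul0r oppr0 expR0 mulr1.
  by rewrite OF_base expr0 mulrNN !mul1r.
rewrite mulnS add2n EE_rec oppr0 mul0r sub0r IH OF_rec exprS natrM; ring.
Qed.

Lemma psi_OF (r : nat) : (0 < r)%N ->
  psi (gkernel r) = - (Num.sqrt pi)^-1 * (\sum_(s < r) \sum_(t < r)
    OF (2 * s%:Z + 2 * t%:Z - 2) / (2 ^+ (2 * s + 2 * t) * s`!%:R * t`!%:R)) :> R.
Proof.
move=> r0; rewrite psi_EE// mulr_sumr; apply: eq_bigr => s _.
rewrite mulr_sumr; apply: eq_bigr => t _.
rewrite EE_even0 (_ : 2 * s%:Z + 2 * t%:Z - 2 = 2 * (s + t)%N%:Z - 2); last first.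
  by rewrite PoszD mulrDr.
rewrite sqrtrM// /cs -mulnDr mul2n -addnn !exprD.
have p0 : Num.sqrt pi != 0 :> R by rewrite sqrtr_eq0 -ltNge pi_gt0.
have s20 : Num.sqrt 2 != 0 :> R by rewrite sqrtr_eq0 -ltNge.
have sg : (-1) ^+ s * (-1) ^+ t * ((-1) ^+ s * (-1) ^+ t) = 1 :> R.
  by rewrite -exprD -exprD addnn -mul2n exprM sqrrN !expr1n.
have f0 k : k`!%:R != 0 :> R by rewrite pnatr_eq0 -lt0n fact_gt0.
have e0 k : 2 ^+ k != 0 :> R by rewrite expf_neq0.
transitivity (- ((-1) ^+ s * (-1) ^+ t * ((-1) ^+ s * (-1) ^+ t)) * (Num.sqrt pi)^-1 *
  (OF (2 * (s + t)%N%:Z - 2) / (2 ^+ s * 2 ^+ t * (2 ^+ s * 2 ^+ t) * s`!%:R * t`!%:R)) : R).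
  by field; rewrite !f0 !e0 p0 s20.
by rewrite sg; ring.
Qed.

End kernels.

(** * Coin tossing *)

Section fair_coin.
Context {R : realType}.
Notation phi := (@phi R).

(* The probability that the first [s + t] tosses of a fair coin show [s] heads
   and [t] tails. *)
Definition W (s t : nat) : R := 'C(s + t, s)%:R / 2 ^+ (s + t).

(* [al n = 'C(2 * n, n) / 4 ^ n]. *)
Fixpoint al (n : nat) : R :=
  if n is n'.+1 then al n' * ((2 * n'%:R + 1) / (2 * n'%:R + 2)) else 1.

Definition backward_diff (u : nat -> R) (n : nat) : R :=
  u n - (if n is n'.+1 then u n' else 0).

Lemma W_sym (s t : nat) : W s t = W t s.
Proof. by rewrite /W (addnC t s) -(bin_sub (leq_addr t s)) addKn. Qed.

Lemma W0 (t : nat) : W 0 t = (2 ^+ t)^-1.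
Proof. by rewrite /W add0n bin0 mul1r. Qed.

Lemma W_pascal (s t : nat) : W s.+1 t.+1 = 2^-1 * (W s t.+1 + W s.+1 t).
Proof.
rewrite /W !addSn !addnS binS natrD !exprS addnC -[in 'C(_, s)]addnC.
by field; rewrite expf_neq0.
Qed.

(** Pascal's rule by the outcome of the last toss, valid on the axes too since terms with a negative
    index count as zero; u is taken one toss earlier. *)
Lemma W_prev (u : nat -> R) (s t : nat) :
  W s t * (if (s + t)%N is n.+1 then u n else 0) =
  2^-1 * ((if s is s'.+1 then W s' t * u (s' + t)%N else 0) +
          (if t is t'.+1 then W s t' * u (s + t')%N else 0)).
Proof.
case: s t => [|s] [|t].
- by rewrite addn0 !mulr0 addr0 mulr0.
- by rewrite add0n add0r !W0 exprS invfM mulrA.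
- by rewrite addn0 addr0 !(W_sym _ 0) !W0 exprS invfM mulrA addn0.
- by rewrite W_pascal addSn addnS addSn; ring.
Qed.

Lemma sum_shift (g : nat -> R) (k : nat) :
  \sum_(s < k.+1) (if s : nat is s'.+1 then g s' else 0) = \sum_(s < k) g s.
Proof. by rewrite big_ord_recl add0r; apply: eq_bigr. Qed.

(* Pascal's rule reduces the sum over the square [[0, k]^2] to its boundary. *)
Lemma square_exit (u : nat -> R) (k : nat) :
  \sum_(s < k.+1) \sum_(t < k.+1) W s t * backward_diff u (s + t) =
  \sum_(t < k.+1) W k t * u (k + t)%N.
Proof.
pose f s t := W s t * u (s + t)%N.
have fC s t : f s t = f t s by rewrite /f W_sym addnC.
have -> : \sum_(s < k.+1) \sum_(t < k.+1) W s t * backward_diff u (s + t) =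
  \sum_(s < k.+1) \sum_(t < k.+1) f s t -
  2^-1 * (\sum_(s < k) \sum_(t < k.+1) f s t + \sum_(s < k.+1) \sum_(t < k) f s t).
  rewrite -(sum_shift (fun s => \sum_(t < k.+1) f s t) k).
  have -> : \sum_(s < k.+1) \sum_(t < k) f s t = \sum_(s < k.+1)
      \sum_(t < k.+1) (if t : nat is t'.+1 then f s t' else 0).
    by apply: eq_bigr => s _; rewrite (sum_shift (f s)).
  rewrite -big_split/= mulr_sumr -sumrB; apply: eq_bigr => s _.
  have -> : (if s : nat is s'.+1 then \sum_(t < k.+1) f s' t else 0) =
     \sum_(t < k.+1) (if s : nat is s'.+1 then f s' t else 0).
    by case: (s : nat) => // ; rewrite big1.
  rewrite -big_split/= mulr_sumr -sumrB; apply: eq_bigr => t _.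
  by rewrite /backward_diff mulrBr W_prev.
(* The square minus half of both truncated squares leaves half of the last row and half of the last
   column, which agree by symmetry. *)
have E1 : \sum_(s < k.+1) \sum_(t < k.+1) f s t =
    \sum_(s < k) \sum_(t < k.+1) f s t + \sum_(t < k.+1) f k t.
  by rewrite big_ord_recr.
have E2 : \sum_(s < k.+1) \sum_(t < k.+1) f s t =
    \sum_(s < k.+1) \sum_(t < k) f s t + \sum_(t < k.+1) f k t.
  under eq_bigr do rewrite big_ord_recr/=.
  by rewrite big_split/=; congr (_ + _); apply: eq_bigr => s _; rewrite fC.
rewrite -/(f _ _); under [RHS]eq_bigr do rewrite -/(f _ _).
move: E1 E2; lra.
Qed.

(** This is [square_exit] for u = 1, whose backward difference is 1 at the origin and 0
    elsewhere. *)
Lemma W_total (k : nat) : \sum_(t < k.+1) W k t = 1.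
Proof.
have := square_exit (fun=> 1) k; under [in RHS]eq_bigr do rewrite mulr1.
move=> <-; rewrite !big_ord_recl/= W0 expr0 invr1 mul1r /backward_diff/= subr0.
rewrite [X in _ + X + _]big1 ?addr0; last first.
  by move=> i _; rewrite subrr mulr0.
rewrite big1 ?addr0// => s _; rewrite big1// => t _.
by rewrite subrr mulr0.
Qed.

Lemma al_gt0 (n : nat) : 0 < al n.
Proof.
elim: n => //= n IH; have n0 : 0 <= n%:R :> R by [].
by rewrite mulr_gt0// divr_gt0//; lra.
Qed.

Lemma alS_sub (n : nat) : al n.+1 - al n = - al n / (2 * n.+1%:R).
Proof.
have n0 : 0 <= n%:R :> R by [].
have n1 : 2 * n%:R + 2 != 0 :> R by rewrite gt_eqF//; lra.
have n2 : n%:R + 1 != 0 :> R by rewrite gt_eqF//; lra.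
rewrite -(natr1 n) /=; field.
by rewrite n2 n1.
Qed.

Lemma OF_al (n : nat) : OF (2 * n.+1%:Z - 2) = 2 ^+ n * n`!%:R * al n :> R.
Proof.
elim: n => [|n IH].
  by rewrite OF_rec OF_base mulr0 sub0r mulrNN expr0 fact0 /= !mulr1.
have n0 : 0 <= n%:R :> R by [].
have n1 : 2 * n%:R + 2 != 0 :> R by rewrite gt_eqF//; lra.
by rewrite OF_rec IH factS natrM exprS -(natr1 n) /=; field.
Qed.

(** This is what makes the double sum for psi an instance of [square_exit]. The exceptional value
    OF(-2) = -1 corresponds to [al 0 = 1], with [al] continued by 0 to the left. *)
Lemma OF_backward_diff (n : nat) :
  - OF (2 * n%:Z - 2) = 2 ^+ n * n`!%:R * backward_diff al n :> R.
Proof.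
case: n => [|n].
  by rewrite OF_base opprK fact0 expr0 /backward_diff subr0 !mul1r.
rewrite OF_al /backward_diff alS_sub factS natrM exprS.
have n0 : 0 <= n%:R :> R by [].
by field; apply: lt0r_neq0; lra.
Qed.

Lemma psi_al (k : nat) :
  psi (gkernel k.+1) = (Num.sqrt pi)^-1 * \sum_(t < k.+1) W k t * al (k + t) :> R.
Proof.
rewrite psi_OF// mulNr -mulrN; congr (_ * _).
rewrite -square_exit -sumrN; apply: eq_bigr => s _.
rewrite -sumrN; apply: eq_bigr => t _.
rewrite -mulNr (_ : 2 * s%:Z + 2 * t%:Z - 2 = 2 * (s + t)%N%:Z - 2); last first.
  by rewrite PoszD mulrDr.
rewrite OF_backward_diff /W.
have f0 n : n`!%:R != 0 :> R by rewrite pnatr_eq0 -lt0n fact_gt0.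
have e0 n : 2 ^+ n != 0 :> R by rewrite expf_neq0.
have <- : 'C(s + t, s)%:R * (s`!%:R * t`!%:R) = (s + t)`!%:R :> R.
  by rewrite -!natrM -(bin_fact (leq_addr t s)) addKn.
rewrite -mulnDr mul2n -addnn !exprD; field.
by rewrite !f0 !e0.
Qed.

Lemma abel_sum (w A : nat -> R) (k : nat) :
  \sum_(t < k.+1) w t * A t = A k * \sum_(t < k.+1) w t +
  \sum_(s < k) (A s - A s.+1) * \sum_(j < s.+1) w j.
Proof.
elim: k => [|k IH]; first by rewrite !big_ord1 big_ord0 addr0 mulrC.
rewrite big_ord_recr/= IH [\sum_(t < k.+2) w t]big_ord_recr/=.
by rewrite [X in _ = _ + X]big_ord_recr/= [\sum_(i < k.+1) w i]big_ord_recr/=; ring.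
Qed.

(** Summation by parts. The factor 1/2 from the decrement of [al] is kept with the partial sum of
    [W], because their product is an incomplete beta function. *)
Lemma psi_abel (k : nat) :
  psi (gkernel k.+1) = (Num.sqrt pi)^-1 * (al (2 * k) +
    \sum_(s < k) al (k + s) / (k + s).+1%:R * (2^-1 * \sum_(j < s.+1) W k j)) :> R.
Proof.
rewrite psi_al (abel_sum (W k) (fun t => al (k + t))) W_total mulr1 mul2n -addnn.
congr (_ * (_ + _)); apply: eq_bigr => s _.
rewrite addnS -(opprB (al (k + s).+1)) alS_sub.
have n0 : 0 <= (k + s)%:R :> R by [].
by field; apply: lt0r_neq0; move: n0; rewrite natrD; lra.
Qed.

End fair_coin.

(** * Gamma and beta functions *)

Section local_FTC.
Context {R : realType}.
Notation mu := (@lebesgue_measure R).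

(** The hypotheses concern only the closed interval because the primitives used below involve sqrt,
    which is not differentiable at 0. *)
Lemma integral_itvFTC_loc (f F : R -> R) (a b : R) : a < b ->
  (forall x : R, a <= x <= b -> {for x, continuous f}) ->
  (forall x : R, a <= x <= b -> is_derive x 1 F (f x)) ->
  (\int[mu]_(x in `[a, b]) (f x)%:E = (F b - F a)%:E)%E.
Proof.
move=> ab cf dF.
have cF (x : R) : a <= x <= b -> {for x, continuous F}.
  move=> /dF Fx; apply/differentiable_continuous/derivable1_diffP.
  by have [] := Fx.
rewrite (@continuous_FTC2 _ f F)//.
- apply: continuous_in_subspaceT => x; rewrite inE/= in_itv/=; exact: cf.
- split.
  + move=> x; rewrite in_itv/= => /andP[ax xb].
    by have [] : is_derive x 1 F (f x) by apply: dF; rewrite !ltW.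
  + by apply: cvg_at_right_filter; apply: cF; rewrite lexx ltW.
  + by apply: cvg_at_left_filter; apply: cF; rewrite lexx ltW.
- move=> x; rewrite in_itv/= => /andP[ax xb]; rewrite derive1E.
  by have [] : is_derive x 1 F (f x) by apply: dF; rewrite !ltW.
Qed.

End local_FTC.

Lemma is_deriveXf {R : realType} (f : R -> R) (x df : R) (n : nat) :
  is_derive x 1 f df ->
  is_derive x 1 (fun t => f t ^+ n.+1) (n.+1%:R * f x ^+ n * df).
Proof.
move=> Df; elim: n => [|n IH].
  by rewrite expr0 !mul1r; under eq_fun do rewrite expr1.
under eq_fun do rewrite exprS.
by have := is_deriveMf Df IH => H; apply: (is_derive_eq H); rewrite -(natr1 n.+1) exprS; ring.
Qed.

Lemma is_derive_expRN {R : realType} (x : R) :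
  is_derive x 1 (fun t : R => expR (- t)) (- expR (- x)).
Proof.
have DN : is_derive x 1 (fun t : R => - t) (-1) by exact: is_deriveNid.
have := @is_derive1_comp _ expR (fun t : R => - t) x _ _ (is_derive_expR _) DN.
by move=> H; apply: (is_derive_eq H); rewrite mulrN1.
Qed.

Lemma lebesgue_integrableD {R : realType} (A : set R) (f g : R -> R) : measurable A ->
  (@lebesgue_measure R).-integrable A (EFin \o f) ->
  (@lebesgue_measure R).-integrable A (EFin \o g) ->
  (@lebesgue_measure R).-integrable A (EFin \o (fun x => f x + g x)).
Proof.
move=> mA intf intg.
rewrite (_ : EFin \o _ = (EFin \o f) \+ (EFin \o g))%E; last exact/funext.
by apply: integrableD.
Qed.

(** * The gamma function at multiples of 1/2 and Wallis' bounds *)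

Section half_integer_gamma.
Context {R : realType}.
Notation mu := (@lebesgue_measure R).
Notation phi := (@phi R).

(* The integrand of [Gamma (k.+1 / 2)]. *)
Definition hgamma_fun (k : nat) (t : R) : R :=
  Num.sqrt t ^+ k / Num.sqrt t * expR (- t).

Definition hgamma (k : nat) : R := \int[mu]_(t in `]0, +oo[) hgamma_fun k t.

(** Compact intervals filling ]0, +oo[ and avoiding the singularity at 0; n + 2 makes them
    non-degenerate already at n = 0. *)
Let J (n : nat) : set R := `[n.+2%:R^-1, n.+2%:R]%classic.

Lemma J_lt (n : nat) : n.+2%:R^-1 < n.+2%:R :> R.
Proof.
apply: (@lt_trans _ _ 1); first by rewrite invf_lt1 ?ltr0n ?ltr1n.
by rewrite ltr1n.
Qed.

Lemma J_gt0 (n : nat) (x : R) : n.+2%:R^-1 <= x -> 0 < x.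
Proof. by move=> h; rewrite (lt_le_trans _ h)// invr_gt0. Qed.

Lemma J_bigcup : \bigcup_n J n = `]0, +oo[%classic.
Proof.
apply/seteqP; split=> [x [n _]|x] /=.
  by rewrite /J/= !in_itv/= andbT => /andP[/J_gt0].
rewrite in_itv/= andbT => x0.
pose m := (Num.truncn x + Num.truncn x^-1)%N.
have h1 := truncnS_gt x; have h2 := truncnS_gt x^-1.
exists m => //=; rewrite /J/= in_itv/=; apply/andP; split.
  rewrite -(invrK x) lef_pV2 ?posrE ?invr_gt0//.
  by rewrite (le_trans (ltW h2))// ler_nat; apply: leqW; rewrite ltnS leq_addl.
by rewrite (le_trans (ltW h1))// ler_nat; apply: leqW; rewrite ltnS leq_addr.
Qed.

Lemma hgamma_fun_ge0 (k : nat) (t : R) : 0 <= hgamma_fun k t.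
Proof. by rewrite mulr_ge0 ?expR_ge0// divr_ge0 ?exprn_ge0 ?sqrtr_ge0. Qed.

Lemma continuous_hgamma_fun (k : nat) (t : R) : 0 < t ->
  {for t, continuous (hgamma_fun k)}.
Proof.
move=> t0; have c := @sqrt_continuous R t.
apply: cvgM; first apply: cvgM.
- elim: k => [|k IH]; first by under eq_fun do rewrite expr0; exact: cvg_cst.
  by under eq_fun do rewrite exprS; rewrite exprS; apply: cvgM.
- by apply: cvgV => //; rewrite gt_eqF// sqrtr_gt0.
- apply: continuous_comp; last exact: continuous_expR.
  by apply: (@cvgN _ R^o); exact: cvg_id.
Qed.

Lemma measurable_hgamma_fun (k : nat) :
  measurable_fun (`]0, +oo[%classic : set R) (hgamma_fun k).
Proof.
apply: open_continuous_measurable_fun => // x; rewrite inE/= in_itv/= andbT.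
exact: continuous_hgamma_fun.
Qed.

(** Values on the intervals [J n] together with their limit. By monotone convergence this gives the
    integral and its finiteness at once, so the recurrence needs no prior integrability. *)
Let has_integral (k : nat) (l : R) := exists v : nat -> R,
  (forall n, (\int[mu]_(t in J n) (hgamma_fun k t)%:E = (v n)%:E)%E) /\
  v n @[n --> \oo] --> l.

Lemma has_integralP (k : nat) (l : R) : has_integral k l ->
  (\int[mu]_(t in `]0%R, +oo[) (hgamma_fun k t)%:E = l%:E)%E.
Proof.
move=> [v [vE vl]].
have h : (\int[mu]_(t in J n) (hgamma_fun k t)%:E @[n --> \oo] -->
    \int[mu]_(t in \bigcup_n J n) (hgamma_fun k t)%:E)%E.
  apply: ge0_nondecreasing_set_cvg_integral.
  - move=> n m nm; apply/subsetPset => x; rewrite /J/= !in_itv/= => /andP[h1 h2].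
    rewrite (le_trans h2) ?ler_nat// andbT (le_trans _ h1)//.
    by rewrite lef_pV2 ?posrE ?ler_nat.
  - by move=> n; exact: measurable_itv.
  - move=> n; apply/measurable_EFinP.
    apply: measurable_funS (measurable_hgamma_fun k) => //.
    by rewrite -J_bigcup; exact: bigcup_sup.
  - by move=> n x _; rewrite lee_fin hgamma_fun_ge0.
rewrite J_bigcup in h.
have h2 : ((v n)%:E @[n --> \oo] --> l%:E)%E by apply: cvg_EFin => //; exact: nearW.
rewrite (_ : (fun n => _) = fun n => (v n)%:E) in h; last exact/funext.
by rewrite -(cvg_lim _ h)// (cvg_lim _ h2).
Qed.

Lemma cvg_expRN_n (C : R) (c : R) : 0 < c ->
  C * expR (- (c * n.+2%:R)) @[n --> \oo] --> 0.
Proof.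
move=> c0.
have hc D : D * harmonic n @[n --> \oo] --> (0 : R).
  by rewrite -(mulr0 D); apply: cvgM; [exact: cvg_cst|exact: cvg_harmonic].
have hN : - (`|C| / c * harmonic n) @[n --> \oo] --> (0 : R).
  by rewrite -oppr0; exact: cvgN.
apply: squeeze_cvgr hN (hc (`|C| / c)); near=> n; rewrite -ler_norml normrM.
rewrite (ger0_norm (expR_ge0 _)) -mulrA ler_wpM2l// expRN /harmonic/= -invfM.
rewrite lef_pV2 ?posrE ?expR_gt0 ?mulr_gt0//.
apply: le_trans (expR_ge1Dx _).
apply: (@le_trans _ _ (c * n.+2%:R)); last by rewrite lerDr.
by rewrite ler_pM2l// ler_nat.
Unshelve. all: by end_near. Qed.

Lemma cvg_invSS : (n.+2%:R : R)^-1 @[n --> \oo] --> 0.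
Proof.
have := @cvg_harmonic R; rewrite -(cvg_shiftS (@harmonic R)); exact.
Qed.

Lemma cvg_sqrt_invSS : Num.sqrt (n.+2%:R^-1 : R) @[n --> \oo] --> 0.
Proof.
rewrite -[X in _ --> X](@sqrtr0 R).
by apply: (cvg_comp _ _ cvg_invSS); exact: sqrt_continuous.
Qed.

Lemma DD0_0 : DD 0 0 = 2^-1 :> R.
Proof. by have := @DD0N R 0; rewrite oppr0; lra. Qed.

(** The substitution t = u^2 / 2 turns the integrand into phi, so 2 sqrt(pi) Phi(sqrt(2 t)) is a
    primitive; it increases from sqrt(pi) to 2 sqrt(pi). *)
Lemma has_integral0 : has_integral 0 (Num.sqrt pi).
Proof.
pose F (t : R) := 2 * Num.sqrt pi * DD 0 (Num.sqrt 2 * Num.sqrt t).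
exists (fun n => F n.+2%:R - F n.+2%:R^-1); split.
  move=> n; apply: integral_itvFTC_loc; first exact: J_lt.
    by move=> x /andP[/J_gt0 x0 _]; exact: continuous_hgamma_fun.
  move=> x /andP[/J_gt0 x0 _].
  have D1 := is_deriveMf (is_derive_cstf (Num.sqrt 2) x) (is_derive1_sqrt x0).
  have D2 := @is_derive1_comp _ (DD 0) (fun t => Num.sqrt 2 * Num.sqrt t) x _ _
    (is_derive_DD 0 _) D1.
  have := is_deriveMf (is_derive_cstf (2 * Num.sqrt pi) x) D2.
  move=> H; apply: (is_derive_eq H).
  rewrite !mul0r !add0r DD1 phiE exprMn !sqr_sqrtr ?(ltW x0)//.
  rewrite /hgamma_fun expr0 [2 * x]mulrC mulfK//.
  have p0 : Num.sqrt pi != 0 :> R by rewrite sqrtr_eq0 -ltNge pi_gt0.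
  have s20 : Num.sqrt 2 != 0 :> R by rewrite sqrtr_eq0 -ltNge.
  have sx0 : Num.sqrt x != 0 by rewrite sqrtr_eq0 -ltNge.
  rewrite sqrtrM//; field.
  by rewrite p0 s20 sx0.
have E : Num.sqrt pi = 2 * Num.sqrt pi * 1 - 2 * Num.sqrt pi * 2^-1 :> R by field.
rewrite [X in _ --> X]E; apply: cvgB; apply: cvgM; try exact: cvg_cst.
  have [B [B0 hB]] := @DD0_left_tail R.
  have e0 : 0 < 2^-1 :> R by rewrite invr_gt0.
  have hB1 : 1 - B * expR (- (2^-1 * n.+2%:R)) @[n --> \oo] --> (1 - 0 : R).
    by apply: cvgB; [exact: cvg_cst|exact: cvg_expRN_n].
  rewrite subr0 in hB1.
  apply: squeeze_cvgr hB1 (cvg_cst (1 : R)); near=> n.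
  rewrite DD0_le1 andbT -[X in DD 0 X]opprK DD0N lerD2l lerN2.
  have s0 : 0 <= Num.sqrt 2 * Num.sqrt n.+2%:R :> R by rewrite mulr_ge0 ?sqrtr_ge0.
  apply: le_trans (hB _ _) _; first by rewrite oppr_le0.
  rewrite sqrrN exprMn !sqr_sqrtr//; apply: ler_wpM2l => //.
  by rewrite ler_expR; lra.
rewrite -DD0_0 -[X in _ --> DD 0 X](mulr0 (Num.sqrt 2)).
apply: cvg_comp; last exact: (@continuous_DD R 0).
by apply: cvgM; [exact: cvg_cst|exact: cvg_sqrt_invSS].
Unshelve. all: by end_near. Qed.

Lemma has_integral1 : has_integral 1 1.
Proof.
pose F (t : R) := -1 * expR (- t).
have dE := @is_derive_expRN R.
exists (fun n => F n.+2%:R - F n.+2%:R^-1); split.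
  move=> n; apply: integral_itvFTC_loc; first exact: J_lt.
    by move=> x /andP[/J_gt0 x0 _]; exact: continuous_hgamma_fun.
  move=> x /andP[/J_gt0 x0 _].
  have := is_deriveMf (is_derive_cstf (-1) x) (dE x).
  move=> H; apply: (is_derive_eq H); rewrite mul0r add0r mulN1r opprK.
  by rewrite /hgamma_fun expr1 divff ?mul1r// sqrtr_eq0 -ltNge.
have E : 1 = 0 - (-1 * expR (- 0)) :> R by rewrite oppr0 expR0; ring.
rewrite [X in _ --> X]E; apply: cvgB.
  rewrite /F; under eq_fun do rewrite -[X in expR (- X)]mul1r.
  exact: cvg_expRN_n.
apply: cvgM; first exact: cvg_cst.
apply: cvg_comp; last exact: (@continuous_expR R).
by apply: cvgN; exact: cvg_invSS.
Qed.

(** Integration by parts with F(t) = sqrt(t)^(k+1) exp(- t), which vanishes at both ends. *)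
Lemma has_integralSS (k : nat) (l : R) : has_integral k l ->
  has_integral k.+2 (k.+1%:R / 2 * l).
Proof.
move=> [v [vE vl]].
pose F (t : R) := Num.sqrt t ^+ k.+1 * expR (- t).
exists (fun n => k.+1%:R / 2 * v n - (F n.+2%:R - F n.+2%:R^-1)); split.
  move=> n.
  have J0 x : J n x -> 0 < x by rewrite /J/= in_itv/= => /andP[/J_gt0].
  have iF : (\int[mu]_(t in J n) (k.+1%:R / 2 * hgamma_fun k t - hgamma_fun k.+2 t)%:E
      = (F n.+2%:R - F n.+2%:R^-1)%:E)%E.
    apply: integral_itvFTC_loc; first exact: J_lt.
      move=> x /andP[/J_gt0 x0 _]; apply: cvgB; last exact: continuous_hgamma_fun.
      by apply: cvgM; [exact: cvg_cst|exact: continuous_hgamma_fun].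
    move=> x /andP[/J_gt0 x0 _].
    have D1 := is_derive_expRN x.
    have D2 : is_derive x 1 (fun t : R => Num.sqrt t ^+ k.+1)
        (k.+1%:R * Num.sqrt x ^+ k * (2 * Num.sqrt x)^-1).
      exact: is_deriveXf (is_derive1_sqrt x0).
    have := is_deriveMf D2 D1; move=> H; apply: (is_derive_eq H).
    have sx0 : Num.sqrt x != 0 by rewrite sqrtr_eq0 -ltNge.
    by rewrite /hgamma_fun !exprS; field.
  have iJ j : mu.-integrable (J n) (EFin \o hgamma_fun j).
    apply: continuous_compact_integrable; first exact: segment_compact.
    apply: continuous_in_subspaceT => x; rewrite inE => /J0.
    exact: continuous_hgamma_fun.
  have mJ : measurable (J n) := measurable_itv _.
  have vR : \int[mu]_(t in J n) hgamma_fun k t = v n by rewrite /Rintegral vE.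
  have iFR : \int[mu]_(t in J n) (k.+1%:R / 2 * hgamma_fun k t - hgamma_fun k.+2 t) =
     F n.+2%:R - F n.+2%:R^-1 by rewrite /Rintegral iF.
  rewrite (lebesgue_EFin_Rintegral mJ (iJ k.+2)); congr EFin.
  have iJZ := lebesgue_integrable_scale (k.+1%:R / 2) mJ (iJ k).
  move: iFR; rewrite RintegralB; [|exact: mJ|exact: iJZ|exact: iJ].
  rewrite RintegralZl; [|exact: mJ|exact: iJ].
  by rewrite vR => <-; ring.
rewrite -[X in _ --> X]subr0; apply: cvgB.
  by apply: cvgM => //; exact: cvg_cst.
have F0 t : 0 <= F t by rewrite mulr_ge0 ?expR_ge0// exprn_ge0// sqrtr_ge0.
rewrite -[X in _ --> X](subr0 0); apply: cvgB.
  (* At b = n + 2 the bounds sqrt(b) <= b and exp(b) >= b^(k+2) / (k+2)! give F(b) <= (k+2)! / b. *)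
  have h : k.+2`!%:R * harmonic n @[n --> \oo] --> (0 : R).
    by rewrite -(mulr0 k.+2`!%:R); apply: cvgM; [exact: cvg_cst|exact: cvg_harmonic].
  apply: squeeze_cvgr (cvg_cst 0) h; near=> n.
  apply/andP; split; first exact: F0.
  rewrite /F.
  set b : R := n.+2%:R; have b1 : 1 <= b by rewrite ler1n.
  have b0 : 0 < b by rewrite ltr0n.
  have sb : Num.sqrt b <= b.
    have b2 : b <= b ^+ 2 by rewrite expr2 ler_peMr// ltW.
    rewrite -[leRHS](ger0_norm (ltW b0)) -sqrtr_sqr ler_sqrt; first exact: b2.
    exact: sqr_ge0.
  have st1 : Num.sqrt b ^+ k.+1 * expR (- b) <= b ^+ k.+1 * (k.+2`!%:R / b ^+ k.+2).
    apply: ler_pM; [by rewrite exprn_ge0 ?sqrtr_ge0|exact: expR_ge0| |].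
      by apply: lerXn2r; rewrite ?nnegrE ?sqrtr_ge0 ?(ltW b0) ?sb.
    have fp : 0 < k.+2`!%:R :> R by rewrite ltr0n fact_gt0.
    rewrite expRN -[leRHS]invrK lef_pV2 ?posrE ?expR_gt0//; last first.
      by rewrite invr_gt0 divr_gt0// exprn_gt0.
    rewrite invf_div; apply: le_trans (expR_ge1Dxn k.+1 (ltW b0)).
    by rewrite lerDr.
  apply: le_trans st1 _; rewrite (exprS b k.+1); set bk := b ^+ k.+1.
  have bk0 : bk != 0 by rewrite expf_neq0// gt_eqF.
  have -> : bk * (k.+2`!%:R / (b * bk)) = k.+2`!%:R * b^-1.
    by field; rewrite bk0 gt_eqF.
  by rewrite ler_wpM2l// /harmonic/= lef_pV2 ?posrE// ler_nat.
apply: squeeze_cvgr (cvg_cst 0) cvg_sqrt_invSS; near=> n; rewrite F0/= /F.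
set a : R := n.+2%:R^-1.
have a0 : 0 < a by rewrite invr_gt0.
have a1 : a <= 1 by rewrite invf_le1 ?ler1n// ltr0n.
have sa : Num.sqrt a <= 1 by rewrite -[leRHS]sqrtr1 ler_sqrt.
rewrite exprS -mulrA ler_piMr ?sqrtr_ge0// mulr_ile1 ?expR_ge0 ?exprn_ge0 ?sqrtr_ge0//.
  by rewrite exprn_ile1 ?sqrtr_ge0.
by rewrite expR_le1 oppr_le0 ltW.
Unshelve. all: by end_near. Qed.

Lemma ex_has_integral (k : nat) : exists l, has_integral k l.
Proof.
have : (exists l, has_integral k l) /\ (exists l, has_integral k.+1 l).
  elim: k => [|k [[l hl] h]].
    by split; [exists (Num.sqrt pi); exact: has_integral0|exists 1; exact: has_integral1].
  by split=> //; exists (k.+1%:R / 2 * l); exact: has_integralSS.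
by case.
Qed.

Lemma hgammaE (k : nat) (l : R) : has_integral k l -> hgamma k = l.
Proof. by move=> /has_integralP h; rewrite /hgamma /Rintegral h. Qed.

Lemma hgamma0 : hgamma 0 = Num.sqrt pi.
Proof. exact/hgammaE/has_integral0. Qed.

Lemma hgamma1 : hgamma 1 = 1.
Proof. exact/hgammaE/has_integral1. Qed.

Lemma hgammaSS (k : nat) : hgamma k.+2 = k.+1%:R / 2 * hgamma k.
Proof.
have [l hl] := ex_has_integral k.
by rewrite (hgammaE hl) (hgammaE (has_integralSS hl)).
Qed.

Lemma integrable_hgamma (k : nat) : mu.-integrable `]0, +oo[ (EFin \o hgamma_fun k).
Proof.
have [l /has_integralP hl] := ex_has_integral k.
apply/integrableP; split.
  by apply/measurable_EFinP; exact: measurable_hgamma_fun.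
under eq_integral do rewrite /= ger0_norm ?hgamma_fun_ge0//.
by rewrite hl ltry.
Qed.

Lemma Gamma_hgamma (k : nat) : Gamma (k.+1%:R / 2) = hgamma k :> R.
Proof.
apply: eq_Rintegral => t; rewrite inE/= in_itv/= andbT => t0; congr (_ * _).
rewrite -powR12_sqrt ?ltW//.
rewrite (_ : k.+1%:R / 2 - 1 = 2^-1 * k%:R + - 2^-1 :> R); last by rewrite -natr1; field.
rewrite powRD; last by rewrite (gt_eqF t0) implybT.
by rewrite powRN powRrM powR_mulrn// powR_ge0.
Qed.

Lemma hgamma_even (n : nat) : hgamma (2 * n) = Num.sqrt pi * al n * n`!%:R.
Proof.
elim: n => [|n IH]; first by rewrite muln0 hgamma0 fact0 !mulr1.
rewrite mulnS add2n hgammaSS IH factS natrM /=.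
have n0 : 0 <= n%:R :> R by [].
rewrite -!natr1 natrM; field.
by apply: lt0r_neq0; lra.
Qed.

Lemma hgamma_odd (n : nat) : hgamma (2 * n).+1 = n`!%:R.
Proof.
elim: n => [|n IH]; first by rewrite muln0 hgamma1.
by rewrite mulnS add2n hgammaSS IH factS natrM -!natr1 natrM; field.
Qed.

(* AM-GM applied to the integrands. *)
Lemma hgamma_logconvex (k : nat) (c : R) : 0 < c ->
  2 * hgamma k.+1 <= c * hgamma k + c^-1 * hgamma k.+2.
Proof.
move=> c0; have ih := integrable_hgamma.
have m0 : measurable (`]0, +oo[ : set R) := measurable_itv _.
have iZ (k' : nat) (a : R) := lebesgue_integrable_scale a m0 (ih k').
rewrite /hgamma -!RintegralZl//.
rewrite -RintegralD; [|exact: m0|exact: iZ|exact: iZ].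
apply: le_Rintegral; first exact: m0.
- exact: iZ.
- exact: (lebesgue_integrableD m0 (iZ k c) (iZ k.+2 c^-1)).
move=> t; rewrite /= in_itv/= andbT => t0.
rewrite /hgamma_fun !exprS.
set s := Num.sqrt t; have s0 : 0 < s by rewrite sqrtr_gt0.
set E := s ^+ k / s * expR (- t).
have E0 : 0 <= E by rewrite mulr_ge0 ?expR_ge0// divr_ge0 ?exprn_ge0 ?ltW.
have -> : 2 * (s * s ^+ k / s * expR (- t)) = 2 * s * E by rewrite /E; ring.
have -> : c * E + c^-1 * (s * (s * s ^+ k) / s * expR (- t)) =
    (c + c^-1 * s ^+ 2) * E by rewrite /E; ring.
apply: ler_wpM2r => //; rewrite -subr_ge0.
have -> : c + c^-1 * s ^+ 2 - 2 * s = c^-1 * (c - s) ^+ 2 by field; rewrite gt_eqF.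
by rewrite mulr_ge0 ?sqr_ge0// invr_ge0 ltW.
Qed.

(** As [hgamma (2 * n).+2] is n + 1/2 times [hgamma (2 * n)], the choice c^2 = n + 1/2 makes the two
    terms on the right of log-convexity equal. *)
Lemma al_lower (n : nat) : 1 <= (n%:R + 2^-1) * (pi * al n ^+ 2) :> R.
Proof.
have n0 : 0 <= n%:R :> R by [].
pose c : R := Num.sqrt (n%:R + 2^-1).
have np : 0 < n%:R + 2^-1 :> R by lra.
have c0 : 0 < c by rewrite sqrtr_gt0.
have c2 : c ^+ 2 = n%:R + 2^-1 by rewrite sqr_sqrtr// ltW.
have := hgamma_logconvex (2 * n) c0.
have -> : hgamma (2 * n).+2 = c ^+ 2 * hgamma (2 * n).
  by rewrite hgammaSS c2 -natr1 natrM; field.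
rewrite hgamma_odd hgamma_even => h.
have f0 : 0 < n`!%:R :> R by rewrite ltr0n fact_gt0.
have h1 : 1 <= c * (Num.sqrt pi * al n).
  rewrite -(ler_pM2r f0) -(ler_pM2l (ltr0n R 2)) mul1r; apply: le_trans h _.
  by rewrite le_eqVlt; apply/orP; left; apply/eqP; field; rewrite gt_eqF.
rewrite -c2 -[X in X * al n ^+ 2](@sqr_sqrtr _ pi) ?pi_ge0// -!exprMn.
by rewrite -[leLHS](expr1n _ 2) ler_sqr ?nnegrE// (le_trans _ h1).
Qed.

(** The same argument one index further, with c^2 equal to the index of [al]: now the even argument
    of [hgamma] stands in the middle. *)
Lemma al_upper (n : nat) : n%:R * (pi * al n ^+ 2) <= 1 :> R.
Proof.
case: n => [|n]; first by rewrite mul0r.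
have n0 : 0 < n.+1%:R :> R by [].
pose c : R := Num.sqrt n.+1%:R.
have c0 : 0 < c by rewrite sqrtr_gt0.
have c2 : c ^+ 2 = n.+1%:R by rewrite sqr_sqrtr.
have := hgamma_logconvex (2 * n).+1 c0.
have -> : hgamma (2 * n).+3 = c ^+ 2 * hgamma (2 * n).+1.
  by rewrite hgammaSS c2 -(natr1 (2 * n).+1) -(natr1 (2 * n)) -(natr1 n) natrM; field.
have -> : (2 * n).+2 = (2 * n.+1)%N by rewrite mulnS add2n.
rewrite hgamma_odd hgamma_even => h.
have f0 : 0 < n`!%:R :> R by rewrite ltr0n fact_gt0.
have h1 : c * (Num.sqrt pi * al n.+1) <= 1.
  rewrite -(ler_pM2r f0) -(ler_pM2l (ltr0n R 2)) mul1r -(ler_pM2l c0).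
  have -> : c * (2 * (c * (Num.sqrt pi * al n.+1) * n`!%:R)) =
     2 * (Num.sqrt pi * al n.+1 * n.+1`!%:R) by rewrite factS natrM -c2; ring.
  apply: le_trans h _.
  by rewrite le_eqVlt; apply/orP; left; apply/eqP; field; rewrite gt_eqF.
rewrite -c2 -[X in X * al n.+1 ^+ 2](@sqr_sqrtr _ pi) ?pi_ge0// -!exprMn.
rewrite expr_le1// !mulr_ge0 ?sqrtr_ge0//; exact/ltW/al_gt0.
Qed.

Lemma Gamma_half (n : nat) : Gamma (n%:R + 1 / 2) = Num.sqrt pi * al n * n`!%:R :> R.
Proof.
rewrite -hgamma_even -Gamma_hgamma; congr Gamma.
by rewrite -(natr1 (2 * n)) natrM; field.
Qed.

Lemma Gamma_nat (n : nat) : Gamma (n%:R + 1) = n`!%:R :> R.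
Proof.
rewrite -hgamma_odd -Gamma_hgamma; congr Gamma.
by rewrite -(natr1 (2 * n).+1) -(natr1 (2 * n)) natrM; field.
Qed.

End half_integer_gamma.

(** * Incomplete beta functions at positive integers *)

Section incomplete_beta.
Context {R : realType}.
Notation mu := (@lebesgue_measure R).

(* The primitive of [t ^+ k * (1 - t) ^+ s] that vanishes at [0], up to the
   factor [(k + s + 1)! / (k! * s!)]. *)
Definition beta_primitive (k s : nat) (t : R) : R :=
  t ^+ k.+1 * \sum_(j < s.+1) 'C(k + j, k)%:R * (1 - t) ^+ j.

Lemma is_derive_1sub (x : R) : is_derive x 1 (fun t : R => 1 - t) (-1).
Proof.
have := is_deriveDf (is_derive_cstf 1 x) (is_deriveNid x 1).
by move=> H; apply: (is_derive_eq H); rewrite add0r.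
Qed.

(** In the step from s to s + 1, the derivative of the new summand combines with the old one into (k
    + s + 2) C(k+s+1, k) x^k (1 - x)^(s+1). *)
Lemma is_derive_beta_primitive (k s : nat) (x : R) :
  is_derive x 1 (beta_primitive k s)
    (s.+1%:R * 'C(k + s.+1, k)%:R * x ^+ k * (1 - x) ^+ s).
Proof.
have Dk := is_deriveXf k (is_derive_id x 1).
elim: s => [|s IH].
  rewrite (_ : beta_primitive k 0 = fun t => t ^+ k.+1).
    by apply: (is_derive_eq Dk); rewrite addn1 binSn expr0; ring.
  by apply/funext => t; rewrite /beta_primitive big_ord1 addn0 binn expr0 !mulr1.
have Ds := is_deriveXf s (is_derive_1sub x).
have := is_deriveDf IH (is_deriveMf (is_derive_cstf 'C(k + s.+1, k)%:R x)
  (is_deriveMf Dk Ds)).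
rewrite [X in is_derive _ _ X _](_ : _ = beta_primitive k s.+1); last first.
  by apply/funext => t; rewrite /beta_primitive [in RHS]big_ord_recr/=; ring.
move=> H; apply: (is_derive_eq H).
have -> : s.+2%:R * 'C(k + s.+2, k)%:R = (k + s.+2)%:R * 'C(k + s.+1, k)%:R :> R.
  rewrite -!natrM addnS; congr (_%:R).
  rewrite -[in LHS]bin_sub; last by rewrite leqW// leq_addr.
  rewrite -[in RHS]bin_sub ?leq_addr//.
  by rewrite -addnS !addKn -mul_bin_diag addnS.
by rewrite natrD -(natr1 s.+1) !exprS; ring.
Qed.

Lemma inc_betaE (k s : nat) (z : R) : 0 < z <= 1 ->
  inc_beta z k.+1%:R (s%:R + 1) =
  beta_primitive k s z / (s.+1%:R * 'C(k + s.+1, k)%:R).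
Proof.
move=> /andP[z0 z1].
pose f (t : R) := t ^+ k * (1 - t) ^+ s.
have cf : continuous f.
  move=> x; apply: cvgM; first exact: exprn_continuous.
  apply: (@continuous_comp _ _ _ (fun t : R => 1 - t) (fun t : R => t ^+ s)).
    by apply: cvgB; [exact: cvg_cst|exact: cvg_id].
  exact: exprn_continuous.
have c0 : s.+1%:R * 'C(k + s.+1, k)%:R != 0 :> R.
  by rewrite mulf_neq0 ?pnatr_eq0// -lt0n bin_gt0 leq_addr.
have E : inc_beta z k.+1%:R (s%:R + 1) = \int[mu]_(t in `]0, z[) f t.
  apply: eq_Rintegral => t; rewrite inE/= in_itv/= => /andP[t0 tz].
  rewrite addrK powR_mulrn ?subr_ge0 ?(le_trans (ltW tz))//.
  by rewrite -natr1 addrK powR_mulrn// ltW.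
have if0 : mu.-integrable `[0, z] (EFin \o f).
  apply: continuous_compact_integrable; first exact: segment_compact.
  exact: continuous_subspaceT.
rewrite E.
have -> : \int[mu]_(t in `]0, z[) f t = \int[mu]_(t in `[0, z]) f t.
  rewrite Rintegral_itv_bndo_bndc; last first.
    by apply: integrableS if0 => //; apply: subset_itv; rewrite bnd_simp.
  rewrite Rintegral_itv_obnd_cbnd//.
  by apply: integrableS if0 => //; apply: subset_itv; rewrite bnd_simp.
pose F (t : R) := (s.+1%:R * 'C(k + s.+1, k)%:R)^-1 * beta_primitive k s t.
have dF (x : R) : is_derive x 1 F (f x); last first.
  rewrite /Rintegral (integral_itvFTC z0 cf dF)/=.
  by rewrite /F /beta_primitive expr0n/= mul0r mulr0 subr0 mulrC.
have := is_deriveMf (is_derive_cstf (s.+1%:R * 'C(k + s.+1, k)%:R)^-1 x)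
  (is_derive_beta_primitive k s x).
move=> H; apply: (is_derive_eq H); rewrite mul0r add0r /f.
by rewrite -(mulrA _ (x ^+ k)) mulKf.
Qed.

(** The negative binomial form of the incomplete beta function: at z = 1 only j = 0 survives, and at
    z = 1/2 the summands are the [W k j], halved. *)
Lemma reg_inc_beta_half (k s : nat) :
  reg_inc_beta (1 / 2) k.+1%:R (s%:R + 1) = 2^-1 * \sum_(j < s.+1) W k j :> R.
Proof.
have c0 : s.+1%:R * 'C(k + s.+1, k)%:R != 0 :> R.
  by rewrite mulf_neq0 ?pnatr_eq0// -lt0n bin_gt0 leq_addr.
have h2 : 0 < (1 / 2 : R) <= 1.
  by rewrite divr_gt0//= ler_pdivrMr// mul1r ler1n.
rewrite /reg_inc_beta !inc_betaE ?ltr01//= /beta_primitive.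
have -> : \sum_(j < s.+1) 'C(k + j, k)%:R * (1 - 1) ^+ j = 1 :> R.
  rewrite big_ord_recl/= addn0 binn expr0 mulr1 big1 ?addr0// => j _.
  by rewrite subrr expr0n mulr0.
rewrite expr1n mulr1.
have -> (A B : R) : B != 0 -> A / B / (1 / B) = A by move=> B0; field.
  rewrite (_ : 1 - 1 / 2 = 2^-1 :> R); last by field.
  rewrite !mulr_sumr; apply: eq_bigr => j _.
  have e0 n : 2 ^+ n != 0 :> R by rewrite expf_neq0.
  rewrite div1r !exprVn /W exprD exprS; field.
  by rewrite !e0.
exact: c0.
Qed.

(** Here al n = Gamma(n + 1/2) / (sqrt(pi) n!), and the denominator k + s + 1 of [psi_abel]
    completes the factorial. *)
Lemma psi_beta (r : nat) : (0 < r)%N ->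
  psi (gkernel r) =
    Gamma (2 * r%:R - 3 / 2) / (pi * Gamma (2 * r%:R - 1))
    + \sum_(s < r.-1)
        Gamma (r%:R + s%:R - 1 / 2) / (pi * Gamma (r%:R + s%:R + 1))
        * reg_inc_beta (1 / 2) r%:R (s%:R + 1) :> R.
Proof.
case: r => // k _; rewrite psi_abel /=.
have p0 : Num.sqrt pi != 0 :> R by rewrite sqrtr_eq0 -ltNge pi_gt0.
have pE : pi = Num.sqrt pi * Num.sqrt pi :> R by rewrite -expr2 sqr_sqrtr ?pi_ge0.
have f0 n : n`!%:R != 0 :> R by rewrite pnatr_eq0 -lt0n fact_gt0.
rewrite mulrDr; congr (_ + _).
  have -> : 2 * k.+1%:R - 3 / 2 = (2 * k)%:R + 1 / 2 :> R.
    by rewrite -(natr1 k) natrM; field.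
  have -> : 2 * k.+1%:R - 1 = (2 * k)%:R + 1 :> R.
    by rewrite -(natr1 k) natrM; ring.
  rewrite Gamma_half Gamma_nat; move: p0 pE (f0 (2 * k)%N).
  move: (Num.sqrt pi) (_`!%:R) => C D C0 -> D0.
  by field; rewrite C0 D0.
rewrite mulr_sumr; apply: eq_bigr => s _.
have -> : k.+1%:R + s%:R - 1 / 2 = (k + s)%:R + 1 / 2 :> R.
  by rewrite -(natr1 k) natrD; field.
have -> : k.+1%:R + s%:R + 1 = (k + s).+1%:R + 1 :> R.
  by rewrite -(natr1 k) -(natr1 (k + s)) natrD; ring.
rewrite Gamma_half Gamma_nat reg_inc_beta_half factS natrM.
move: (2^-1 * _) => I.
have n0 : (k + s).+1%:R != 0 :> R by rewrite pnatr_eq0.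
move: n0 (f0 (k + s)%N) p0 pE.
move: ((k + s).+1%:R) (_`!%:R) (Num.sqrt pi) => A B C A0 B0 C0 ->.
by field; rewrite A0 B0 C0.
Qed.

End incomplete_beta.

(** * Asymptotics *)

Section asymptotics.
Context {R : realType}.

Lemma W_succ (k m : nat) : 2 * m.+1%:R * W k m.+1 = (k + m).+1%:R * W k m :> R.
Proof.
have e0 : 2 ^+ (k + m) != 0 :> R by rewrite expf_neq0.
rewrite /W addnS exprS.
have -> : 2 * m.+1%:R * ('C((k + m).+1, k)%:R / (2 * 2 ^+ (k + m))) =
    (m.+1%:R * 'C((k + m).+1, k)%:R) / 2 ^+ (k + m) :> R by field.
rewrite -natrM (_ : (m.+1 * 'C((k + m).+1, k) = (k + m).+1 * 'C(k + m, k))%N); last first.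
  rewrite -[in LHS]bin_sub; last by rewrite leqW// leq_addr.
  by rewrite -[in RHS]bin_sub ?leq_addr// -addnS !addKn -mul_bin_diag addnS.
by rewrite natrM mulrA.
Qed.

Lemma al_W (k : nat) : al k = W k k :> R.
Proof.
elim: k => [|k IH]; first by rewrite W0 expr0 invr1.
rewrite W_pascal (W_sym k.+1) /= IH.
have k0 : 0 <= k%:R :> R by [].
have := W_succ k k; rewrite -(natr1 k) -(natr1 (k + k)) natrD => h.
have -> : W k k.+1 = ((k%:R + k%:R + 1) * W k k) / (2 * (k%:R + 1)) :> R.
  by rewrite -h; field; apply: lt0r_neq0; lra.
by field; apply/andP; split; apply: lt0r_neq0; lra.
Qed.

Lemma W_ge0 (s t : nat) : 0 <= W s t :> R.
Proof. by rewrite divr_ge0// exprn_ge0. Qed.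

(* The number of tosses still missing when one side has come up [k + 1] times is
   as in Banach's matchbox problem; both moments telescope. *)
Lemma matchbox_mean (k m : nat) :
  \sum_(t < m) W k t * (k%:R + 1 - t%:R) = 2 * m%:R * W k m :> R.
Proof.
elim: m => [|m IH]; first by rewrite big_ord0 mulr0 mul0r.
by rewrite big_ord_recr/= IH W_succ -(natr1 (k + m)) natrD; ring.
Qed.

Lemma matchbox_square (k m : nat) :
  \sum_(t < m) W k t * ((k%:R + 1 - t%:R) ^+ 2 - (k%:R + 1 + t%:R)) =
  (k%:R + 1 - m%:R) * (2 * m%:R * W k m) :> R.
Proof.
elim: m => [|m IH]; first by rewrite big_ord0 mulr0 mul0r mulr0.
rewrite big_ord_recr/= IH W_succ -(natr1 (k + m)) -(natr1 m) natrD; ring.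
Qed.

(** At m = k + 1 the right-hand side of [matchbox_square] vanishes, so the second moment is the mean
    of k + 1 + t with t <= k. *)
Lemma matchbox_square_le (k : nat) :
  \sum_(t < k.+1) W k t * (k%:R + 1 - t%:R) ^+ 2 <= 2 * k.+1%:R :> R.
Proof.
have := matchbox_square k k.+1; rewrite -natr1 subrr mul0r => h.
apply: (@le_trans _ _ (\sum_(t < k.+1) W k t * (2 * (k%:R + 1)))); last first.
  by rewrite -mulr_suml W_total mul1r.
have -> : \sum_(t < k.+1) W k t * (k%:R + 1 - t%:R) ^+ 2 =
    \sum_(t < k.+1) W k t * (k%:R + 1 + t%:R) :> R.
  apply/eqP; rewrite -subr_eq0 -sumrB.
  by under eq_bigr do rewrite -mulrBr; rewrite h.
apply: ler_sum => t _; rewrite ler_wpM2l ?W_ge0//.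
have : (t%:R : R) <= k%:R by rewrite ler_nat -ltnS.
lra.
Qed.

(** Twice the decrement of [al] from n to n + 1, hence the slope in the expansion below. *)
Let be (n : nat) : R := al n / n.+1%:R.

Lemma beS (n : nat) : be n - be n.+1 = 3 / 2 * al n / (n.+1%:R * n.+2%:R).
Proof.
have n0 : 0 <= n%:R :> R by [].
rewrite /be /= -(natr1 n.+1) -(natr1 n); field.
by apply/and3P; split; apply: lt0r_neq0; lra.
Qed.

Lemma al_le (k n : nat) : (k <= n)%N -> al n <= al k :> R.
Proof.
elim: n => [|n IH]; first by rewrite leqn0 => /eqP ->.
rewrite leq_eqVlt => /predU1P[->//|]; rewrite ltnS => /IH; apply: le_trans.
rewrite -subr_le0 alS_sub mulNr oppr_le0 divr_ge0 ?mulr_ge0//.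
exact/ltW/al_gt0.
Qed.

Lemma be_diff (k j n : nat) : (k <= n)%N ->
  0 <= be n - be (n + j) <= j%:R * (3 / 2 * al k / k.+1%:R ^+ 2).
Proof.
move=> kn; elim: j => [|j /andP[IH1 IH2]]; first by rewrite addn0 subrr mul0r lexx.
have -> : be n - be (n + j.+1) = (be n - be (n + j)) + (be (n + j) - be (n + j).+1).
  by rewrite addnS; ring.
rewrite beS; set m := (n + j)%N.
have km : (k <= m)%N by rewrite (leq_trans kn)// leq_addr.
have a0 : 0 < al m :> R := al_gt0 m.
have P : 0 <= 3 / 2 * al m / (m.+1%:R * m.+2%:R) :> R.
  by rewrite divr_ge0// mulr_ge0// ltW.
apply/andP; split; first exact: addr_ge0.
have -> (c : R) : j.+1%:R * c = j%:R * c + c by rewrite -(natr1 j) mulrDl mul1r.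
apply: lerD; first exact: IH2.
apply: ler_pM; rewrite ?invr_ge0 ?mulr_ge0// ?(ltW a0)//.
  by rewrite ler_wpM2l// al_le.
rewrite lef_pV2 ?posrE ?exprn_gt0 ?mulr_gt0// expr2 -!natrM ler_nat.
by rewrite leq_mul// ltnS// leqW.
Qed.

(** A Taylor expansion of the convex sequence [al] at its right end n + j. Each step of the
    induction adds half of a difference of slopes, which [be_diff] bounds, and j^2 + (j + 1) <= (j +
    1)^2. *)
Lemma al_expand (k j n : nat) : (k <= n)%N ->
  0 <= al n - (al (n + j) + j%:R * be (n + j) / 2) <=
  j%:R ^+ 2 * (3 / 4 * al k / k.+1%:R ^+ 2).
Proof.
elim: j n => [|j IH] n kn.
  by rewrite addn0 mul0r mul0r addr0 subrr expr0n/= mul0r lexx.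
have /andP[I1 I2] := IH n.+1 (leqW kn).
have /andP[D1 D2] := @be_diff k j.+1 n kn.
have step : al n = al n.+1 + be n / 2 :> R.
  have /eqP := @alS_sub R n; rewrite subr_eq => /eqP ->.
  by rewrite /be; field; rewrite addrC natr1 pnatr_eq0.
rewrite addSnnS in I1 I2; rewrite step.
have -> : al n.+1 + be n / 2 - (al (n + j.+1) + j.+1%:R * be (n + j.+1) / 2) =
  (al n.+1 - (al (n + j.+1) + j%:R * be (n + j.+1) / 2)) + (be n - be (n + j.+1)) / 2.
  by rewrite -(natr1 j); field.
apply/andP; split; first by rewrite addr_ge0// divr_ge0.
apply: (@le_trans _ _ (j%:R ^+ 2 * (3 / 4 * al k / k.+1%:R ^+ 2) +
   (j.+1%:R * (3 / 2 * al k / k.+1%:R ^+ 2)) / 2)); first by rewrite lerD// ler_pM2r.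
pose c : R := al k / k.+1%:R ^+ 2.
have c0 : 0 <= c by rewrite divr_ge0 ?exprn_ge0// ltW// al_gt0.
have j0 : 0 <= j%:R :> R by [].
rewrite -(natr1 j) -!(mulrA _ (al k)) -/c; nra.
Qed.

(** Expand [al (k + t)] at N = 2k + 1. The mean distance is 2 (k + 1) [al k.+1], and [be N] is
    [al N] / (2 (k + 1)), so the linear term is [al N * al k.+1 / 2]; the second moment bounds
    eps. *)
Lemma psi_expand (k : nat) : exists eps : R,
  0 <= eps <= 3 / 2 * al k / k.+1%:R /\
  Num.sqrt pi * psi (gkernel k.+1) =
    al (2 * k).+1 * (1 + al k.+1 / 2) + eps.
Proof.
pose N := (2 * k).+1.
pose er (t : nat) : R := al (k + t) - (al N + (k.+1 - t)%:R * be N / 2).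
have NE (t : 'I_k.+1) : (k + t + (k.+1 - t))%N = N.
  by rewrite /N; have := ltn_ord t; lia.
have cE (t : 'I_k.+1) : (k.+1 - t)%:R = k%:R + 1 - t%:R :> R.
  by rewrite natrB ?natr1// ltnW.
have erb (t : 'I_k.+1) : 0 <= er t <= (k%:R + 1 - t%:R) ^+ 2 * (3 / 4 * al k / k.+1%:R ^+ 2).
  by rewrite -cE; have := @al_expand k (k.+1 - t) (k + t) (leq_addr _ _); rewrite NE.
exists (\sum_(t < k.+1) W k t * er t); split.
  apply/andP; split.
    by apply: sumr_ge0 => t _; rewrite mulr_ge0 ?W_ge0//; have /andP[] := erb t.
  have k0 : k.+1%:R != 0 :> R by rewrite pnatr_eq0.
  apply: (@le_trans _ _ ((2 * k.+1%:R) * (3 / 4 * al k / k.+1%:R ^+ 2))); last first.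
    by rewrite le_eqVlt; apply/orP; left; apply/eqP; field; rewrite addrC natr1.
  apply: (@le_trans _ _ ((\sum_(t < k.+1) W k t * (k%:R + 1 - t%:R) ^+ 2) *
      (3 / 4 * al k / k.+1%:R ^+ 2))).
    rewrite mulr_suml; apply: ler_sum => t _; rewrite -mulrA ler_wpM2l ?W_ge0//.
    by have /andP[] := erb t.
  apply: ler_wpM2r; last exact: matchbox_square_le.
  by rewrite divr_ge0 ?exprn_ge0// mulr_ge0// ltW// al_gt0.
have p0 : Num.sqrt pi != 0 :> R by rewrite sqrtr_eq0 -ltNge pi_gt0.
rewrite psi_al mulVKf//.
have -> : al N * (1 + al k.+1 / 2) = \sum_(t < k.+1) W k t * (al N + (k.+1 - t)%:R * be N / 2).
  have k0 : k%:R + 1 != 0 :> R by rewrite natr1 pnatr_eq0.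
  have WE : al k.+1 = W k k.+1 :> R by rewrite al_W W_pascal (W_sym k.+1); field.
  have beN : be N = al N / (2 * (k%:R + 1)).
    by congr (_ / _); rewrite /N -(natr1 (2 * k).+1) -(natr1 (2 * k)) natrM; ring.
  rewrite WE beN; move: (al N) => a.
  under eq_bigr do rewrite cE mulrDr mulrA mulrA.
  rewrite big_split/= -!mulr_suml W_total matchbox_mean mul1r -(natr1 k).
  by field.
rewrite -big_split; apply: eq_bigr => t _.
by rewrite -[RHS]mulrDr /er addrC subrK.
Qed.

Lemma le_of_sqr (x y : R) : 0 <= y -> x ^+ 2 <= y ^+ 2 -> x <= y.
Proof.
move=> y0; apply: contraTT; rewrite -!ltNge => yx; nra.
Qed.

(** With c the target, c - A <= (c^2 - A^2) / c, and c^2 - A^2 is at most 3/2 c^2 / (2r - 1/2),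
    where 3/2 = (2r - 1/2) - (2r - 2). The root rho of r keeps all powers integral. *)
Lemma invsqrt_approx (r A rho : R) : 2 <= r -> 0 < rho -> rho ^+ 2 = r -> 0 <= A ->
  1 <= (2 * r - 2^-1) * A ^+ 2 -> (2 * r - 1) * A ^+ 2 <= 1 ->
  `|A - (Num.sqrt (2 * r - 2))^-1| <= (rho ^+ 3)^-1.
Proof.
move=> r2 rho0 rhoE A0 lo hi.
have r0 : 0 < 2 * r - 2 by lra.
set c := (Num.sqrt (2 * r - 2))^-1.
have c0 : 0 < c by rewrite invr_gt0 sqrtr_gt0.
have c2 : c ^+ 2 * (2 * r - 2) = 1.
  by rewrite exprVn sqr_sqrtr ?ltW// mulVf// gt_eqF.
have Ac : A <= c.
  apply: le_of_sqr; first exact: ltW.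
  have r1 : 0 < 2 * r - 1 by lra.
  by rewrite -(ler_pM2l r1); apply: le_trans hi _; nra.
rewrite distrC ger0_norm ?subr_ge0//.
have crho : c * rho <= 1.
  apply: le_of_sqr => //.
  by rewrite exprMn rhoE expr1n -c2 ler_wpM2l ?sqr_ge0//; lra.
have r1 : 0 < r by lra.
apply: (@le_trans _ _ (c / r)); last first.
  rewrite exprS rhoE invfM ler_wpM2r ?invr_ge0 ?(ltW r1)//.
  by rewrite -[leRHS]mul1r ler_pdivlMr.
rewrite ler_pdivlMr// -(ler_pM2l c0).
have key : c * (c - A) <= c ^+ 2 - A ^+ 2 by nra.
have y0 : 0 < 2 * r - 2^-1 by lra.
have key2 : (2 * r - 2^-1) * (c ^+ 2 - A ^+ 2) <= 3 / 2 * c ^+ 2.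
  have : (2 * r - 2^-1) * c ^+ 2 = c ^+ 2 * (2 * r - 2) + 3 / 2 * c ^+ 2 by field.
  by rewrite c2 mulrBr => ->; lra.
have d0 : 0 <= c ^+ 2 - A ^+ 2 by nra.
apply: (@le_trans _ _ ((c ^+ 2 - A ^+ 2) * r)); first by rewrite mulrA ler_wpM2r// ltW.
have : (c ^+ 2 - A ^+ 2) * r * (3 / 2) <= (2 * r - 2^-1) * (c ^+ 2 - A ^+ 2) by nra.
lra.
Qed.

(** With s = sqrt(2), P lies between s / (2r + 1) and 2 s / (4r - 3), twice the target; these differ
    by 5 s / ((4r - 3) (2r + 1)), which is of order r^(-2). *)
Lemma product_approx (r P rho : R) : 2 <= r -> 0 < rho -> rho ^+ 2 = r -> 0 <= P ->
  1 <= (2 * r - 2^-1) * (r + 2^-1) * P ^+ 2 -> (2 * r - 1) * r * P ^+ 2 <= 1 ->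
  `|P / 2 - Num.sqrt 2 / (4 * r - 3)| <= (rho ^+ 3)^-1.
Proof.
move=> r2 rho0 rhoE P0 lo hi.
have s0 : 0 <= Num.sqrt 2 :> R := sqrtr_ge0 _.
have s2 : Num.sqrt 2 ^+ 2 = 2 :> R by rewrite sqr_sqrtr.
set s := Num.sqrt 2 in s0 s2 *.
have sle : s <= 3 / 2 by nra.
have d0 : 0 < 4 * r - 3 by lra.
have e0 : 0 < 2 * r + 1 by lra.
have up : P <= 2 * s / (4 * r - 3).
  apply: le_of_sqr; first by rewrite divr_ge0 ?mulr_ge0// ltW.
  rewrite expr_div_n exprMn s2 ler_pdivlMr ?exprn_gt0//.
  have : (4 * r - 3) ^+ 2 <= 8 * ((2 * r - 1) * r) by nra.
  have := sqr_ge0 P; nra.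
have dn : s / (2 * r + 1) <= P.
  apply: le_of_sqr => //.
  rewrite expr_div_n s2 ler_pdivrMr ?exprn_gt0//.
  have : 2 * ((2 * r - 2^-1) * (r + 2^-1)) <= (2 * r + 1) ^+ 2 by nra.
  have := sqr_ge0 P; nra.
have r1 : 0 < r by lra.
have E : s / (4 * r - 3) = 2 * s / (4 * r - 3) / 2 by field; rewrite gt_eqF.
rewrite E -mulrBl normrM (ger0_norm (_ : 0 <= 2^-1))// distrC ger0_norm ?subr_ge0//.
have rho1 : 1 <= rho by apply: le_of_sqr; [exact: ltW|rewrite rhoE expr1n; lra].
apply: (@le_trans _ _ ((r ^+ 2)^-1)); last first.
  rewrite lef_pV2 ?posrE ?exprn_gt0// -rhoE -exprM.
  exact: ler_weXn2l.
apply: (@le_trans _ _ ((2 * s / (4 * r - 3) - s / (2 * r + 1)) / 2)).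
  by rewrite ler_pM2r ?invr_gt0// lerD2l lerN2.
have -> : 2 * s / (4 * r - 3) - s / (2 * r + 1) = 5 * s / ((4 * r - 3) * (2 * r + 1)).
  by field; rewrite !gt_eqF.
rewrite mulrAC ler_pdivrMr ?mulr_gt0// [leRHS]mulrC ler_pdivlMr ?exprn_gt0//.
nra.
Qed.

(** With p = sqrt(pi), A = p [al (2r - 1)] and B = p [al r], psi is A / p^2 + A B / (2 p^3) + eps /
    p. The three errors contribute 1 + 1 + 3 = 5, as dividing by powers of p >= 1 does not enlarge
    them. *)
Lemma psi_approx (r : nat) : (1 < r)%N ->
  `|psi (gkernel r) - ((pi * Num.sqrt (2 * r%:R - 2))^-1
           + Num.sqrt 2 / (pi `^ (3 / 2) * (4 * r%:R - 3)))| <=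
  5 * (r%:R `^ (- (3 / 2))) :> R.
Proof.
case: r => [|[|k']]// _; set k := k'.+1.
set r : R := k.+1%:R.
have r2 : 2 <= r by rewrite ler_nat.
have r0 : 0 < r by lra.
pose rho := Num.sqrt r; have rho0 : 0 < rho by rewrite sqrtr_gt0.
have rhoE : rho ^+ 2 = r by rewrite sqr_sqrtr// ltW.
have powh (x : R) : 0 <= x -> x `^ (3 / 2) = Num.sqrt x ^+ 3.
  move=> x0; rewrite -powR12_sqrt// -powR_mulrn ?powR_ge0// -powRrM.
  by congr (_ `^ _); field.
rewrite powRN (powh _ (ltW r0)) -/rho.
pose p := Num.sqrt pi : R.
have p0 : 0 < p by rewrite sqrtr_gt0 pi_gt0.
have pE : p ^+ 2 = pi by rewrite sqr_sqrtr// pi_ge0.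
have p1 : 1 <= p.
  apply: le_of_sqr; first exact: ltW.
  rewrite pE expr1n.
  by rewrite (le_trans _ (pi_ge2 R))// ler1n.
rewrite (powh _ (pi_ge0 R)) -/p -pE.
have [eps [/andP[eps0 epsle] psiE]] := psi_expand k.
pose A := p * al (2 * k).+1; pose B := p * al k.+1.
have A0 : 0 < A by rewrite mulr_gt0// al_gt0.
have B0 : 0 < B by rewrite mulr_gt0// al_gt0.
have NE : (2 * k).+1%:R = 2 * r - 1 by rewrite /r -(natr1 (2 * k)) -(natr1 k) natrM; ring.
have Alo : 1 <= (2 * r - 2^-1) * A ^+ 2.
  have := @al_lower R (2 * k).+1; rewrite NE -pE -exprMn.
  by rewrite (_ : 2 * r - 1 + 2^-1 = 2 * r - 2^-1)//; field.
have Ahi : (2 * r - 1) * A ^+ 2 <= 1.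
  by have := @al_upper R (2 * k).+1; rewrite NE -pE -exprMn.
have Blo : 1 <= (r + 2^-1) * B ^+ 2.
  by have := @al_lower R k.+1; rewrite -pE -exprMn.
have Bhi : r * B ^+ 2 <= 1.
  by have := @al_upper R k.+1; rewrite -pE -exprMn.
have h1 := invsqrt_approx r2 rho0 rhoE (ltW A0) Alo Ahi.
have h2 : `|A * B / 2 - Num.sqrt 2 / (4 * r - 3)| <= (rho ^+ 3)^-1.
  apply: (product_approx r2 rho0 rhoE); first by rewrite mulr_ge0 ?ltW.
  - rewrite exprMn mulrACA -[leLHS](mulr1 1); apply: ler_pM => //.
  - rewrite exprMn mulrACA -[leRHS](mulr1 1); apply: ler_pM => //.
      by rewrite mulr_ge0 ?sqr_ge0//; lra.
    by rewrite mulr_ge0 ?sqr_ge0// ltW.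
(* C = p [al k] is at most 1 / sqrt(r - 1), hence at most 2 / rho, and 3/2 times 2 gives the
   constant 3. *)
have h3 : `|eps / p| <= 3 * (rho ^+ 3)^-1.
  rewrite (ger0_norm (divr_ge0 eps0 (ltW p0))).
  have kE : k%:R = r - 1 by rewrite /r -(natr1 k); ring.
  have Chi : (r - 1) * (p * al k) ^+ 2 <= 1.
    by have := @al_upper R k; rewrite kE -pE -exprMn.
  set C := p * al k in Chi.
  have C0 : 0 <= C by rewrite mulr_ge0 ?(ltW p0)// ltW// al_gt0.
  have Crho : C * rho <= 2.
    apply: le_of_sqr => //.
    by rewrite exprMn rhoE; have := sqr_ge0 C; nra.
  have al_le : al k <= C by rewrite ler_peMl// ltW// al_gt0.
  apply: (@le_trans _ _ (3 / 2 * C / r)).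
    apply: (@le_trans _ _ eps); first by rewrite ler_pdivrMr// ler_peMr.
    by apply: le_trans epsle _; rewrite ler_pM2r ?invr_gt0// ler_pM2l ?divr_gt0.
  have -> : 3 * (rho ^+ 3)^-1 = 3 / rho / r.
    by rewrite exprS rhoE; field; rewrite !gt_eqF.
  rewrite ler_pM2r ?invr_gt0// ler_pdivlMr//; lra.
have -> : psi (gkernel k.+1) = A / p ^+ 2 + (A * B / 2) / p ^+ 3 + eps / p :> R.
  apply: (mulfI (lt0r_neq0 p0)); rewrite psiE /A /B; field.
  by rewrite gt_eqF.
have -> : A / p ^+ 2 + (A * B / 2) / p ^+ 3 + eps / p -
    ((p ^+ 2 * Num.sqrt (2 * r - 2))^-1 + Num.sqrt 2 / (p ^+ 3 * (4 * r - 3))) =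
   (A - (Num.sqrt (2 * r - 2))^-1) / p ^+ 2 +
   (A * B / 2 - Num.sqrt 2 / (4 * r - 3)) / p ^+ 3 + eps / p.
  rewrite !invfM; ring.
have dv (x : R) n : `|x / p ^+ n| <= `|x|.
  rewrite normrM normfV (ger0_norm (_ : 0 <= p ^+ n)) ?exprn_ge0 ?(ltW p0)//.
  rewrite ler_pdivrMr ?exprn_gt0// ler_peMr//.
  by rewrite exprn_ege1.
apply: le_trans (ler_normD _ _) _; apply: (@le_trans _ _ ((1 + 1 + 3) * (rho ^+ 3)^-1)).
  have -> : (1 + 1 + 3) * (rho ^+ 3)^-1 =
      (rho ^+ 3)^-1 + (rho ^+ 3)^-1 + 3 * (rho ^+ 3)^-1 by ring.
  apply: lerD; last exact: h3.
  apply: le_trans (ler_normD _ _) _; apply: lerD.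
    exact: le_trans (dv _ _) h1.
  exact: le_trans (dv _ _) h2.
by rewrite ler_wpM2r ?invr_ge0 ?exprn_ge0 ?(ltW rho0)//; lra.
Qed.

Lemma psi_asymptotics : (fun r : nat => psi (gkernel r) : R) =
  (fun r : nat => (pi * Num.sqrt (2 * r%:R - 2))^-1
     + Num.sqrt 2 / (pi `^ (3 / 2) * (4 * r%:R - 3)))
  +O_\oo (fun r : nat => r%:R `^ (- (3 / 2))).
Proof.
apply/eqaddOP; near=> C; near=> r => /=.
rewrite (ger0_norm (powR_ge0 _ _)).
apply: le_trans (psi_approx _) _; last first.
  by rewrite ler_wpM2r ?powR_ge0//; near: C; exact: nbhs_pinfty_ge.
by near: r; exists 2%N.
Unshelve. all: by end_near. Qed.

End asymptotics.

(** * Densities and independence *)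

Section integrable_prod.
Context {d d' : measure_display} {T : measurableType d} {T' : measurableType d'}.
Context {R : realType}.
Variables (m : {sigma_finite_measure set T -> \bar R}).
Variables (m' : {sigma_finite_measure set T' -> \bar R}).

Lemma integrable_prod (f : T -> R) (k : T' -> R) :
  m.-integrable setT (EFin \o f) -> m'.-integrable setT (EFin \o k) ->
  (m \x m')%E.-integrable setT (fun z => (f z.1 * k z.2)%:E).
Proof.
move=> /integrableP[mf ifoo] /integrableP[mk ikoo].
have mfk : measurable_fun setT (fun z : T * T' => (f z.1 * k z.2)%:E).
  apply/measurable_EFinP; apply: measurable_funM.
    exact: (measurableT_comp ((measurable_EFinP _ _).1 mf) measurable_fst).
  exact: (measurableT_comp ((measurable_EFinP _ _).1 mk) measurable_snd).
have mf1 : measurable_fun setT (fun x => `|f x|%:E).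
  by apply/measurable_EFinP; apply: measurableT_comp => //; exact/measurable_EFinP.
have mk1 : measurable_fun setT (fun x => `|k x|%:E).
  by apply/measurable_EFinP; apply: measurableT_comp => //; exact/measurable_EFinP.
apply: (iffRL (integrable12ltyP _ _ mfk)) => /=.
under eq_integral => x _.
  under eq_integral => y _ do rewrite normrM EFinM.
  rewrite ge0_integralZl//.
  over.
rewrite ge0_integralZr//; last exact: integral_ge0.
apply: lte_mul_pinfty => //; first exact: integral_ge0.
by rewrite ge0_fin_numE//; exact: integral_ge0.
Qed.

End integrable_prod.

(** * Fubini's theorem for convolutions of Gaussian-dominated functions *)

Section gaussian_fubini.
Context {R : realType}.
Notation mu := (@lebesgue_measure R).
Implicit Types (f k : R -> R).

Lemma gdom_prod_integrable f k : gdom f -> gdom k ->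
  (mu \x mu)%E.-integrable setT (fun z => (f z.1 * k z.2)%:E).
Proof. by move=> gf gk; apply: integrable_prod; exact: gdom_integrable. Qed.

Lemma gdom_conv_integrable f k (h : R) : 0 < h -> gdom f -> gdom k ->
  (mu \x mu)%E.-integrable setT
    (fun z : R * R => (f z.2 * k ((z.1 - z.2) / h))%:E).
Proof.
move=> h0 gf gk.
have h0N : h != 0 by rewrite gt_eqF.
have mf := gdom_measurable gf; have mk := gdom_measurable gk.
have [_ [C [a [a0 fC]]]] := gf; have [_ [D [b [b0 kD]]]] := gk.
(* As x^2 <= 2 (x - y)^2 + 2 y^2, e (x^2 + y^2) is at most 3 e y^2 + 2 e (x - y)^2, and the two
   terms are below a y^2 and b (x - y)^2 / h^2. *)
pose e := Num.min (a / 3) (b / h ^+ 2 / 2).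
have bh0 : 0 < b / h ^+ 2 by rewrite divr_gt0// exprn_gt0.
have e0 : 0 < e by rewrite /e lt_min; apply/andP; split; apply: divr_gt0.
have := gdom_prod_integrable (gdom_gauss 1 e0) (gdom_gauss (`|C| * `|D|) e0).
apply: le_integrable => //.
  apply/measurable_EFinP; apply: measurable_funM.
    exact: (measurableT_comp mf measurable_snd).
  apply: (measurableT_comp mk); apply: measurable_funM => //.
  exact: measurable_funB.
move=> [x y] _ /=; rewrite lee_fin normrM.
apply: (@le_trans _ _ ((`|C| * expR (- (a * y ^+ 2))) *
    (`|D| * expR (- (b * ((x - y) / h) ^+ 2))))).
  apply: ler_pM => //.
    by apply: le_trans (fC _) _; rewrite ler_wpM2r ?expR_ge0// ler_norm.
  by apply: le_trans (kD _) _; rewrite ler_wpM2r ?expR_ge0// ler_norm.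
apply: le_trans (ler_norm _); rewrite mul1r mulrACA (mulrCA (expR _)).
rewrite ler_wpM2l ?mulr_ge0// -!expRD ler_expR.
have ea : e <= a / 3 by rewrite ge_min lexx.
have eb : e <= b / h ^+ 2 / 2 by rewrite ge_min lexx orbT.
have -> : b * ((x - y) / h) ^+ 2 = b / h ^+ 2 * (x - y) ^+ 2.
  by rewrite expr_div_n; ring.
have h1 : e * y ^+ 2 <= a / 3 * y ^+ 2 by rewrite ler_wpM2r ?sqr_ge0.
have h2 : e * (x - y) ^+ 2 <= b / h ^+ 2 / 2 * (x - y) ^+ 2.
  by rewrite ler_wpM2r ?sqr_ge0.
have h3 : 0 <= e * (x - 2 * y) ^+ 2 by rewrite mulr_ge0 ?sqr_ge0// ltW.
move: h1 h2 h3; move: (b / h ^+ 2) => B; nra.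
Qed.

(** Translation invariance enters as the hypothesis that the integral of k does not depend on y; for
    the kernel it comes from the convolution formula. *)
Lemma gdom_fubini f k (h I : R) : 0 < h -> gdom f -> gdom k ->
  (forall y, \int[mu]_x k ((x - y) / h) = I) ->
  (\int[mu]_x (\int[mu]_y (f y * k ((x - y) / h)))%:E)%E =
  (\int[mu]_y (f y * I))%:E /\
  mu.-integrable setT (fun x => (\int[mu]_y (f y * k ((x - y) / h)))%:E).
Proof.
move=> h0 gf gk kI; have h0N : h != 0 by rewrite gt_eqF.
have ifk := gdom_conv_integrable h0 gf gk.
have gk' y : gdom (fun x => k ((x - y) / h)) by exact: gdom_affine.
have gkm x : gdom (fun y => f y * k ((x - y) / h)).
  apply: gdomMb => //; have := cbounded_affine x (- h) (gdom_cbounded gk).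
  congr cbounded; apply/funext => y; congr k.
  by rewrite invrN mulrN -mulNr opprB.
have FE x : (\int[mu]_y (f y * k ((x - y) / h))%:E)%E =
    (\int[mu]_y (f y * k ((x - y) / h)))%:E.
  by rewrite lebesgue_EFin_Rintegral//; exact: gdom_integrable.
split; last first.
  have := integrable_fubini_F ifk; congr (_.-integrable _ _).
  by apply/funext => x; exact: FE.
under eq_integral do rewrite -FE.
have := Fubini ifk => /= ->.
rewrite -lebesgue_EFin_Rintegral//; last first.
  by apply: gdom_integrable; apply: gdomMb => //; exact: cbounded_cst.
apply: eq_integral => y _; rewrite lebesgue_EFin_Rintegral//; last first.
  by apply: gdom_integrable; exact: gdomZ.
by rewrite RintegralZl ?kI//; exact: gdom_integrable.
Qed.

End gaussian_fubini.

Section density.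
Context {d : measure_display} {T : measurableType d} {R : realType}.
Variable P : probability T R.
Notation mu := (@lebesgue_measure R).

(** The set identity makes nu absolutely continuous, and its Radon-Nikodym derivative agrees with f
    almost everywhere because both have the same integral on every measurable set. *)
Lemma integral_density (nu : {finite_measure set T -> \bar R})
    (mu : {sigma_finite_measure set T -> \bar R}) (f : T -> \bar R) (u : T -> \bar R) :
  measurable_fun setT f ->
  (forall A, measurable A -> nu A = (\int[mu]_(x in A) f x)%E) ->
  nu.-integrable setT u -> (\int[nu]_x u x = \int[mu]_x (u x * f x))%E.
Proof.
move=> mf nuf iu; have mu' := measurable_int nu iu.
have XM : nu `<< mu.
  apply/null_content_dominatesP => A mA A0; rewrite nuf//.
  by apply: null_set_integral => //; exact: measurable_funTS.
rewrite -(Radon_Nikodym_change_of_variables XM measurableT iu).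
set g := Radon_Nikodym _ _.
have ig : mu.-integrable setT g by exact: Radon_Nikodym_integrable.
have fg : ae_eq mu setT g f.
  apply: integral_ae_eq => //.
  by move=> A _ mA; rewrite -Radon_Nikodym_integral// -nuf.
apply: ae_eq_integral => //.
- by apply: emeasurable_funM => //; exact: (measurable_int mu).
- exact: emeasurable_funM.
- by move: fg; apply: filterS => x /= /[apply] ->.
Qed.

Lemma bounded_integrable (Z : T -> R) (M : R) : measurable_fun setT Z ->
  (forall t, `|Z t| <= M) -> P.-integrable setT (EFin \o Z).
Proof.
move=> mZ ZM; have Pfin : (P setT < +oo)%E by rewrite probability_setT ltry.
apply: measurable_bounded_integrable => //.
exists M; split; first exact: num_real.
by move=> x Mx t _; exact: le_trans (ZM t) (ltW Mx).
Qed.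

End density.

Section bounded_random_variable.
Context {d : measure_display} {T : measurableType d} {R : realType}.
Variable P : probability T R.
Notation mu := (@lebesgue_measure R).

Lemma cbounded_integrable (X : {RV P >-> R}) (u : R -> R) : cbounded u ->
  P.-integrable setT (EFin \o (u \o X)).
Proof.
move=> bu; have [_ [M uM]] := bu.
have muX : measurable_fun setT (u \o X).
  by apply: measurableT_comp => //; exact: cbounded_measurable.
by apply: (bounded_integrable P muX (M := M)) => t; exact: uM.
Qed.

End bounded_random_variable.

Section density_real.
Context {d : measure_display} {T : measurableType d} {R : realType}.
Variable P : probability T R.
Notation mu := (@lebesgue_measure R).

(* [R] carries two measurable structures with the same measurable sets but
   different displays; Lebesgue measure lives on [measurableTypeR R]. *)
Lemma RV_measurableTypeR (X : {RV P >-> R}) :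
  exists X' : {RV P >-> measurableTypeR R}, X' = X :> (T -> R).
Proof.
have mX : measurable_fun setT (X : T -> measurableTypeR R).
  by have := @measurable_funPT _ _ _ _ X.
pose X' : {RV P >-> measurableTypeR R} :=
  HB.pack (X : T -> measurableTypeR R) (isMeasurableFun.Build _ _ _ _ _ mX).
by exists X'.
Qed.

Lemma Rintegral_density (X : {RV P >-> R}) (f u : R -> R) :
  has_density X f -> gdom f -> cbounded u ->
  \int[P]_t u (X t) = \int[mu]_y (f y * u y).
Proof.
move=> Xf gf bu; have [_ [M uM]] := bu.
have mf : measurable_fun setT (EFin \o f).
  by apply/measurable_EFinP; exact: gdom_measurable.
have mu' : measurable_fun [set: measurableTypeR R] u := cbounded_measurable bu.
have intX := cbounded_integrable X bu.
have [X' X'E] := RV_measurableTypeR X.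
have iu : (distribution P X').-integrable setT (EFin \o u).
  exact: (bounded_integrable (distribution P X') mu' uM).
have {}Xf A : measurable A -> distribution P X' A = (\int[mu]_(x in A) (f x)%:E)%E.
  by move=> mA; rewrite -(Xf A mA) /distribution /pushforward X'E.
rewrite /Rintegral; congr fine.
transitivity (\int[distribution P X']_y (u y)%:E)%E.
  have muE : measurable_fun [set: measurableTypeR R] (EFin \o u).
    exact/measurable_EFinP.
  have iuX' : P.-integrable setT ((EFin \o u) \o X') by rewrite X'E.
  have E := integral_distribution muE iuX'.
  by apply: esym; apply: etrans E _; rewrite X'E.
rewrite (integral_density (mu := mu) mf Xf iu)//.
by apply: eq_integral => x _; rewrite -EFinM mulrC.
Qed.

End density_real.

Section independence.
Context {d : measure_display} {T : measurableType d} {R : realType}.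
Variable P : probability T R.

(** The joint law agrees with the product of the marginals on rectangles, hence everywhere; Fubini's
    theorem then splits the integral. *)
Lemma Rintegral_indepM (X Y : {RV P >-> R}) (u v : R -> R) :
  (forall A B, measurable A -> measurable B ->
    P (X @^-1` A `&` Y @^-1` B) = (P (X @^-1` A) * P (Y @^-1` B))%E) ->
  cbounded u -> cbounded v ->
  \int[P]_t (u (X t) * v (Y t)) = (\int[P]_t u (X t)) * (\int[P]_t v (Y t)).
Proof.
move=> XY bu bv; have [_ [M uM]] := bu; have [_ [N vN]] := bv.
have mu' : measurable_fun [set: R] u := cbounded_measurable bu.
have mv : measurable_fun [set: R] v := cbounded_measurable bv.
have iuX := cbounded_integrable X bu; have ivY := cbounded_integrable Y bv.
have mXY : measurable_fun setT (fun t => (X t, Y t)).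
  exact: measurable_fun_pair.
pose Z : {mfun T >-> (R * R)%type} :=
  HB.pack (fun t => (X t, Y t)) (isMeasurableFun.Build _ _ _ _ _ mXY).
pose w (z : R * R) := (u z.1 * v z.2)%:E.
have iu : (distribution P X).-integrable setT (EFin \o u).
  exact: (bounded_integrable (distribution P X) mu' uM).
have iv : (distribution P Y).-integrable setT (EFin \o v).
  exact: (bounded_integrable (distribution P Y) mv vN).
have iw := integrable_prod iu iv.
have ZE : forall C, measurable C ->
    (distribution P X \x distribution P Y)%E C = distribution P Z C.
  apply: product_measure_unique => A B mA mB.
  by rewrite -[RHS]XY.
have mw : measurable_fun setT w := measurable_int _ iw.
have iwZ : P.-integrable setT (w \o Z).
  apply: (bounded_integrable P (Z := fun t => u (X t) * v (Y t)) (M := M * N)).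
    by apply: measurable_funM; exact: measurableT_comp.
  by move=> t; rewrite normrM ler_pM.
have -> : \int[P]_t (u (X t) * v (Y t)) = fine (\int[distribution P Z]_z w z).
  by rewrite /Rintegral integral_distribution.
rewrite -(@eq_measure_integral _ _ _ _ (distribution P Z)
  (distribution P X \x distribution P Y)%E); last first.
  by move=> C mC _; exact: ZE.
have fX : \int[distribution P X]_x u x = \int[P]_t u (X t).
  by rewrite /Rintegral; congr fine; apply: integral_distribution => //; exact/measurable_EFinP.
have fY : \int[distribution P Y]_x v x = \int[P]_t v (Y t).
  by rewrite /Rintegral; congr fine; apply: integral_distribution => //; exact/measurable_EFinP.
rewrite -integral12_prod_meas1// -fX -fY.
under eq_integral => x _.
  rewrite /fubini_F /w /=.
  under eq_integral => y _ do rewrite EFinM.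
  rewrite integralZl// -[X in (_ * X)%E]fineK ?integrable_fin_num//.
  over.
rewrite integralZr//.
by rewrite -[X in (X * _)%E]fineK ?integrable_fin_num.
Qed.

End independence.

(** * The estimator *)

Section sample_mean.
Context {d : measure_display} {T : measurableType d} {R : realType}.
Variable P : probability T R.
Variables (n : nat) (X : 'I_n -> {RV P >-> R}) (u : R -> R) (M S : R).
Hypotheses (n_gt0 : (0 < n)%N) (X_indep : mutually_independent X).
Hypotheses (bu : cbounded u).
Hypotheses (uM : forall i, \int[P]_t u (X i t) = M).
Hypotheses (uS : forall i, \int[P]_t (u (X i t) ^+ 2) = S).

Lemma Rintegral_probability_cst (k : R) : \int[P]_t k = k.
Proof.
transitivity (k * fine (P setT)); first exact: Rintegral_cst.
by rewrite probability_setT/= mulr1.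
Qed.

Lemma pairwise_independent (i j : 'I_n) (A B : set R) : i != j ->
  measurable A -> measurable B ->
  P (X i @^-1` A `&` X j @^-1` B) = (P (X i @^-1` A) * P (X j @^-1` B))%E.
Proof.
move=> ij mA mB; pose C k := if k == i then A else B.
have Ci : C i = A by rewrite /C eqxx.
have Cj : C j = B by rewrite /C eq_sym (negbTE ij).
have := @X_indep [set i; j]%SET C.
rewrite big_setU1 ?inE//= big_set1 Ci Cj => <-.
  congr (P _); apply/seteqP; split=> t /=.
    by move=> [At Bt] k /=; rewrite !inE => /orP[]/eqP ->; rewrite ?Ci ?Cj.
  move=> h; have := h i; have := h j.
  by rewrite /= !inE !eqxx orbT Ci Cj => /(_ isT) ? /(_ isT).
by move=> k _; rewrite /C; case: ifP.
Qed.

Let Y t := n%:R^-1 * \sum_(i < n) u (X i t).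

Let n0 : n%:R != 0 :> R. Proof. by rewrite pnatr_eq0 -lt0n. Qed.

Lemma expectation_mean : ('E_P[Y] = M%:E)%E.
Proof.
have iu i := cbounded_integrable (X i) bu.
have iS : P.-integrable setT (EFin \o (fun t => \sum_(i < n) u (X i t))).
  exact: integrable_sumR.
rewrite unlock EFin_Rintegral//; last exact: integrable_scale.
rewrite RintegralZl// Rintegral_sum//.
under eq_bigr do rewrite uM.
by rewrite sumr_const card_ord -[M *+ n]mulr_natl mulKf.
Qed.

(** After centring, the square of the sum becomes a double sum whose off-diagonal terms vanish by
    pairwise independence. *)
Lemma variance_mean : ('V_P[Y] = ((S - M ^+ 2) / n%:R)%:E)%E.
Proof.
pose v x := u x - M.
have bv : cbounded v by apply: cboundedD => //; exact: cbounded_cst.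
have iu i := cbounded_integrable (X i) bu.
have [_ [K vK]] := bv.
have mv i : measurable_fun setT (v \o X i).
  by apply: measurableT_comp => //; exact: cbounded_measurable.
have iv i j : P.-integrable setT (EFin \o (fun t => v (X i t) * v (X j t))).
  apply: (bounded_integrable P (M := K * K)).
    exact: (measurable_funM (mv i) (mv j)).
  by move=> t; rewrite normrM ler_pM.
have i1 : P.-integrable setT (EFin \o (fun _ : T => M ^+ 2)).
  by apply: (bounded_integrable P (M := `|M ^+ 2|)).
have v0 i : \int[P]_t v (X i t) = 0.
  rewrite RintegralB//; last 2 first.
  - exact: iu.
  - by apply: (bounded_integrable P (M := `|M|)).
  by rewrite uM Rintegral_probability_cst subrr.
have vv i j : \int[P]_t (v (X i t) * v (X j t)) = (i == j)%:R * (S - M ^+ 2).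
  case: eqVneq => [<-|ij]; last first.
    rewrite Rintegral_indepM//; first by rewrite v0 !mul0r.
    by move=> A B mA mB; exact: pairwise_independent.
  have iu2 : P.-integrable setT (EFin \o (fun t => u (X i t) ^+ 2)).
    by have := cbounded_integrable (X i) (cboundedM bu bu).
  transitivity (\int[P]_t ((u (X i t) ^+ 2 - M ^+ 2) - 2 * M * v (X i t))).
    by apply: eq_Rintegral => t _; rewrite /v; ring.
  have ivi : P.-integrable setT (EFin \o (fun t => v (X i t))).
    exact: (cbounded_integrable (X i) bv).
  rewrite RintegralB//; last exact: integrable_scale.
    rewrite RintegralZl// v0 mulr0 subr0 RintegralB//.
    by rewrite uS Rintegral_probability_cst mul1r.
  have := integrableB measurableT iu2 i1.
  by apply: eq_integrable => // t _; rewrite /= EFinB.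
rewrite /variance unlock expectation_mean /= unlock.
transitivity (\int[P]_t (n%:R^-1 ^+ 2 * \sum_(i < n) \sum_(j < n) v (X i t) * v (X j t))%:E)%E.
  apply: eq_integral => t _; congr EFin.
  transitivity ((Y t - M) * (Y t - M)); first by [].
  have -> : Y t - M = n%:R^-1 * \sum_(i < n) v (X i t).
    by rewrite /Y /v sumrB sumr_const card_ord mulrBr -[M *+ n]mulr_natl mulKf.
  rewrite mulrACA -expr2; congr (_ * _); rewrite mulr_suml.
  by apply: eq_bigr => i _; rewrite mulr_sumr.
have isum : P.-integrable setT (EFin \o
    (fun t => \sum_(i < n) \sum_(j < n) v (X i t) * v (X j t))).
  by apply: integrable_sumR => // i; exact: integrable_sumR.
rewrite EFin_Rintegral//; last exact: integrable_scale.
rewrite RintegralZl// Rintegral_sum//; last by move=> i; exact: integrable_sumR.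
congr EFin.
under eq_bigr => i _.
  rewrite Rintegral_sum// (bigD1 i)//= vv eqxx mul1r.
  rewrite big1 ?addr0; last by move=> j ji; rewrite vv eq_sym (negbTE ji) mul0r.
  over.
rewrite sumr_const card_ord -[_ *+ n]mulr_natl; field.
by rewrite n0.
Qed.

End sample_mean.

(** * Integrals of products of smoothed mixtures *)

Section mixture_integrals.
Context {R : realType} {m : nat}.
Variables (w a sigma : 'I_m -> R) (h : R).
Hypotheses (sigma_gt0 : forall j, 0 < sigma j) (w_sum1 : \sum_(j < m) w j = 1).
Hypothesis h_gt0 : 0 < h.
Notation mu := (@lebesgue_measure R).
Notation f := (mixture_pdf w a sigma).

(** The standard deviation of a component after adding q independent normal errors of standard
    deviation h: q = 0 for F, q = 1 for the mean of the estimator. *)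
Definition inflated (q : nat) (j : 'I_m) : R :=
  Num.sqrt (sigma j ^+ 2 + q%:R * h ^+ 2).

(** One family containing both F (r = 1, q = 0) and the mean of the estimator (q = 1), so one
    formula covers all products in bias and variance. *)
Definition smoothed_mixture (r q : nat) (x : R) : R :=
  \sum_(j < m) w j * smoothed r h (inflated q j) (a j) x.

Lemma inflated_gt0 q j : 0 < inflated q j.
Proof. by rewrite sqrtr_gt0 ltr_wpDr ?exprn_gt0// mulr_ge0// sqr_ge0. Qed.

Lemma sqr_inflated q j : inflated q j ^+ 2 = sigma j ^+ 2 + q%:R * h ^+ 2.
Proof. by rewrite sqr_sqrtr// addr_ge0 ?sqr_ge0// mulr_ge0// sqr_ge0. Qed.

Lemma inflated0 j : inflated 0 j = sigma j.
Proof. by rewrite /inflated mul0r addr0 sqrtr_sqr ger0_norm// ltW. Qed.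

Lemma mixture_pdfE x : f x = \sum_(j < m) w j * ((sigma j)^-1 * DD 1 ((x - a j) / sigma j)).
Proof. by apply: eq_bigr => j _; rewrite DD1 mulrA. Qed.

Lemma gdom_mixture : gdom f.
Proof.
rewrite (_ : f = fun x => \sum_(j < m) w j * ((sigma j)^-1 * DD 1 ((x - a j) / sigma j))).
  apply: gdom_sum => j _; apply: gdomZ; apply: gdomZ.
  by apply: (gdom_affine (a j) _ (gdom_DD 0)); rewrite gt_eqF.
by apply/funext => x; rewrite mixture_pdfE.
Qed.

Lemma cdf_smoothed x : antideriv f x = smoothed_mixture 1 0 x.
Proof.
have -> : f = fun x => \sum_(j < m) w j * ((sigma j)^-1 * DD 1 ((x - a j) / sigma j)).
  by apply/funext => y; rewrite mixture_pdfE.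
have g j : gdom (fun x => (sigma j)^-1 * DD 1 ((x - a j) / sigma j)).
  by apply: gdomZ; apply: (gdom_affine (a j) _ (gdom_DD 0)); rewrite gt_eqF.
rewrite antideriv_sum//; apply: eq_bigr => j _; congr (_ * _).
rewrite /smoothed big_ord1 cs0 muln0 expr0 !mul1r inflated0.
exact: antideriv_DD1_affine.
Qed.

Lemma expectation_Gkernel r x :
  \int[mu]_y (f y * Gkernel r ((x - y) / h)) = smoothed_mixture r 1 x.
Proof.
under eq_Rintegral => y _.
  rewrite mixture_pdfE GkernelE mulr_suml.
  under eq_bigr => j _ do rewrite mulr_sumr.
  over.
have g j s := gdom_DDDD 1 (2 * s) (a j) x (sigma_gt0 j) h_gt0.
have E j s y : w j * ((sigma j)^-1 * DD 1 ((y - a j) / sigma j)) *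
    (cs s * DD (2 * s) ((x - y) / h)) = w j * (sigma j)^-1 * cs s *
    (DD 1 ((y - a j) / sigma j) * DD (2 * s) ((x - y) / h)) by ring.
have gg j s : gdom (fun y => w j * ((sigma j)^-1 * DD 1 ((y - a j) / sigma j)) *
    (cs s * DD (2 * s) ((x - y) / h))).
  by under eq_fun do rewrite E; exact: gdomZ.
rewrite Rintegral_sum//; last first.
  by move=> j; apply: gdom_integrable; exact: gdom_sum.
apply: eq_bigr => j _; rewrite Rintegral_sum//; last first.
  by move=> s; exact: gdom_integrable.
rewrite mulr_sumr; apply: eq_bigr => s _.
under eq_Rintegral do rewrite E.
rewrite RintegralZl//; last exact: gdom_integrable.
rewrite convolution_DD//.
have -> : Num.sqrt (sigma j ^+ 2 + h ^+ 2) = inflated 1 j by rewrite /inflated mul1r.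
have := inflated_gt0 1 j; move: (inflated 1 j) => t t0.
have s0 := sigma_gt0 j.
rewrite add1n -[EE (2 * s).+1]/(DD (2 * s)) expr_div_n expr1 [t ^+ _.+1]exprS.
by field; rewrite expf_neq0 ?gt_eqF.
Qed.

Lemma smoothed_mixtureC r q x : (0 < r)%N ->
  1 - smoothed_mixture r q x = \sum_(j < m) w j * smoothedC r h (inflated q j) (a j) x.
Proof.
move=> r0; rewrite -w_sum1 -sumrB; apply: eq_bigr => j _.
by rewrite smoothedCE// mulrBr mulr1.
Qed.

Section product.
Variables (r q r' q' : nat).
Hypothesis r'_gt0 : (0 < r')%N.

Lemma smoothed_mixtureM x :
  smoothed_mixture r q x * (1 - smoothed_mixture r' q' x) =
  \sum_(i < m) \sum_(j < m) (w i * w j) *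
    (smoothed r h (inflated q i) (a i) x * smoothedC r' h (inflated q' j) (a j) x).
Proof.
rewrite smoothed_mixtureC// mulr_suml; apply: eq_bigr => i _.
by rewrite mulr_sumr; apply: eq_bigr => j _; rewrite mulrACA.
Qed.

Lemma gdom_smoothed_mixture :
  gdom (fun x => smoothed_mixture r q x * (1 - smoothed_mixture r' q' x)).
Proof.
under eq_fun do rewrite smoothed_mixtureM.
apply: gdom_sum => i _; apply: gdom_sum => j _; apply: gdomZ.
by apply: gdom_smoothed; exact: inflated_gt0.
Qed.

(** Variances add under convolution, hence q + q', which takes the values 2, 1 and 0 in the
    theorem. *)
Lemma Rintegral_smoothed_mixture :
  \int[mu]_x (smoothed_mixture r q x * (1 - smoothed_mixture r' q' x)) =
  \sum_(s < r) \sum_(u < r') cs s * cs u * V w a sigma h (s + u) (q + q').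
Proof.
have g i j : gdom (fun x => smoothed r h (inflated q i) (a i) x *
    smoothedC r' h (inflated q' j) (a j) x).
  by apply: gdom_smoothed; exact: inflated_gt0.
under eq_Rintegral do rewrite smoothed_mixtureM.
rewrite Rintegral_sum//; last first.
  by move=> i; apply: gdom_integrable; apply: gdom_sum => j _; exact: gdomZ.
under eq_bigr => i _.
  rewrite Rintegral_sum//; last by move=> j; apply: gdom_integrable; exact: gdomZ.
  under eq_bigr => j _.
    rewrite RintegralZl//; last exact: gdom_integrable.
    rewrite Rintegral_smoothed ?inflated_gt0// !sqr_inflated addrACA -mulrDl -natrD.
    rewrite -/(sigma2 _ _ _ _ _) mulr_sumr.
    under eq_bigr do rewrite mulr_sumr.
    over.
  rewrite exchange_big/=.
  under eq_bigr do rewrite exchange_big/=.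
  over.
rewrite exchange_big/=; apply: eq_bigr => s _.
rewrite exchange_big/=; apply: eq_bigr => u _.
rewrite /V !mulr_sumr; apply: eq_bigr => i _.
rewrite !mulr_sumr; apply: eq_bigr => j _.
have sg0 : 0 < sigma2 sigma h i j (q + q').
    by rewrite sqrtr_gt0 ltr_wpDr ?addr_gt0 ?exprn_gt0// mulr_ge0// sqr_ge0.
move: (sigma2 _ _ _ _ _) sg0 => t t0.
rewrite (_ : 2 * (s + u)%N%:Z - 2 = (2 * (s + u))%N%:Z - 2) ?dphiEE//.
rewrite expfzDr ?gt_eqF// expr1z -[- (2 * _)]/(- (2 * (s + u))%N%:Z) -invr_expz.
rewrite -exprnP mulnDr !exprD/=.
by field; rewrite !expf_neq0 ?gt_eqF.
Qed.

End product.
End mixture_integrals.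

Section kernel_integral.
Context {R : realType}.
Notation mu := (@lebesgue_measure R).

(** With the scale t equal to the bandwidth h all weights (h / t)^(2s) are 1, so the convolution
    formula applies and replaces a change of variables. *)
Lemma Rintegral_GGc_affine (r : nat) (h y : R) : (0 < r)%N -> 0 < h ->
  \int[mu]_x (Gkernel r ((x - y) / h) * (1 - Gkernel r ((x - y) / h))) =
  h * psi (gkernel r).
Proof.
move=> r0 h0; have hN0 : h != 0 by rewrite gt_eqF.
have E x : Gkernel r ((x - y) / h) = smoothed r h h y x.
  by rewrite GkernelE; apply: eq_bigr => s _; rewrite divff// expr1n mulr1.
under eq_Rintegral do rewrite E -smoothedCE//.
rewrite Rintegral_smoothed// psi_EE// mulr_sumr; apply: eq_bigr => s _.
rewrite mulr_sumr; apply: eq_bigr => u _.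
have -> : Num.sqrt (h ^+ 2 + h ^+ 2) = h * Num.sqrt 2.
  rewrite (_ : h ^+ 2 + h ^+ 2 = h ^+ 2 * 2); last by ring.
  by rewrite sqrtrM ?sqr_ge0// sqrtr_sqr gtr0_norm.
rewrite subrr mul0r exprMn [Num.sqrt 2 ^+ _]exprM sqr_sqrtr// mulnDr !exprD.
by field; rewrite !expf_neq0.
Qed.

End kernel_integral.

Lemma sum_csM {R : realType} (r : nat) (c : nat -> R) :
  \sum_(s < r) \sum_(t < r) cs s * cs t * c (s + t)%N =
  \sum_(s < r) \sum_(t < r)
    (-1) ^+ (s + t) / (2 ^+ (s + t) * s`!%:R * t`!%:R) * c (s + t)%N.
Proof.
apply: eq_bigr => s _; apply: eq_bigr => t _; congr (_ * _).
by rewrite /cs !exprD !invfM; ring.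
Qed.

Section estimator.
Context {d : measure_display} {T : measurableType d} {R : realType}.
Variable P : probability T R.
Variables (m : nat) (w a sigma : 'I_m -> R) (n : nat) (X : 'I_n -> {RV P >-> R}).
Hypotheses (n_gt0 : (0 < n)%N) (sigma_gt0 : forall j, 0 < sigma j).
Hypotheses (w_sum1 : \sum_(j < m) w j = 1) (X_indep : mutually_independent X).
Notation f := (mixture_pdf w a sigma).
Hypothesis X_density : forall i, has_density (X i) f.
Variables (h : R) (r : nat).
Hypotheses (h_gt0 : 0 < h) (r_gt0 : (0 < r)%N).
Notation mu := (@lebesgue_measure R).
Notation G := (@Gkernel R r).
Notation M := (smoothed_mixture w a sigma h r 1).
Notation F := (smoothed_mixture w a sigma h 1 0).

Let gf : gdom f. Proof. exact: gdom_mixture. Qed.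

Lemma cbounded_reflect k x : cbounded k -> cbounded (fun y : R => k ((x - y) / h)).
Proof.
move=> bk; have := cbounded_affine x (- h) bk.
by congr cbounded; apply/funext => y; rewrite invrN mulrN -mulNr opprB.
Qed.

Let bG x := cbounded_reflect x (cbounded_Gkernel r).

Lemma expectation_Fhat x : ('E_P[Fhat X r h x] = (M x)%:E)%E.
Proof.
apply: (expectation_mean (u := fun y => G ((x - y) / h))) => // i.
by rewrite (Rintegral_density (X_density i) gf (bG x)) expectation_Gkernel.
Qed.

Definition self_overlap (x : R) : R :=
  \int[mu]_y (f y * (G ((x - y) / h) * (1 - G ((x - y) / h)))).

(** Since G^2 = G - G (1 - G), the second moment of one summand is M - [self_overlap]. *)
Lemma variance_Fhat x :
  ('V_P[Fhat X r h x] = ((M x * (1 - M x) - self_overlap x) / n%:R)%:E)%E.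
Proof.
rewrite (variance_mean (u := fun y => G ((x - y) / h)) (M := M x)
  (S := M x - self_overlap x)) //; last 2 first.
- move=> i.
  by rewrite (Rintegral_density (X_density i) gf (bG x)) expectation_Gkernel.
- move=> i.
  have bG2 : cbounded (fun y => G ((x - y) / h) ^+ 2) by exact: cboundedM (bG x) (bG x).
  have bGG : cbounded (fun y => G ((x - y) / h) * (1 - G ((x - y) / h))).
    exact: cbounded_reflect (gdom_cbounded (gdom_GGc r_gt0)).
  rewrite (Rintegral_density (X_density i) gf bG2) -expectation_Gkernel//.
  rewrite -RintegralB//; last 2 first.
  + by apply: gdom_integrable; exact: gdomMb.
  + by apply: gdom_integrable; exact: gdomMb.
  by apply: eq_Rintegral => y _; ring.
by congr (_%:E); congr (_ / _); ring.
Qed.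

Lemma self_overlap_integral : mu.-integrable setT (EFin \o self_overlap) /\
  (\int[mu]_x (self_overlap x)%:E = (h * psi (gkernel r))%:E)%E.
Proof.
have gG := @gdom_GGc R _ r_gt0.
have [-> i] := gdom_fubini h_gt0 gf gG (fun y => Rintegral_GGc_affine y r_gt0 h_gt0).
split=> //; have bc := cbounded_cst (h * psi (gkernel r)).
(* That f has total mass 1 is read off from the law of one observation, which exists as n > 0,
   applied to a constant function. *)
rewrite -(Rintegral_density (X_density (Ordinal n_gt0)) gf bc).
by rewrite Rintegral_probability_cst.
Qed.

Lemma ISB_Fhat : ISB P (Fhat X r h) (antideriv f) =
  (- (\sum_(s < r) \sum_(t < r)
      (-1) ^+ (s + t) / (2 ^+ (s + t) * s`!%:R * t`!%:R) * V w a sigma h (s + t) 2)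
   + 2 * (\sum_(s < r) (-1) ^+ s / (2 ^+ s * s`!%:R) * V w a sigma h s 1)
   - V w a sigma h 0 0)%:E.
Proof.
have gMF r1 q1 r2 q2 := @gdom_smoothed_mixture _ _ w a _ h sigma_gt0 w_sum1 r1 q1 r2 q2.
have gMM := gMF r 1%N r 1%N r_gt0; have gFF := gMF 1%N 0%N 1%N 0%N isT.
have gMF' := gMF r 1%N 1%N 0%N isT; have gFM := gMF 1%N 0%N r 1%N r_gt0.
have g1 := gdomD (gdomD (gdomZ (-1) gMM) (gdomZ (-1) gFF)) (gdomD gMF' gFM).
rewrite /ISB.
transitivity (\int[mu]_x ((-1 * (M x * (1 - M x)) + -1 * (F x * (1 - F x))) +
    (M x * (1 - F x) + F x * (1 - M x)))%:E)%E.
  apply: eq_integral => x _; rewrite expectation_Fhat (cdf_smoothed _ _ h)//.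
  by rewrite -EFinB -EFin_expe; congr EFin; ring.
rewrite lebesgue_EFin_Rintegral//; last exact: gdom_integrable.
congr EFin; have gi := @gdom_integrable R.
rewrite RintegralD//; last 2 first.
- by apply: gi; apply: gdomD; exact: gdomZ.
- by apply: gi; exact: gdomD.
rewrite RintegralD//; last 2 first.
- by apply: gi; exact: gdomZ.
- by apply: gi; exact: gdomZ.
rewrite RintegralD//; last 2 first.
- exact: gi.
- exact: gi.
rewrite !RintegralZl//; last 2 first.
- exact: gi.
- exact: gi.
rewrite !Rintegral_smoothed_mixture// !big_ord1.
rewrite cs0 !mul1r addn0.
(* F has the single coefficient [cs 0 = 1], so both mixed double sums collapse to the same simple
   sum; hence the factor 2. *)
under [X in _ + (X + _)]eq_bigr do rewrite big_ord1 cs0 mulr1 !addn0.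
under [X in _ + (_ + X)]eq_bigr do rewrite !add0n mul1r.
rewrite -(sum_csM r (fun p => V w a sigma h p 2)).
by rewrite /cs; ring.
Qed.

Lemma IV_Fhat : IV P (Fhat X r h) =
  (- (h / n%:R) * psi (gkernel r)
   + n%:R^-1 * (\sum_(s < r) \sum_(t < r)
      (-1) ^+ (s + t) / (2 ^+ (s + t) * s`!%:R * t`!%:R)
      * V w a sigma h (s + t) 2))%:E.
Proof.
have gMM := @gdom_smoothed_mixture _ _ w a _ h sigma_gt0 w_sum1 r 1 r 1 r_gt0.
have [iQ QE] := self_overlap_integral.
have iM := gdom_integrable gMM.
rewrite /IV.
transitivity (\int[mu]_x (n%:R^-1%:E * ((M x * (1 - M x))%:E - (self_overlap x)%:E)))%E.
  apply: eq_integral => x _; rewrite variance_Fhat -EFinB -EFinM.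
  by rewrite mulrC.
rewrite integralZl//; last first.
  by have := integrableB measurableT iM iQ.
rewrite integralB//.
rewrite QE lebesgue_EFin_Rintegral// Rintegral_smoothed_mixture// -EFinB -EFinM.
congr EFin.
rewrite -(sum_csM r (fun p => V w a sigma h p 2)).
by ring.
Qed.

End estimator.

Unset Implicit Arguments.
Set Strict Implicit.

Theorem theorem2 (R : realType) (d : measure_display) (T : measurableType d)
  (P : probability T R)
  (m : nat) (w mu sigma : 'I_m -> R) (n : nat) (X : 'I_n -> {RV P >-> R})
  (m_gt0 : (0 < m)%N) (n_gt0 : (0 < n)%N)
  (sigma_gt0 : forall j, 0 < sigma j)
  (w_gt0 : forall j, 0 < w j)
  (w_sum1 : \sum_(j < m) w j = 1)
  (X_indep : mutually_independent X)
  (X_density : forall i, has_density (X i) (mixture_pdf w mu sigma)) :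
  [/\ forall (h : R) (r : nat), 0 < h -> (0 < r)%N ->
        ISB P (Fhat X r h) (antideriv (mixture_pdf w mu sigma)) =
          (- (\sum_(s < r) \sum_(t < r)
                (-1) ^+ (s + t) / (2 ^+ (s + t) * s`!%:R * t`!%:R)
                * V w mu sigma h (s + t) 2)
           + 2 * (\sum_(s < r)
                (-1) ^+ s / (2 ^+ s * s`!%:R) * V w mu sigma h s 1)
           - V w mu sigma h 0 0)%:E
        /\
        IV P (Fhat X r h) =
          (- (h / n%:R) * psi (gkernel r)
           + n%:R^-1 * (\sum_(s < r) \sum_(t < r)
                (-1) ^+ (s + t) / (2 ^+ (s + t) * s`!%:R * t`!%:R)
                * V w mu sigma h (s + t) 2))%:E,
      forall r : nat, (0 < r)%N ->
        psi (gkernel r) =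
          - (Num.sqrt pi)^-1 *
            (\sum_(s < r) \sum_(t < r)
               OF (2 * s%:Z + 2 * t%:Z - 2)
               / (2 ^+ (2 * s + 2 * t) * s`!%:R * t`!%:R)) :> R
        /\
        psi (gkernel r) =
          Gamma (2 * r%:R - 3 / 2) / (pi * Gamma (2 * r%:R - 1))
          + \sum_(s < r.-1)
              Gamma (r%:R + s%:R - 1 / 2) / (pi * Gamma (r%:R + s%:R + 1))
              * reg_inc_beta (1 / 2) r%:R (s%:R + 1) :> R
    & (fun r : nat => psi (gkernel r) : R) =
        (fun r : nat => (pi * Num.sqrt (2 * r%:R - 2))^-1
           + Num.sqrt 2 / (pi `^ (3 / 2) * (4 * r%:R - 3)))
        +O_\oo (fun r : nat => r%:R `^ (- (3 / 2)))].
Proof.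
split.
- move=> h r h0 r0; split; first exact: ISB_Fhat.
  exact: IV_Fhat.
- by move=> r r0; split; [exact: psi_OF|exact: psi_beta].
- exact: psi_asymptotics.
Qed.
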